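(* Let $\tilde N>0$, $0<\tilde S<\tilde T$ and let $(\tilde t,\tilde x)$ be a point inside the hexagon, i.e. $0<\tilde t<\tilde T$ and $\max(0,\tilde t+\tilde S-\tilde T)<\tilde x<\tilde N+\min(\tilde t,\tilde S)$. Let $\rho\to\infty$ and let integers $S=S(\rho)$, $T=T(\rho)$, $N=N(\rho)$ satisfy $$S=\rho\tilde S+o(\rho),\qquad T=\rho\tilde T+o(\rho),\qquad N=\rho\tilde N+o(\rho).$$ For each $\rho$ consider the process $H_t$ with parameters $(N,T,S)$ (uniformly random families of $N$ non-intersecting paths, see context). Then the point processes $\{(\hat x,\hat t)\in\mathbb Z^2:\ \lfloor\rho\tilde x\rfloor+\hat x\in H_{\lfloor\rho\tilde t\rfloor+\hat t}\}$ have a limit as $\rho\to\infty$, and the limit is a determinantal point process on $\mathbb Z^2$ with translation-invariant kernel $$K(\hat x,\hat s;\hat y,\hat t)=\frac1{2\pi i}\int_{e^{-i\phi}}^{e^{i\phi}}(1+cw)^{\hat t-\hat s}\,w^{\hat x-\hat y-1}\,dw ,$$ where the integration is over the right arc of the unit circle (the arc $\{e^{iu}:-\phi\le u\le\phi\}$) from $e^{-i\phi}$ to $e^{i\phi}$ when $\hat s\ge\hat t$, and over the left arc (the arc $\{e^{iu}:\phi\le u\le 2\pi-\phi\}$) from $e^{-i\phi}$ to $e^{i\phi}$ when $\hat s<\hat t$. Here $$c=\sqrt{\frac{\tilde x(\tilde S+\tilde N-\tilde x)}{(\tilde T-\tilde t-\tilde S+\tilde x)(\tilde t+\tilde N-\tilde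 x)}},$$ $$\phi=\arccos\frac{-\tilde N(\tilde N+\tilde T)+(\tilde S+\tilde N-\tilde x)(\tilde t+\tilde N-\tilde x)+\tilde x(\tilde T+\tilde x-\tilde S-\tilde t)}{2\sqrt{\tilde x(\tilde S+\tilde N-\tilde x)(\tilde t+\tilde N-\tilde x)(\tilde x+\tilde T-\tilde S-\tilde t)}},$$ with the convention $\phi=0$ if the expression under the arccosine is greater than $1$ and $\phi=\pi$ if it is less than $-1$. Explicitly: for every $n\ge1$ and all pairwise distinct $(\hat x_1,\hat t_1),\dots,(\hat x_n,\hat t_n)\in\mathbb Z^2$, $$\lim_{\rho\to\infty}\mathrm{Prob}\{\lfloor\rho\tilde x\rfloor+\hat x_i\in H_{\lfloor\rho\tilde t\rfloor+\hat t_i},\ i=1,\dots,n\}=\det_{i,j=1,\dots,n}\big[K(\hat x_i,\hat t_i;\hat x_j,\hat t_j)\big],$$ and there is a point process (random subset) on $\mathbb Z^2$ having these determinants as correlation functions.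
   Context: Path model: let $N\ge1$ and $T\ge S\ge 0$ be integers. In the plane with coordinates $(t,x)$ put $X_i=(0,i-1)$ and $Y_i=(T,S+i-1)$ for $i=1,\dots,N$. Consider families of $N$ non-intersecting (pairwise vertex-disjoint) paths on $\mathbb Z^2$, the $i$-th connecting $X_i$ to $Y_i$, where each path is a polygonal line every link of which goes from some $(t,x)\in\mathbb Z^2$ to $(t+1,x)$ or $(t+1,x+1)$. Equip the finite set of such families with the uniform probability measure. For an integer time $t$, $H_t$ denotes the random $N$-point set of integers $x$ such that $(t,x)$ lies on one of the paths. All paths lie in a hexagon; in the limit its rescaled interior is $\{0<\tilde t<\tilde T,\ \max(0,\tilde t+\tilde S-\tilde T)<\tilde x<\tilde N+\min(\tilde t,\tilde S)\}$. A point process on $\mathbb Z^2$ is determinantal with kernel $K$ if for all distinct $(x_1,t_1),\dots,(x_n,t_n)$ the probability that all these points belong to the random configuration equals $\det[K(x_i,t_i;x_j,t_j)]_{i,j=1}^n$. *)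

(* Defs.v *)
(* MathComp / MathComp-Analysis *)
From HB Require Import structures.
From mathcomp Require Import all_boot all_order all_algebra.
From mathcomp Require Import complex.
From mathcomp Require Import all_classical all_reals all_analysis.

Set Implicit Arguments.
Unset Strict Implicit.
Unset Printing Implicit Defensive.

Import Order.TTheory GRing.Theory Num.Theory.
Import numFieldNormedType.Exports.

Local Open Scope classical_set_scope.
Local Open Scope complex_scope.
Local Open Scope ring_scope.

(* Lets the Landau notation [=o_ +oo] be used for functions of a real variable. *)
Canonical pinfty_nbhs_filter_on (R : numFieldType) :=
  FilterType (pinfty_nbhs R) (@filter_filter R _ proper_pinfty_nbhs).

(** Families of non-intersecting lattice paths *)

(* A path with T links, starting at a prescribed vertex, is encoded by its
   links: [b k] says whether the link from time k to time k.+1 goes up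
   ((t,x) -> (t+1,x+1)) or is horizontal ((t,x) -> (t+1,x)). *)
Definition links (T : nat) := {ffun 'I_T -> bool}.

(* Ordinate at time t of the path with links b starting at (0, x0). *)
Definition ordinate (T : nat) (x0 : nat) (b : links T) (t : nat) : nat :=
  (x0 + \sum_(k < T | (k < t)%N) b k)%N.

Definition path_family (N T : nat) := {ffun 'I_N -> links T}.

(* The paths are indexed from 0: the path i goes from (0, i) to (T, S + i).
   Every link advances time by one, so two paths share a vertex iff they have
   the same ordinate at the same time. *)
Definition nonintersecting (N T S : nat) : {set path_family N T} :=
  [set p : path_family N T |
    [forall i : 'I_N, ordinate i (p i) T == (S + i)%N] &&
    [forall i : 'I_N, forall j : 'I_N, (i != j) ==>
       [forall t : 'I_T.+1, ordinate i (p i) t != ordinate j (p j) t]]].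

(* [in_H p t x] : the point (t, x) lies on one of the paths, i.e. x \in H_t.
   There is no such x when t is outside {0, ..., T}. *)
Definition in_H (N T : nat) (p : path_family N T) (t x : int) : bool :=
  [exists i : 'I_N, exists k : 'I_T.+1,
     (t == k%:Z) && (x == (ordinate i (p i) k)%:Z)].

Definition uniform_prob (R : realType) (F : finType) (A : {set F})
  (E : pred F) : R := #|[set f in A | E f]|%:R / #|A|%:R.

(* Points of Z^2 are written (x, t), position first.  Probability that all the
   points (x0 + x_i, t0 + t_i) belong to the random configuration. *)
Definition hit_prob (R : realType) (N T S : nat) (x0 t0 : int) (n : nat)
  (pts : 'I_n -> int * int) : R :=
  uniform_prob R (nonintersecting N T S) (fun p =>
    [forall i, in_H p (t0 + (pts i).2) (x0 + (pts i).1)]).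

(** Point processes on Z^2 *)

Definition point_process (R : realType) (d : measure_display)
  (Omega : measurableType d) (P : probability Omega R)
  (X : Omega -> set (int * int)) : Prop :=
  forall q : int * int, measurable [set w | X w q].

Definition correlation_det (R : realType)
  (K : int * int -> int * int -> R[i]) (n : nat)
  (pts : 'I_n -> int * int) : R[i] :=
  \det (\matrix_(i < n, j < n) K (pts i) (pts j)).

Definition determinantal (R : realType) (d : measure_display)
  (Omega : measurableType d) (P : probability Omega R)
  (X : Omega -> set (int * int)) (K : int * int -> int * int -> R[i]) : Prop :=
  forall (n : nat) (pts : 'I_n -> int * int), (0 < n)%N -> injective pts ->
    (fine (P [set w | forall i, X w (pts i)]))%:C = correlation_det K pts.

(** Contour integrals along arcs of the unit circle *)

Definition expi (R : realType) (u : R) : R[i] := cos u +i* sin u.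

Definition complex_integral (R : realType) (a b : R) (g : R -> R[i]) : R[i] :=
  (\int[lebesgue_measure]_(u in `[a, b]) complex.Re (g u))
  +i* (\int[lebesgue_measure]_(u in `[a, b]) complex.Im (g u)).

(* Integral of f(w) dw along w = e^{iu}, u running monotonically from a to b
   (clockwise if b < a). *)
Definition arc_integral (R : realType) (a b : R) (f : R[i] -> R[i]) : R[i] :=
  let g u := f (expi u) * ((0 +i* 1) * expi u) in
  if a <= b then complex_integral a b g else - complex_integral b a g.

(** The kernel *)

(* Both arcs run from e^{-i phi} to e^{i phi}; the left arc
   {e^{iu} : phi <= u <= 2 pi - phi} is therefore traversed clockwise. *)
Definition sine_kernel (R : realType) (c phi : R) (p q : int * int) : R[i] :=
  let: (x, s) := p in let: (y, t) := q in
  let f (w : R[i]) := (1 + c%:C * w) ^ (t - s) * w ^ (x - y - 1) in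
  (2 * pi%:C * (0 +i* 1))^-1 *
  (if t <= s then arc_integral (- phi) phi f
   else arc_integral (2 * pi - phi) phi f).

Definition kernel_c (R : realType) (N T S t x : R) : R :=
  Num.sqrt ((x * (S + N - x)) / ((T - t - S + x) * (t + N - x))).

Definition cos_phi (R : realType) (N T S t x : R) : R :=
  (- (N * (N + T)) + (S + N - x) * (t + N - x) + x * (T + x - S - t)) /
  (2 * Num.sqrt (x * (S + N - x) * (t + N - x) * (x + T - S - t))).

Definition kernel_phi (R : realType) (N T S t x : R) : R :=
  let a := cos_phi N T S t x in
  if 1 < a then 0 else if a < -1 then pi else acos a.

(* Main.v *)
Require Import Defs.
From HB Require Import structures.
From mathcomp Require Import all_boot all_order all_algebra.
From mathcomp Require Import fingroup perm complex.
From mathcomp Require Import all_classical all_reals all_analysis.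
From mathcomp Require Import measurable_realfun.
From mathcomp Require Import zify ring lra.

Set Implicit Arguments.
Unset Strict Implicit.
Unset Printing Implicit Defensive.

Import Order.TTheory GRing.Theory Num.Theory.
Import numFieldNormedType.Exports.

Local Open Scope classical_set_scope.
Local Open Scope complex_scope.
Local Open Scope ring_scope.

(** The correlation functions of the path model are computed exactly for finite
    parameters, and their limit is found by diagonalizing the kernel.

    _Exact kernel_.  By the argument of Lindstrom, Gessel and Viennot
    (sum_families_det) the weighted number of non-intersecting families is a
    determinant of weighted numbers of single paths.  Giving the weight 1 + h to
    the visits of n marked points and reading off the top coefficient in h, one
    finds that the probability that the n points are all occupied is the
    determinant of a kernel in the form of Eynard and Mehta (card_all_occupied,
    hit_prob_det).

    _Diagonalization_.  On the slice at time t let D be the difference operator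
    of the Hahn polynomials.  It is selfadjoint, its eigenfunctions of degree
    k < N span what the starting points and the end points generate, and the
    transition between consecutive times intertwines the operators D of these
    times.  At equal times the kernel is therefore the spectral projection of D
    on its N top eigenvalues, and at different times it is the projection, or
    minus the complementary projection, composed with transitions
    (kernel_mx_ge, kernel_mx_lt).

    _Local limit_.  After division by rho ^ 2 the coefficients of D near the
    point of observation converge to constants, so the matrix elements of the
    powers of D converge to those of a translation invariant operator, which is
    multiplication by symb th = a + b cos th up to conjugation (moments).  As the
    moments converge, so do the sums of continuous functions of the eigenvalues,
    by polynomial approximation.  The N-th eigenvalue also has a limit, the
    threshold; the symbol crosses it only at the angle phi, so that squeezing the
    step function between continuous ones gives the limit of the spectral
    projection (projection_cvg): the integral of cos (n th) over the angles where
    symb th exceeds the threshold.  This also covers the frozen regions, where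
    phi is 0 or pi.  The transitions between different times become factors
    1 + c w and their inverses, w = e^(i th), and the result is the contour
    integral of the theorem times c ^ (x - y) (sine_kernel_geE,
    sine_kernel_ltE).  That factor does not change determinants.

    _Limit process_.  Convergence of all the correlation functions gives
    convergence of the probabilities of all the occupation patterns of finite
    sets of points.  The limits are consistent, and a random set with these
    pattern probabilities is constructed from a uniform random number by
    repeatedly splitting the unit interval (process_of_limits). *)

(** * Path families and determinants *)

Section LGV.
Variable F : comRingType.

(** Total weight of the paths from (0, i) to (t, y), where the weight of a path
    is the product of om over its vertices. *)
Definition path_sum (om : nat -> int -> F) (i : nat) : nat -> int -> F :=
  fix path_sum t y := match t with
    | 0%N => om 0%N y * (y == i%:Z)%:R
    | t'.+1 => om t y * (path_sum t' y + path_sum t' (y - 1))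
  end.

(** The end points are arbitrary because the induction on time moves them. *)
Definition families_to (N T : nat) (y : 'I_N -> int) : {set path_family N T} :=
  [set p : path_family N T |
    [forall i : 'I_N, (ordinate i (p i) T)%:Z == y i] &&
    [forall i : 'I_N, forall j : 'I_N, (i != j) ==>
       [forall t : 'I_T.+1, ordinate i (p i) t != ordinate j (p j) t]]].

Definition family_weight (om : nat -> int -> F) N T (p : path_family N T) : F :=
  \prod_(t < T.+1) \prod_(i < N) om t (ordinate i (p i) t)%:Z.

Definition extend N T (qb : path_family N T * {ffun 'I_N -> bool}) :
    path_family N T.+1 :=
  [ffun i => [ffun k => if unlift ord_max k is Some k' then qb.1 i k'
                        else qb.2 i]].

Lemma unlift_ord_max_widen T (k : 'I_T) :
  unlift ord_max (widen_ord (leqnSn T) k) = Some k.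
Proof.
rewrite (_ : widen_ord _ k = lift ord_max k) ?liftK//.
by apply: val_inj; rewrite /= /bump leqNgt ltn_ord.
Qed.

Lemma extend_bij N T : bijective (@extend N T).
Proof.
exists (fun p : path_family N T.+1 =>
  ([ffun i => [ffun k => p i (lift ord_max k)]], [ffun i => p i ord_max])).
  move=> [q b]; congr pair; apply/ffunP => i; last by rewrite !ffunE unlift_none.
  by rewrite ffunE; apply/ffunP => k; rewrite !ffunE liftK.
move=> p; apply/ffunP => i; apply/ffunP => k; rewrite !ffunE.
by case: unliftP => [j ->|->] /=; rewrite ?ffunE /= ?ffunE.
Qed.

Lemma ordinate_extend N T (q : path_family N T) b (i : 'I_N) t : (t <= T)%N ->
  ordinate i (extend (q, b) i) t = ordinate i (q i) t.
Proof.
move=> tT; rewrite /ordinate big_mkcond big_ord_recr /= ltnNge tT /= addn0.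
congr addn; rewrite [RHS]big_mkcond; apply: eq_bigr => k _.
by rewrite !ffunE unlift_ord_max_widen.
Qed.

Lemma ordinate_extend_last N T (q : path_family N T) b (i : 'I_N) :
  ordinate i (extend (q, b) i) T.+1 = (ordinate i (q i) T + b i)%N.
Proof.
rewrite /ordinate -addnA; congr addn.
rewrite big_mkcond big_ord_recr /= ltnSn !ffunE unlift_none /=; congr addn.
rewrite [RHS]big_mkcond; apply: eq_bigr => k _.
by rewrite !ffunE unlift_ord_max_widen ltn_ord (ltn_trans (ltn_ord k)).
Qed.

Lemma extend_families_to N T (y : 'I_N -> int) q b : injective y ->
  (extend (q, b) \in families_to T.+1 y) =
  (q \in families_to T (fun i => y i - (b i : nat)%:Z)).
Proof.
move=> yinj; rewrite !inE.
have -> : [forall i : 'I_N, (ordinate i (extend (q, b) i) T.+1)%:Z == y i] =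
    [forall i : 'I_N, (ordinate i (q i) T)%:Z == y i - (b i : nat)%:Z].
  apply: eq_forallb => i; rewrite ordinate_extend_last PoszD.
  by rewrite [RHS]eq_sym subr_eq eq_sym.
case: forallP => //= yE; apply/idP/idP => /forallP H; apply/forallP => i;
    apply/forallP => j; apply/implyP => ij; apply/forallP => t.
  have /forallP/(_ (widen_ord (leqnSn _) t)) := implyP (forallP (H i) j) ij.
  by rewrite !ordinate_extend //= -ltnS.
have /forallP Hij := implyP (forallP (H i) j) ij.
have [tT|tT] := leqP t T.
  by rewrite !ordinate_extend //; apply: (Hij (Ordinal (tT : (t < T.+1)%N))).
have -> : nat_of_ord t = T.+1 by apply/eqP; rewrite eqn_leq tT andbT -ltnS.
rewrite !ordinate_extend_last; apply: contraNneq ij => e.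
apply/eqP/yinj/eqP.
move: (yE i) (yE j); rewrite ![_ == _ - _]eq_sym !subr_eq -!PoszD e.
by move=> /eqP -> /eqP ->.
Qed.

Lemma family_weight_extend om N T (q : path_family N T) b :
  family_weight om (extend (q, b)) = family_weight om q *
  \prod_(i < N) om T.+1 (ordinate i (q i) T + b i)%N%:Z.
Proof.
rewrite /family_weight big_ord_recr /=; congr (_ * _).
  apply: eq_bigr => t _; apply: eq_bigr => i _.
  by rewrite ordinate_extend// -ltnS.
by apply: eq_bigr => i _; rewrite ordinate_extend_last.
Qed.

(** The last link of each path is free: a family up to time T + 1 is a family up
    to time T together with the set of the paths that then go up.  No condition
    at time T + 1 is left, because the end points are distinct. *)
Lemma sum_families_toS om N T (y : 'I_N -> int) : injective y ->
  \sum_(p in families_to T.+1 y) family_weight om p =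
  \sum_(b : {ffun 'I_N -> bool}) (\prod_i om T.+1 (y i)) *
    \sum_(q in families_to T (fun i => y i - (b i : nat)%:Z)) family_weight om q.
Proof.
move=> yinj; rewrite (reindex (@extend N T)); last first.
  by apply: onW_bij; exact: extend_bij.
rewrite big_mkcond -(pair_bigA _ (fun q b =>
  if extend (q, b) \in families_to T.+1 y then
  family_weight om (extend (q, b)) else 0)) exchange_big /=.
apply: eq_bigr => b _; rewrite big_distrr /= [RHS]big_mkcond.
apply: eq_bigr => q _; rewrite extend_families_to//; case: ifP => //.
rewrite inE => /andP[/forallP qy _]; rewrite family_weight_extend mulrC.
congr (_ * _); apply: eq_bigr => i _; congr om.
by have /eqP := qy i; rewrite PoszD => ->; rewrite subrK.
Qed.

Lemma sum_families_to_tie om N T (y : 'I_N -> int) i j : i != j -> y i = y j ->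
  \sum_(q in families_to T y) family_weight om q = 0.
Proof.
move=> ij yij; rewrite big_pred0// => q; rewrite inE; apply/negP.
move=> /andP[/forallP qy /forallP H].
have /forallP/(_ ord_max)/negP := implyP (forallP (H i) j) ij; apply.
by have /eqP := qy i; rewrite yij; have /eqP <- := qy j => -[->].
Qed.

Lemma det_tie om N T (y : 'I_N -> int) i j : i != j -> y i = y j ->
  \det (\matrix_(i < N, j < N) path_sum om i T (y j)) = 0.
Proof.
move=> ij yij; rewrite -det_tr; apply: (determinant_alternate ij) => k.
by rewrite !mxE yij.
Qed.

Lemma strict_incr_perm_id N (s : 'S_N) :
  (forall i j : 'I_N, (i < j)%N -> (s i < s j)%N) -> s = 1%g.
Proof.
move=> s_incr.
(* A strictly increasing map satisfies i <= s i, and the sums of both sides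
   are equal. *)
have le_s k : forall i : 'I_N, i = k :> nat -> (i <= s i)%N.
  elim: k => [|k IH] i ik; first by rewrite ik.
  have kN : (k < N)%N by rewrite (leq_trans _ (ltn_ord i))// ik.
  have := IH (Ordinal kN) erefl; rewrite /= ik => /leq_ltn_trans; apply.
  by apply: s_incr; rewrite /= ik.
have : (\sum_(i < N) (s i - i) = 0)%N.
  rewrite sumnB; last by move=> i _; apply: le_s erefl.
  by rewrite [X in (_ - X)%N](reindex_inj (@perm_inj _ s)) subnn.
move/eqP; rewrite sum_nat_eq0 => /forallP H.
apply/permP => i; rewrite perm1; apply/val_inj/eqP.
by rewrite eqn_leq (le_s i i erefl) andbT -subn_eq0; apply: (H i).
Qed.

(** Lindstrom, Gessel and Viennot: for increasing end points the sum over
    non-intersecting families is a determinant.  By induction on time: expanding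
    the determinant along the choices of the last links gives the same
    recursion, because a choice that makes two end points equal contributes zero
    on both sides, and all the others are increasing again. *)
Lemma sum_families_det om N T (y : 'I_N -> int) :
  (forall i j : 'I_N, (i < j)%N -> y i < y j) ->
  \sum_(p in families_to T y) family_weight om p =
  \det (\matrix_(i < N, j < N) path_sum om i T (y j)).
Proof.
elim: T y => [|T IH] y yincr; last first.
  have yinj : injective y.
    move=> i j yij; apply/val_inj; have [/yincr|/yincr|//] := ltngtP i j.
      by rewrite yij ltxx.
    by rewrite yij ltxx.
  rewrite sum_families_toS// {1}/determinant.
  transitivity (\sum_(b : {ffun 'I_N -> bool}) (\prod_i om T.+1 (y i)) *
     \det (\matrix_(i < N, j < N) path_sum om i T (y j - (b j : nat)%:Z))).
    apply: eq_bigr => b _; congr (_ * _).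
    have [/injectiveP binj|] := boolP (injectiveb (fun i => y i - (b i : nat)%:Z)).
      apply: IH => i j ij; have := yincr _ _ ij.
      rewrite -[y i < _]lez1D lt_neqAle => yij.
      apply/andP; split; first by apply/eqP => /binj ie; rewrite ie ltnn in ij.
      by move: yij; case: (b i); case: (b j) => /=; lia.
    move=> /injectivePn[i [j ij e]].
    by rewrite (sum_families_to_tie _ _ ij)// (@det_tie _ _ _ (fun i => y i - (b i : nat)%:Z) i j).
  rewrite -big_distrr /= /determinant exchange_big /= big_distrr /=.
  apply: eq_bigr => s _; rewrite -big_distrr /= mulrCA; congr (_ * _).
  transitivity (\prod_i (om T.+1 (y (s i)) * (\sum_(c : bool) path_sum om i T (y (s i) - (c : nat)%:Z)))).
    rewrite big_split /= [in LHS](reindex_inj (@perm_inj _ s)).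
    congr (_ * _); rewrite bigA_distr_bigA /=.
    pose g (b : {ffun 'I_N -> bool}) : {ffun 'I_N -> bool} := [ffun i => b (s i)].
    have gbij : bijective g.
      exists (fun b : {ffun 'I_N -> bool} => [ffun i => b (s^-1 i)%g]) => b; apply/ffunP => i;
        by rewrite !ffunE ?permK ?permKV.
    rewrite [RHS](reindex g); last by apply: onW_bij.
    by apply: eq_bigr => b _; apply: eq_bigr => i _; rewrite mxE ffunE.
  apply: eq_bigr => i _; rewrite mxE /= big_bool /= subr0; congr (_ * _).
  by rewrite addrC.
have ordinate0 (p : path_family N 0) (i : 'I_N) t : ordinate i (p i) t = i.
  by rewrite /ordinate big_ord0 addn0.
transitivity (\prod_(i < N) (om 0%N (y i) * (y i == i%:Z)%:R)).
  have [/forallP yE|] := boolP [forall i : 'I_N, y i == i%:Z]; last first.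
    move=> /forallPn[i yi]; rewrite big_pred0 => [|p]; last first.
      rewrite inE; apply/negP => /andP[/forallP/(_ i)].
      by rewrite ordinate0 eq_sym (negbTE yi).
    by rewrite (bigD1 i)//= (negbTE yi) mulr0 mul0r.
  pose p0 : path_family N 0 := [ffun=> [ffun=> false]].
  rewrite (big_pred1 p0) => [|p]; last first.
    have -> : p = p0 by apply/ffunP => i; apply/ffunP => -[].
    rewrite [RHS]/= eqxx inE; apply/andP; split.
      by apply/forallP => i; rewrite ordinate0 eq_sym.
    apply/forallP => i; apply/forallP => j; apply/implyP => ij.
    by apply/forallP => t; rewrite !ordinate0.
  rewrite /family_weight big_ord1; apply: eq_bigr => i _.
  by rewrite ordinate0 yE mulr1 (eqP (yE i)).
rewrite /determinant (bigD1 1%g) //= [X in _ + X]big1 ?addr0 => [|s s1].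
  rewrite odd_perm1 mul1r; apply: eq_bigr => i _; by rewrite mxE perm1.
have [/forallP yE|] := boolP [forall i : 'I_N, y (s i) == i%:Z].
  case/negP: s1; rewrite -eq_invg1; apply/eqP; apply: strict_incr_perm_id.
  move=> i j ij; have := yincr _ _ ij.
  by rewrite -{1}(permKV s i) -{1}(permKV s j) !(eqP (yE _)).
move=> /forallPn[i yi].
by rewrite (bigD1 i)//= mxE /= (negbTE yi) mulr0 mul0r mulr0.
Qed.
End LGV.

(** * Correlation functions of the path model *)

(** Sylvester's identity: it replaces a determinant of the size of the number
    of paths by one of the size of the number of points. *)
Lemma det_mulC_add1 (F : comRingType) m n (X : 'M[F]_(m, n)) (Y : 'M[F]_(n, m)) :
  \det (1%:M + X *m Y) = \det (1%:M + Y *m X).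
Proof.
have XY : block_mx 1%:M X 0 1%:M *m block_mx 1%:M (- X) Y 1%:M =
    block_mx (1%:M + X *m Y) 0 Y 1%:M.
  by rewrite mulmx_block !mul1mx !mul0mx !mulmx1 addNr !add0r.
have YX : block_mx 1%:M (- X) Y 1%:M *m block_mx 1%:M X 0 1%:M =
    block_mx 1%:M 0 Y (1%:M + Y *m X).
  by rewrite mulmx_block !mul1mx !mulmx0 !mulmx1 !addr0 subrr addrC.
have := congr1 determinant XY; have := congr1 determinant YX.
by rewrite !det_mulmx !det_lblock !det_ublock !det1 !mul1r !mulr1 => <- <-.
Qed.

Section Binomial.
Variable F : comRingType.

(** The number of paths with m links that rise by z, for z of any sign. *)
Definition binz (m : nat) (z : int) : F :=
  if z is Posz k then 'C(m, k)%:R else 0.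

Lemma binz0 z : binz 0 z = (z == 0)%:R.
Proof. by case: z => [[|k]|k]. Qed.

Lemma binzS m z : binz m.+1 z = binz m z + binz m (z - 1).
Proof.
case: z => [[|k]|k]; first by rewrite /= !bin0 addr0.
  by rewrite (_ : k.+1%:Z - 1 = k%:Z); [rewrite /= binS natrD | lia].
rewrite (_ : Negz k - 1 = Negz k.+1); last by lia.
by rewrite /= addr0.
Qed.

Lemma path_sum1 i t y : path_sum (fun _ _ => 1 : F) i t y = binz t (y - i%:Z).
Proof.
elim: t y => [|t IH] y; first by rewrite /= mul1r binz0 subr_eq0.
by rewrite /= mul1r binzS !IH addrAC.
Qed.

End Binomial.

(** The entry (i, j) counts the paths from the starting point i to the end
    point j, so that the determinant counts the non-intersecting families. *)
Definition gram (F : comRingType) N T S : 'M[F]_N :=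
  \matrix_(i, j) binz F T ((S + j)%:Z - i%:Z).

Lemma nonintersecting_families_to N T S :
  nonintersecting N T S = families_to T (fun i : 'I_N => (S + i)%:Z).
Proof.
by apply/setP => p; rewrite !inE; congr andb; apply: eq_forallb => i.
Qed.

Lemma sum_nonintersecting (F : comRingType) (om : nat -> int -> F) N T S :
  \sum_(p in nonintersecting N T S) family_weight om p =
  \det (\matrix_(i < N, j < N) path_sum om i T (S + j)%:Z).
Proof.
rewrite nonintersecting_families_to sum_families_det// => i j ij.
by rewrite ltz_nat ltn_add2l.
Qed.

Lemma card_nonintersecting (F : comRingType) N T S :
  #|nonintersecting N T S|%:R = \det (gram F N T S).
Proof.
rewrite -sum1_card natr_sum.
transitivity (\sum_(p in nonintersecting N T S) family_weight (fun _ _ => 1 : F) p).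
  apply: eq_bigr => p _; rewrite /family_weight big1// => t _.
  by rewrite big1.
rewrite sum_nonintersecting; congr (\det _); apply/matrixP => i j.
by rewrite !mxE path_sum1.
Qed.

Lemma card_nonintersecting_gt0 N T S : (S <= T)%N ->
  (0 < #|nonintersecting N T S|)%N.
Proof.
move=> ST; apply/card_gt0P.
(* All the paths go up during the first S steps and are horizontal
   afterwards. *)
exists [ffun=> [ffun k : 'I_T => (k < S)%N]].
have ordE (i : 'I_N) t : ordinate i ([ffun=> [ffun k : 'I_T => (k < S)%N]] i) t =
    (i + \sum_(k < T | (k < t)%N) (k < S))%N.
  by congr addn; apply: eq_bigr => k _; rewrite !ffunE.
rewrite inE; apply/andP; split.
  have sumS : (\sum_(k < T) (k < S) = S)%N.
    rewrite -[RHS]card_ord -sum1_card (big_ord_widen T (fun=> 1%N) ST).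
    by rewrite [RHS]big_mkcond; apply: eq_bigr => k _; case: (k < S)%N.
  apply/forallP => i; rewrite ordE addnC eqn_add2r (eq_bigl predT) ?sumS// => k.
  exact: ltn_ord.
apply/forallP => i; apply/forallP => j; apply/implyP => ij; apply/forallP => t.
by rewrite !ordE eqn_add2r.
Qed.

Section Correlation.
Variables (F : fieldType) (N T S n : nat) (pt : 'I_n -> nat) (px : 'I_n -> int).
Hypothesis pts_inj : injective (fun a => (px a, pt a)).
Hypothesis ptT : forall a, (pt a <= T)%N.

Definition start_mx : 'M[F]_(N, n) :=
  \matrix_(i, a) binz F (pt a) (px a - i%:Z).
Definition end_mx : 'M[F]_(n, N) :=
  \matrix_(a, j) binz F (T - pt a) ((S + j)%:Z - px a).
Definition between_mx : 'M[F]_n :=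
  \matrix_(a, b) if (pt a < pt b)%N then binz F (pt b - pt a) (px b - px a) else 0.
(** The correlation kernel in the form of Eynard and Mehta: the inverse of
    the Gram matrix joins the transitions to the end points with those from
    the starting points, and direct transitions forward in time are
    subtracted. *)
Definition kernel_mx : 'M[F]_n :=
  end_mx *m invmx (gram F N T S) *m start_mx - between_mx.

Definition at_pts a (t : nat) (y : int) := (pt a == t) && (px a == y).

Section Weighted.
Variable h : F.

(** Visits of a marked point get the weight 1 + h, so that the expansion in h
    records which marked points are occupied. *)
Definition pts_weight (t : nat) (y : int) : F :=
  \prod_a (if at_pts a t y then 1 + h else 1).

Lemma pts_weightE t y (f : 'I_n -> F) (g : F) :
  (forall a, at_pts a t y -> f a = g) ->
  pts_weight t y * g = g + h * \sum_(a | at_pts a t y) f a.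
Proof.
move=> fg; have [[a aty]|none] := pselect (exists a, at_pts a t y); last first.
  rewrite /pts_weight big1 => [|a _]; last by case: ifP => // /(ex_intro _ a)/none.
  by rewrite big_pred0 ?mulr0 ?addr0 ?mul1r// => a; apply/negP => /(ex_intro _ a)/none.
have uniq_a b : at_pts b t y = (b == a).
  apply/idP/eqP => [|->//]; case/andP: aty => /eqP at_ /eqP ay /andP[/eqP bt /eqP by_].
  by apply: pts_inj; rewrite at_ ay bt by_.
rewrite /pts_weight (bigD1 a)//= aty big1 ?mulr1 => [|b ba]; last first.
  by rewrite uniq_a (negbTE ba).
rewrite (eq_bigl (pred1 a)) => [|b]; last by rewrite uniq_a.
by rewrite big_pred1_eq fg// mulrDl mul1r.
Qed.

(** Total weight of the paths that reach (t, y), without the weight of that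
    last vertex. *)
Definition arrive (i t : nat) (y : int) : F :=
  if t is t'.+1 then path_sum pts_weight i t' y + path_sum pts_weight i t' (y - 1)
  else (y == i%:Z)%:R.

Lemma path_sum_arrive i t y :
  path_sum pts_weight i t y = pts_weight t y * arrive i t y.
Proof. by case: t. Qed.

(** Decomposition of the weighted paths according to the last marked point
    where the excess weight h, and not 1, is chosen; after it the path is
    unweighted. *)
Lemma arriveE i t y : arrive i t y = binz F t (y - i%:Z) +
  h * \sum_(a | (pt a < t)%N) arrive i (pt a) (px a) * binz F (t - pt a) (y - px a).
Proof.
elim: t y => [|t IH] y; first by rewrite big_pred0 //= mulr0 addr0 binz0 subr_eq0.
have psE z : path_sum pts_weight i t z = binz F t (z - i%:Z) +
    h * \sum_(a | (pt a <= t)%N) arrive i (pt a) (px a) * binz F (t - pt a) (z - px a).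
  rewrite path_sum_arrive.
  rewrite (@pts_weightE _ _ (fun a => arrive i (pt a) (px a))); last first.
    by move=> a /andP[/eqP -> /eqP ->].
  rewrite IH -addrA -mulrDr; congr (_ + _ * _).
  rewrite [in RHS](bigID (fun a => (pt a < t)%N)) /=; congr (_ + _).
    apply: eq_bigl => a; case: (ltngtP (pt a) t) => //.
  rewrite [RHS](bigID (fun a => px a == z)) /= [X in _ = _ + X]big1 ?addr0; last first.
    move=> a /andP[/andP[at1 at2] az].
    rewrite (_ : (t - pt a)%N = 0%N) ?binz0 ?subr_eq0; last by lia.
    by rewrite eq_sym (negbTE az) mulr0.
  apply: eq_big => [a|a]; first by rewrite /at_pts; lia.
  move=> /andP[/eqP -> /eqP ->].
  by rewrite subnn subrr binz0 mulr1.
rewrite /= !psE binzS [y - 1 - _]addrAC addrACA -mulrDr -big_split /=.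
congr (_ + _ * _); apply: eq_bigr => a at_.
by rewrite -mulrDr subSn // binzS [y - 1 - _]addrAC.
Qed.

Definition arrive_mx : 'M[F]_(N, n) := \matrix_(i, a) arrive i (pt a) (px a).

Lemma arrive_mxE : arrive_mx *m (1%:M - h *: between_mx) = start_mx.
Proof.
apply/matrixP => i b; rewrite mulmxBr mulmx1 -scalemxAr !mxE arriveE.
rewrite -addrA -[RHS]addr0; congr (_ + _); apply/eqP; rewrite subr_eq0.
apply/eqP; congr (_ * _); rewrite [LHS]big_mkcond; apply: eq_bigr => a _.
by rewrite !mxE; case: ifP; rewrite ?mulr0.
Qed.

Lemma path_sum_mxE :
  \matrix_(i < N, j < N) path_sum pts_weight i T (S + j)%:Z =
  gram F N T S + h *: (arrive_mx *m end_mx).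
Proof.
apply/matrixP => i j; rewrite !mxE path_sum_arrive.
rewrite (@pts_weightE _ _ (fun a => arrive i (pt a) (px a))); last first.
  by move=> a /andP[/eqP -> /eqP ->].
rewrite arriveE -addrA -mulrDr; congr (_ + _ * _).
rewrite [RHS](bigID (fun a => (pt a < T)%N)) /=; congr (_ + _).
  by apply: eq_bigr => a _; rewrite !mxE.
rewrite [RHS](bigID (fun a => px a == (S + j)%:Z)) /= [X in _ = _ + X]big1 ?addr0; last first.
  move=> a /andP[at1 az]; rewrite !mxE (_ : (T - pt a)%N = 0%N) ?binz0 ?subr_eq0; last by lia.
  by rewrite eq_sym (negbTE az) mulr0.
apply: eq_big => [a|a]; first by rewrite /at_pts -leqNgt eqn_leq ptT.
by move=> /andP[/eqP aT /eqP aS]; rewrite !mxE aT aS subnn subrr binz0 mulr1.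
Qed.

(** Off the diagonal the matrix only leads to later points, and a permutation
    other than the identity cannot move all the points that it displaces
    forward in time. *)
Lemma det_1_sub_between : \det (1%:M - h *: between_mx) = 1.
Proof.
rewrite /determinant (bigD1 1%g) //= [X in _ + X]big1 ?addr0 => [|s s1].
  rewrite odd_perm1 mul1r big1// => i _.
  by rewrite !mxE perm1 eqxx ltnn mulr0 subr0.
have [i iP] : exists i, (s i != i) && ~~ (pt i < pt (s i))%N.
  apply: contrapT => none; case/negP: s1; apply/eqP/permP => i; rewrite perm1.
  have H j : (s j != j) ==> (pt j < pt (s j))%N.
    by apply/implyP => sj; apply: contrapT => /negP jP; apply: none; exists j; rewrite sj.
  have le_pt j : (pt j <= pt (s j))%N.
    by have := H j; case: eqVneq => [->//|_ /= /ltnW].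
  have : (\sum_j (pt (s j) - pt j) = 0)%N.
    by rewrite sumnB// [X in (_ - X)%N](reindex_inj (@perm_inj _ s)) subnn.
  move/eqP; rewrite sum_nat_eq0 => /forallP/(_ i)/=; rewrite subn_eq0 leqNgt.
  by move=> siN; have := H i; rewrite (negbTE siN) implybF negbK => /eqP.
case/andP: iP => si /negbTE ptsi.
by rewrite (bigD1 i)//= !mxE ptsi mulr0 subr0 eq_sym (negbTE si) mul0r mulr0.
Qed.

Hypothesis gram_unit : gram F N T S \in unitmx.

(** The marked points change the Gram matrix by a product that factors
    through the n points. Sylvester's identity reduces the determinant to one
    of size n, and multiplying by the matrix of determinant 1 of direct
    transitions removes the weights from the factor of the starting points. *)
Lemma det_path_sum :
  \det (\matrix_(i < N, j < N) path_sum pts_weight i T (S + j)%:Z) =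
  \det (gram F N T S) * \det (1%:M + h *: kernel_mx).
Proof.
rewrite path_sum_mxE -{1}[gram F N T S]mulmx1.
have -> : gram F N T S *m 1%:M + h *: (arrive_mx *m end_mx) =
    gram F N T S *m (1%:M + (invmx (gram F N T S) *m arrive_mx) *m (h *: end_mx)).
  rewrite mulmxDr; congr (_ + _).
  by rewrite -!mulmxA mulKVmx// scalemxAr.
rewrite det_mulmx det_mulC_add1; congr (_ * _).
rewrite -[LHS]mulr1 -[X in _ * X]det_1_sub_between -det_mulmx mulmxDl mul1mx.
apply: (congr1 determinant); rewrite -!mulmxA arrive_mxE /kernel_mx scalerBr -addrA; congr (_ + _).
by rewrite addrC -!scalemxAl !mulmxA.
Qed.

Definition occupied (p : path_family N T) : {set 'I_n} :=
  [set a | in_H p (pt a)%:Z (px a)].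

Lemma family_weight_pts p : p \in nonintersecting N T S ->
  family_weight pts_weight p = (1 + h) ^+ #|occupied p|.
Proof.
rewrite inE => /andP[_ /forallP pNI].
rewrite /family_weight; under eq_bigr => t _ do rewrite exchange_big /=.
rewrite exchange_big /= -prodr_const [RHS]big_mkcond /=; apply: eq_bigr => a _.
rewrite inE; case: ifPn => [|none].
  move=> /existsP[i /existsP[k /andP[/eqP[atk] /eqP ak]]].
  rewrite (bigD1 k)//= (bigD1 i)//= /at_pts atk ak !eqxx /= big1 ?mulr1 => [|j ji].
    rewrite big1 ?mulr1// => t tk; rewrite big1// => j _.
    by rewrite (_ : _ == _ = false)//; apply/negbTE; apply: contra tk => /eqP/val_inj ->.
  rewrite (_ : _ == _ = false)//.
  have /forallP/(_ k) := implyP (forallP (pNI j) i) ji.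
  by rewrite eqz_nat eq_sym => /negbTE.
rewrite big1// => t _; rewrite big1// => i _; case: ifP => // /andP[/eqP at_ /eqP ay].
case/negP: none; apply/existsP; exists i; apply/existsP; exists t.
by rewrite at_ ay !eqxx.
Qed.

(** The generating function of the number of marked points that are occupied: a
    non-intersecting family passes at most once through each of them. *)
Lemma sum_occupied :
  \sum_(p in nonintersecting N T S) (1 + h) ^+ #|occupied p| =
  \det (gram F N T S) * \det (1%:M + h *: kernel_mx).
Proof.
rewrite -det_path_sum -sum_nonintersecting; apply: eq_bigr => p pNI.
by rewrite family_weight_pts.
Qed.

End Weighted.
End Correlation.

Lemma horner_char_poly (F : comRingType) n (A : 'M[F]_n) (z : F) :
  (char_poly A).[z] = \det (z%:M - A).
Proof.
rewrite -[LHS]/(horner_eval z _) -det_map_mx; congr (\det _).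
apply/matrixP => i j; rewrite /char_poly_mx !mxE /= /horner_eval hornerD hornerN hornerMn hornerX.
by rewrite hornerC.
Qed.

Lemma poly_eq_nonzero (F : numFieldType) (p q : {poly F}) :
  (forall z : F, z != 0 -> p.[z] = q.[z]) -> p = q.
Proof.
move=> pq; apply/eqP; rewrite -subr_eq0; apply/negPn/negP => pq0.
have := @max_poly_roots _ (p - q) (map (fun k : nat => k.+1%:R : F) (iota 0 (size (p - q)))) pq0.
rewrite size_map size_iota ltnn => H; apply: notF; apply: H.
  apply/allP => _ /mapP[k _ ->]; apply/rootP; by rewrite hornerD hornerN pq ?subrr ?pnatr_eq0.
have Sinj : injective (fun k => k.+1%:R : F).
  by move=> i j /eqP; rewrite eqr_nat => /eqP[].
by rewrite (map_inj_uniq Sinj) iota_uniq.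
Qed.

(** The points are all occupied when the number of occupied ones takes its
    largest value n, so the number of these families is the leading coefficient
    in h of the generating function of that number. *)
Lemma card_all_occupied (F : numFieldType) (N T S n : nat) (pt : 'I_n -> nat)
    (px : 'I_n -> int) :
  (S <= T)%N -> injective (fun a => (px a, pt a)) -> (forall a, (pt a <= T)%N) ->
  #|[set p in nonintersecting N T S | [forall a, in_H p (pt a)%:Z (px a)]]|%:R =
  \det (gram F N T S) * \det (kernel_mx F N T S pt px).
Proof.
move=> ST inj ptT; set K := kernel_mx _ _ _ _ _ _.
have Gunit : gram F N T S \in unitmx.
  rewrite unitmxE -card_nonintersecting unitfE pnatr_eq0 -lt0n.
  exact: card_nonintersecting_gt0.
pose occ (p : path_family N T) := #|occupied pt px p|.
have occn p : (occ p <= n)%N by rewrite -[X in (_ <= X)%N]card_ord max_card.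
(* With h = 1 / z, multiplication by z ^ n gives polynomials in z, and the
   leading coefficient in h becomes the value at z = 0. *)
have pq : \sum_(p in nonintersecting N T S) 'X^(n - occ p) * (1 + 'X) ^+ occ p =
    \det (gram F N T S) *: char_poly (- K).
  apply: poly_eq_nonzero => z z0; rewrite hornerZ horner_char_poly opprK.
  have -> : z%:M + K = z *: (1%:M + z^-1 *: K).
    by rewrite scalerDr scalerA mulfV// scale1r scale_scalar_mx mulr1.
  rewrite detZ mulrCA -sum_occupied// horner_sum big_distrr /=.
  apply: eq_bigr => p _; rewrite hornerM !horner_exp hornerD hornerX hornerC.
  rewrite -{2}(subnK (occn p)) exprD -mulrA -exprMn mulrDr mulr1 mulfV//.
  by rewrite [z + 1]addrC.
have := congr1 (fun p : {poly F} => p.[0]) pq.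
rewrite hornerZ horner_char_poly opprK raddf0 add0r => <-.
rewrite horner_sum -sum1_card natr_sum big_mkcond [RHS]big_mkcond.
apply: eq_bigr => p _; rewrite inE; case: (p \in _) => //=.
rewrite hornerM !horner_exp hornerD hornerX hornerC addr0 expr1n mulr1 expr0n.
rewrite subn_eq0; case: forallP => [H|H].
  rewrite (_ : (n <= occ p)%N)// -{1}[n]card_ord; apply: subset_leq_card.
  by apply/fintype.subsetP => a _; rewrite inE H.
case: leqP => // nocc; case: H => a.
have : occupied pt px p = finset.setTfor 'I_n.
  by apply/eqP; rewrite eqEcard finset.subsetT cardsT card_ord.
by move=> /setP/(_ a); rewrite !inE.
Qed.

Lemma hit_prob_det (R : realType) (N T S n : nat) (x0 t0 : int)
    (pts : 'I_n -> int * int) (pt : 'I_n -> nat) :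
  (S <= T)%N -> injective pts -> (forall a, t0 + (pts a).2 = (pt a)%:Z) ->
  (forall a, (pt a <= T)%N) ->
  hit_prob R N T S x0 t0 pts =
  \det (kernel_mx R N T S pt (fun a => x0 + (pts a).1)).
Proof.
move=> ST inj ptE ptT; rewrite /hit_prob /Defs.uniform_prob.
rewrite (_ : finset _ = finset (fun p : path_family N T =>
    (p \in nonintersecting N T S) && [forall a, in_H p (pt a)%:Z (x0 + (pts a).1)])); last first.
  by apply/setP => p; rewrite !inE; congr andb; apply: eq_forallb => a; rewrite ptE.
rewrite card_all_occupied//; last first.
  move=> a b [/addrI e1 e2]; apply: inj; move: (ptE a) (ptE b); rewrite e2 => <- /addrI.
  by case: (pts a) (pts b) e1 => ? ? [? ?] /= -> ->.
rewrite mulrAC (card_nonintersecting R) divff ?mul1r// -card_nonintersecting pnatr_eq0 -lt0n.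
exact: card_nonintersecting_gt0.
Qed.

(** * The Hahn difference operator *)

Section Hahn.
Variable F : realFieldType.
Implicit Types (x y z : int) (f g : int -> F).

(** The inverse factorial, extended by 0: with this convention the recursions of
    the Hahn weight hold at all integers and cut it off at the ends of its
    support. *)
Definition ifac (z : int) : F := if z is Posz k then k`!%:R^-1 else 0.

Lemma ifacB1 z : ifac (z - 1) = z%:~R * ifac z.
Proof.
case: z => [[|k]|k]; first by rewrite /= mul0r.
  rewrite (_ : k.+1%:Z - 1 = k%:Z); last by lia.
  rewrite /= factS natrM invfM mulrA divff ?mul1r//.
  by rewrite pnatr_eq0.
rewrite (_ : Negz k - 1 = Negz k.+1); last by lia.
by rewrite /= mulr0.
Qed.

Lemma ifacB z n : ifac (z - n%:Z) = ifac z * \prod_(l < n) (z%:~R - l%:R).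
Proof.
elim: n => [|n IH]; first by rewrite subr0 big_ord0 mulr1.
rewrite (_ : z - n.+1%:Z = z - n%:Z - 1); last by lia.
by rewrite ifacB1 IH big_ord_recr /= intrB mulrC -mulrA.
Qed.

Lemma ifac_gt0 z : 0 <= z -> 0 < ifac z.
Proof. by case: z => // k _; rewrite /= invr_gt0 ltr0n fact_gt0. Qed.

Lemma ifac_lt0 z : z < 0 -> ifac z = 0.
Proof. by case: z. Qed.

Lemma binz_ifac m z : binz F m z = m`!%:R * (ifac z * ifac (m%:Z - z)).
Proof.
case: z => [k|k]; last by rewrite /= mul0r mulr0.
have [km|mk] := leqP k m; last first.
  by rewrite /= bin_small// (ifac_lt0 (z := m%:Z - k%:Z)) ?mulr0//; lia.
rewrite (_ : m%:Z - k%:Z = (m - k)%N%:Z); last by lia.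
rewrite /= -(bin_fact km) !natrM -invfM mulfK//.
Qed.

(** The falling factorial x (x - 1) ... (x - j + 1). *)
Definition ff (j : nat) (x : int) : F := \prod_(l < j) (x%:~R - l%:R).

Lemma ff0 x : ff 0 x = 1.
Proof. by rewrite /ff big_ord0. Qed.

Lemma ffS j x : ff j.+1 x = ff j x * (x%:~R - j%:R).
Proof. by rewrite /ff big_ord_recr. Qed.

Lemma ff_succ j x : ff j.+1 (x + 1) = (x%:~R + 1) * ff j x.
Proof.
rewrite /ff big_ord_recl /= subr0 intrD; congr (_ * _); apply: eq_bigr => l _.
by rewrite /bump leq0n add1n -natr1; ring.
Qed.

Lemma ff_pred j x : x%:~R * ff j (x - 1) = ff j.+1 x.
Proof. by rewrite -{3}(subrK 1 x) ff_succ intrB subrK. Qed.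

(** The polynomials of degree less than n, in the basis in which the Hahn
    operator is bidiagonal. *)
Definition ffspan (n : nat) (f : int -> F) :=
  exists d : nat -> F, forall x, f x = \sum_(j < n) d j * ff j x.

Lemma ffspan_mul_affine n f a b : ffspan n f ->
  ffspan n.+1 (fun x => f x * (a + b * x%:~R)).
Proof.
move=> [d fE]; exists (fun j => (if (j < n)%N then d j * (a + b * j%:R) else 0) +
    (if j is i.+1 then d i * b else 0)) => x.
rewrite fE mulr_suml; under [RHS]eq_bigr do rewrite mulrDl.
rewrite [RHS]big_split /= big_ord_recr /= ltnn mul0r addr0.
rewrite [X in _ = _ + X]big_ord_recl /= mul0r add0r -big_split /=.
apply: eq_bigr => j _; rewrite ltn_ord /bump leq0n add1n ffS; ring.
Qed.

Lemma ffspan_mul_prod n k f (a b : nat -> F) : ffspan n f ->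
  ffspan (n + k) (fun x => f x * \prod_(l < k) (a l + b l * x%:~R)).
Proof.
elim: k => [|k IH] fs.
  rewrite addn0; have [d fE] := fs; exists d => x; by rewrite big_ord0 mulr1 fE.
have [d dE] := @ffspan_mul_affine _ _ (a k) (b k) (IH fs).
by rewrite addnS; exists d => x; rewrite big_ord_recr mulrA /= dE.
Qed.

Lemma ffspan1 : ffspan 1 (fun=> 1).
Proof. by exists (fun=> 1) => x; rewrite big_ord1 /ff big_ord0 mulr1. Qed.

(** A polynomial of degree at most k that vanishes at k+1 consecutive points has
    no term of degree k: take differences. *)
Lemma ffspan_vanish k (d : nat -> F) x0 :
  (forall i : nat, (i <= k)%N -> \sum_(j < k.+1) d j * ff j (x0 + i%:Z) = 0) -> d k = 0.
Proof.
elim: k d => [|k IH] d H.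
  by have := H 0%N isT; rewrite big_ord1 /ff big_ord0 mulr1.
suff : (fun j => d j.+1 * j.+1%:R) k = 0.
  by move=> /eqP; rewrite mulf_eq0 pnatr_eq0 orbF => /eqP.
apply: (IH (fun j => d j.+1 * j.+1%:R)) => i ik.
have := H i.+1 ik; have := H i (leqW ik).
rewrite !(big_ord_recl k.+1) => h0 h1.
have : \sum_(j < k.+1) d (lift ord0 j) * ff (lift ord0 j) (x0 + i.+1%:Z) -
   \sum_(j < k.+1) d (lift ord0 j) * ff (lift ord0 j) (x0 + i%:Z) = 0.
  by move: h0 h1; rewrite ![ff (nat_of_ord ord0) _]ff0; lra.
rewrite -sumrB => H0; rewrite -[RHS]H0; apply: eq_bigr => j _.
rewrite lift0 -mulrBr -mulrA; congr (_ * _).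
rewrite (_ : x0 + i.+1%:Z = x0 + i%:Z + 1); last by lia.
by rewrite ff_succ ffS -natr1; ring.
Qed.

Variables (N T S : nat).

(** Transition from time t to time t + 1; up to the weights this is the adjoint
    of the transition f |-> f x + f (x + 1) from time t + 1 to time t. *)
Definition back (t : nat) f y : F :=
  (T%:R - t%:R - S%:R + y%:~R) * (t%:R + N%:R - y%:~R) * f y +
  (S%:R + N%:R - y%:~R) * y%:~R * f (y - 1).

Definition forw f x : F := f x + f (x + 1).

Definition hconst (t : nat) : F := (t%:R + N%:R) * (T%:R - t%:R + N%:R - 1).

(** The Hahn difference operator conjugated by the weight w2, which makes its
    coefficients polynomials that have limits after division by the square of
    the scale. *)
Definition hahn (t : nat) f x : F :=
  (T%:R - t%:R - S%:R + x%:~R + 1) * (t%:R + N%:R - x%:~R - 1) * f (x + 1) +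
  ((T%:R - t%:R - S%:R + x%:~R) * (t%:R + N%:R - x%:~R) +
   (S%:R + N%:R - x%:~R - 1) * (x%:~R + 1) - hconst t) * f x +
  (S%:R + N%:R - x%:~R) * x%:~R * f (x - 1).

(** Up to a constant, composing the two transitions in one order gives the
    Hahn operator of time t and in the other order that of time t + 1. *)
Lemma forw_back t f x : forw (back t f) x = hahn t f x + hconst t * f x.
Proof. rewrite /forw /back /hahn addrK !intrD; ring. Qed.

Lemma back_forw t f x : back t (forw f) x = hahn t.+1 f x + hconst t * f x.
Proof. rewrite /forw /back /hahn /hconst subrK -natr1; ring. Qed.

Lemma back_eq t f g : f =1 g -> back t f =1 back t g.
Proof. by move=> fg y; rewrite /back !fg. Qed.

(** The transition intertwines the Hahn operators of consecutive times:
    compute back (forw (back f)) in two ways. *)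
Lemma hahn_back t f x : hahn t.+1 (back t f) x = back t (hahn t f) x.
Proof.
apply: (addIr (hconst t * back t f x)); rewrite -back_forw.
rewrite (back_eq _ (forw_back t f)) /back; ring.
Qed.

(** The product of w1 and w2 is the weight of the Hahn polynomials; w1 comes
    from the starting points of the paths and w2 from their end points. *)
Definition w1 (t : nat) y : F := ifac y * ifac (t%:Z + N%:Z - 1 - y).
Definition w2 (t : nat) x : F :=
  ifac (S%:Z + N%:Z - 1 - x) * ifac (T%:Z - t%:Z - S%:Z + x).

Lemma w2S t x : w2 t (x + 1) * (T%:R - t%:R - S%:R + x%:~R + 1) =
  w2 t x * (S%:R + N%:R - 1 - x%:~R).
Proof.
rewrite /w2 (_ : S%:Z + N%:Z - 1 - (x + 1) = S%:Z + N%:Z - 1 - x - 1); last by lia.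
rewrite ifacB1 [in RHS](_ : T%:Z - t%:Z - S%:Z + x = T%:Z - t%:Z - S%:Z + (x + 1) - 1); last by lia.
by rewrite ifacB1; ring.
Qed.

Lemma w1S t x : w1 t (x + 1) * (x%:~R + 1) = w1 t x * (t%:R + N%:R - 1 - x%:~R).
Proof.
rewrite /w1 (_ : t%:Z + N%:Z - 1 - (x + 1) = t%:Z + N%:Z - 1 - x - 1); last by lia.
rewrite ifacB1 -[in ifac x](addrK 1 x) [in RHS]ifacB1.
ring.
Qed.

(** The operator whose eigenfunctions are the Hahn polynomials. *)
Definition hahn_poly (t : nat) p x : F :=
  (t%:R + N%:R - 1 - x%:~R) * (S%:R + N%:R - 1 - x%:~R) * (p (x + 1) - p x) +
  x%:~R * (T%:R - t%:R - S%:R + x%:~R) * (p (x - 1) - p x).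

Lemma hahn_w2 t p x :
  hahn t (fun z => w2 t z * p z) x = w2 t x * hahn_poly t p x.
Proof.
have := w2S t x; have := w2S t (x - 1); rewrite subrK intrB => e1 e2.
rewrite /hahn.
transitivity ((t%:R + N%:R - x%:~R - 1) * (w2 t (x + 1) * (T%:R - t%:R - S%:R + x%:~R + 1)) * p (x + 1) +
 ((T%:R - t%:R - S%:R + x%:~R) * (t%:R + N%:R - x%:~R) +
   (S%:R + N%:R - x%:~R - 1) * (x%:~R + 1) - hconst t) * (w2 t x * p x) +
  (w2 t (x - 1) * (S%:R + N%:R - 1 - (x%:~R - 1%:~R))) * x%:~R * p (x - 1)); first by ring.
by rewrite e2 -e1 /hahn_poly /hconst; ring.
Qed.

Lemma back_w2 t p y : back t (fun z => w2 t z * p z) y =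
  w2 t.+1 y * ((t%:R + N%:R - y%:~R) * p y + y%:~R * p (y - 1)).
Proof.
have e1 : (T%:R - t%:R - S%:R + y%:~R) * w2 t y = w2 t.+1 y.
  rewrite /w2 (_ : T%:Z - t.+1%:Z - S%:Z + y = T%:Z - t%:Z - S%:Z + y - 1); last by lia.
  by rewrite ifacB1; ring.
have e2 : (S%:R + N%:R - y%:~R) * w2 t (y - 1) = w2 t.+1 y.
  rewrite /w2 (_ : T%:Z - t.+1%:Z - S%:Z + y = T%:Z - t%:Z - S%:Z + (y - 1)); last by lia.
  rewrite (_ : S%:Z + N%:Z - 1 - y = S%:Z + N%:Z - 1 - (y - 1) - 1); last by lia.
  by rewrite ifacB1; ring.
rewrite /back.
transitivity ((T%:R - t%:R - S%:R + y%:~R) * w2 t y * (t%:R + N%:R - y%:~R) * p y +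
 (S%:R + N%:R - y%:~R) * w2 t (y - 1) * y%:~R * p (y - 1)); first by ring.
by rewrite e2 e1; ring.
Qed.

(** The eigenvalue of the Hahn operator on polynomials of degree k; it does
    not depend on the time. *)
Definition hlam (k : nat) : F := - (k%:R * (T%:R + 2 * N%:R - 1 - k%:R)).

Definition hstep (t j : nat) : F :=
  j.+1%:R * (t%:R + N%:R - 1 - j%:R) * (S%:R + N%:R - 1 - j%:R).

Lemma hahn_ff0 t x : hahn_poly t (ff 0) x = 0.
Proof. by rewrite /hahn_poly /ff !big_ord0 subrr !mulr0 addr0. Qed.

Lemma hahn_ffS t j x :
  hahn_poly t (ff j.+1) x = hlam j.+1 * ff j.+1 x + hstep t j * ff j x.
Proof.
transitivity ((t%:R + N%:R - 1 - x%:~R) * (S%:R + N%:R - 1 - x%:~R) *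
    (ff j.+1 (x + 1) - ff j.+1 x) + (T%:R - t%:R - S%:R + x%:~R) *
    (x%:~R * ff j.+1 (x - 1) - x%:~R * ff j.+1 x)); first by rewrite /hahn_poly; ring.
rewrite ff_pred ff_succ !ffS.
rewrite /hlam /hstep -!natr1; ring.
Qed.

(** The operator is bidiagonal in the basis of falling factorials, which gives
    the coefficients of its eigenpolynomials as products; the leading one is 1. *)
Definition hcoef (t k j : nat) : F := \prod_(j <= l < k) (hstep t l / (hlam k - hlam l)).

Definition hpoly (t k : nat) x : F := \sum_(j < k.+1) hcoef t k j * ff j x.

Lemma hlam_neq k l : (l < k)%N -> (k + l < T + N.*2 - 1)%N -> hlam k - hlam l != 0.
Proof.
move=> lk kl; rewrite (_ : _ - _ = - ((k - l)%N%:R * (T + N.*2 - 1 - (k + l))%N%:R)).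
  by rewrite oppr_eq0 mulf_neq0 ?pnatr_eq0; lia.
rewrite (natrB _ (ltnW kl)) natrB; last by lia.
rewrite natrB; last by lia.
rewrite /hlam -muln2 !natrD natrM; ring.
Qed.

Lemma hahn_hpoly t k x : (k + k <= T + N.*2 - 1)%N ->
  hahn_poly t (hpoly t k) x = hlam k * hpoly t k x.
Proof.
move=> kk.
have -> : hahn_poly t (hpoly t k) x = \sum_(j < k.+1) hcoef t k j * hahn_poly t (ff j) x.
  rewrite /hahn_poly /hpoly -!sumrB !mulr_sumr -big_split /=.
  by apply: eq_bigr => j _; ring.
have -> : \sum_(j < k.+1) hcoef t k j * hahn_poly t (ff j) x =
  \sum_(j < k.+1) hcoef t k j * hlam j * ff j x +
  \sum_(j < k) hcoef t k j.+1 * hstep t j * ff j x.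
  rewrite !big_ord_recl hahn_ff0 mulr0 add0r /hlam mul0r oppr0 mulr0 mul0r add0r.
  rewrite -big_split /=; apply: eq_bigr => j _.
  by rewrite /bump leq0n add1n hahn_ffS /hlam; ring.
rewrite big_ord_recr /= addrAC -big_split /= /hpoly mulr_sumr big_ord_recr /=.
congr (_ + _); last by ring.
apply: eq_bigr => j _; rewrite {1 3}/hcoef big_ltn// -/(hcoef t k j.+1).
have jk : hlam k - hlam j != 0 by apply: hlam_neq => //; have := ltn_ord j; lia.
by field.
Qed.

End Hahn.

(** * Orthogonality and completeness of the Hahn polynomials *)

Section Orthogonality.
Variables (F : realFieldType) (N T S t : nat).
Hypotheses (N0 : (0 < N)%N) (ST : (S <= T)%N) (tT : (t <= T)%N).
Implicit Types (f g : int -> F).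

Local Notation wt1 := (@w1 F N t).
Local Notation wt2 := (@w2 F N T S t).
Local Notation hop := (@hahn_poly F N T S t).
Local Notation hp := (@hpoly F N T S t).
Local Notation lamk := (@hlam F N T).

(** The slice of the hexagon at time t is the set of the integers x such that
    slice_lo <= x < slice_lo + slice_size. *)
Definition slice_lo : nat := (t + S - T)%N.
Definition slice_size : nat := (N + minn t S - slice_lo)%N.
Local Notation lo := slice_lo.
Local Notation M := slice_size.

Definition dotw f g : F :=
  \sum_(lo <= x < lo + M) wt1 x%:Z * wt2 x%:Z * f x%:Z * g x%:Z.

Lemma slice_sizeK : (lo + M = N + minn t S)%N.
Proof. by rewrite /slice_size subnKC// /slice_lo; lia. Qed.

Lemma slice_size_ge : (N <= M)%N.
Proof. by rewrite /slice_size /slice_lo; lia. Qed.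

Lemma slice_size_le : (M.*2 <= T + N.*2)%N.
Proof. by rewrite /slice_size /slice_lo; lia. Qed.

Lemma w1_gt0 (x : nat) : (lo <= x < lo + M)%N -> 0 < wt1 x%:Z.
Proof.
rewrite slice_sizeK /slice_lo => /andP[h1 h2].
by rewrite /w1 mulr_gt0 ?ifac_gt0//; lia.
Qed.

Lemma w2_gt0 (x : nat) : (lo <= x < lo + M)%N -> 0 < wt2 x%:Z.
Proof.
rewrite slice_sizeK /slice_lo => /andP[h1 h2].
by rewrite /w2 mulr_gt0 ?ifac_gt0//; lia.
Qed.

Lemma wt_gt0 (x : nat) : (lo <= x < lo + M)%N -> 0 < wt1 x%:Z * wt2 x%:Z.
Proof. by move=> xM; exact: mulr_gt0 (w1_gt0 xM) (w2_gt0 xM). Qed.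

Lemma dotwC f g : dotw f g = dotw g f.
Proof. by apply: eq_bigr => x _; ring. Qed.

(** Summation by parts; the boundary terms vanish at the two ends of the
    slice. *)
Lemma hahn_poly_selfadjoint f g : dotw f (hop g) = dotw (hop f) g.
Proof.
apply/eqP; rewrite -subr_eq0 -sumrB; apply/eqP.
pose V (x : int) := wt1 (x - 1) * wt2 (x - 1) *
  ((t%:R + N%:R - x%:~R) * (S%:R + N%:R - x%:~R)) *
  (f (x - 1) * g x - g (x - 1) * f x).
have e1 (x : int) := w1S F N t x; have e2 (x : int) := w2S F N T S t x.
transitivity (\sum_(lo <= x < lo + M) (V x.+1%:Z - V x%:Z)).
  apply: eq_bigr => x _; rewrite /V (_ : x.+1%:Z = x%:Z + 1); last by lia.
  rewrite !addrK /hahn_poly; set y := x%:Z.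
  have := e1 (y - 1); have := e2 (y - 1); rewrite !subrK => h2 h1.
  have h : wt1 y * wt2 y * (y%:~R * (T%:R - t%:R - S%:R + y%:~R)) =
      wt1 (y - 1) * wt2 (y - 1) * ((t%:R + N%:R - y%:~R) * (S%:R + N%:R - y%:~R)).
    transitivity ((wt1 y * ((y - 1)%:~R + 1)) * (wt2 y * (T%:R - t%:R - S%:R + (y - 1)%:~R + 1))).
      ring.
    rewrite h1 h2; ring.
  transitivity (wt1 y * wt2 y * ((t%:R + N%:R - 1 - y%:~R) * (S%:R + N%:R - 1 - y%:~R)) *
     (f y * g (y + 1) - g y * f (y + 1)) -
    wt1 y * wt2 y * (y%:~R * (T%:R - t%:R - S%:R + y%:~R)) *
    (f (y - 1) * g y - g (y - 1) * f y)); first by ring.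
  rewrite h; ring.
rewrite telescope_sumr ?leq_addr// slice_sizeK {1}/V.
have -> : ((t%:R + N%:R - (N + minn t S)%N%:Z%:~R) * (S%:R + N%:R - (N + minn t S)%N%:Z%:~R) : F) = 0.
  rewrite /minn; case: ifP => _; rewrite PoszD; ring.
rewrite mulr0 mul0r sub0r /V; apply/eqP; rewrite oppr_eq0; apply/eqP.
have [lo0|lo_gt0] := posnP lo.
  by rewrite lo0 /w1 /= !mul0r.
rewrite /w2 (_ : T%:Z - t%:Z - S%:Z + (lo%:Z - 1) = -1) ?mulr0 ?mul0r//.
by move: lo_gt0; rewrite /slice_lo; lia.
Qed.

Lemma dotw_sumr f n (d : nat -> F) (g : nat -> int -> F) :
  dotw f (fun x => \sum_(j < n) d j * g j x) = \sum_(j < n) d j * dotw f (g j).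
Proof.
rewrite /dotw; under eq_bigr do rewrite mulr_sumr.
rewrite exchange_big /=; apply: eq_bigr => j _; rewrite mulr_sumr.
by apply: eq_bigr => x _; ring.
Qed.

Lemma dotw_eq f g f' g' : f =1 f' -> g =1 g' -> dotw f g = dotw f' g'.
Proof. by move=> ff gg; apply: eq_bigr => x _; rewrite ff gg. Qed.

(** The operator is selfadjoint and maps ff j to a combination of ff j and ff
    j.-1, while hp k is an eigenfunction for another eigenvalue than that of
    degree j; so the products vanish by induction on j. *)
Lemma dotw_ff_hpoly j k : (j < k)%N -> (k < M)%N -> dotw (ff F j) (hp k) = 0.
Proof.
have Mle := slice_size_le.
elim: j => [|j IH] jk kM.
all: have kk : (k + k <= T + N.*2 - 1)%N by lia.
all: have e i : hop (hp k) i = lamk k * hp k i by apply: hahn_hpoly.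
  have := hahn_poly_selfadjoint (ff F 0) (hp k).
  rewrite (dotw_eq (fun=> erefl) e) => H.
  have lk : lamk k - lamk 0 != 0 by apply: hlam_neq => //; lia.
  rewrite {2}/hlam mul0r oppr0 subr0 in lk.
  apply: (mulfI lk); rewrite mulr0.
  transitivity (dotw (ff F 0) (fun i => lamk k * hp k i)).
    by rewrite /dotw mulr_sumr; apply: eq_bigr => x _; ring.
  by rewrite H /dotw big1// => x _; rewrite hahn_ff0 mulr0 mul0r.
have := hahn_poly_selfadjoint (ff F j.+1) (hp k).
rewrite (dotw_eq (fun=> erefl) e) (dotw_eq (@hahn_ffS F N T S t j) (fun=> erefl)) => H.
have lk : lamk k - lamk j.+1 != 0 by apply: hlam_neq => //; lia.
apply: (mulfI lk); rewrite mulr0.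
transitivity (dotw (ff F j.+1) (fun i => lamk k * hp k i) - lamk j.+1 * dotw (ff F j.+1) (hp k)).
  rewrite mulrBl; congr (_ - _).
  by rewrite /dotw mulr_sumr; apply: eq_bigr => x _; ring.
transitivity (hstep F N S t j * dotw (ff F j) (hp k)); last by rewrite IH ?mulr0//; lia.
rewrite H /dotw !mulr_sumr -sumrB; apply: eq_bigr => x _; ring.
Qed.

Lemma dotw_hpoly_neq j k : j != k -> (j < M)%N -> (k < M)%N ->
  dotw (hp j) (hp k) = 0.
Proof.
wlog jk : j k / (j < k)%N => [H|_ _ kM].
  by rewrite neq_ltn => /orP[] jk jM kM; [|rewrite dotwC]; apply: H; rewrite ?(ltn_eqF jk).
rewrite dotwC dotw_sumr big1// => i _; rewrite dotwC dotw_ff_hpoly ?mulr0//.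
by rewrite (leq_trans (ltn_ord i)).
Qed.

(** A polynomial of degree k with leading coefficient 1 does not vanish at
    all the points of the slice, whose number exceeds k. *)
Lemma dotw_hpoly_gt0 k : (k < M)%N -> 0 < dotw (hp k) (hp k).
Proof.
move=> kM; have ge0 (x : nat) : (lo <= x < lo + M)%N ->
    0 <= wt1 x%:Z * wt2 x%:Z * hp k x%:Z * hp k x%:Z.
  move=> xM; rewrite -mulrA -expr2 mulr_ge0 ?sqr_ge0//; exact: ltW (wt_gt0 xM).
rewrite lt_neqAle; apply/andP; split; last first.
  by rewrite /dotw big_nat; apply: sumr_ge0.
apply/eqP => /esym/eqP; rewrite /dotw big_nat psumr_eq0// => /allP H.
suff : hcoef F N T S t k k = 0.
  by rewrite /hcoef big_geq// => /eqP; rewrite oner_eq0.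
apply: (@ffspan_vanish F k (hcoef F N T S t k) lo%:Z) => i ik.
have xM : (lo <= lo + i < lo + M)%N by lia.
have := H (lo + i)%N; rewrite mem_index_iota xM => /(_ isT)/=.
rewrite -mulrA mulf_eq0 -expr2 sqrf_eq0.
by rewrite (gt_eqF (wt_gt0 xM)) /= => /eqP.
Qed.

(** The Hahn weight is shared out: psi carries the factor of the end points
    and chi that of the starting points, because the transitions act on one
    of the two factors only. *)
Definition psi k x : F := wt2 x * hp k x.
Definition chi k x : F := wt1 x * hp k x / dotw (hp k) (hp k).

Definition in_slice x := (lo%:Z <= x) && (x < (lo + M)%N%:Z).

Lemma in_sliceP x : in_slice x -> exists2 i : 'I_M, x = (lo + i)%N%:Z & true.
Proof.
case: x => [x|x]; rewrite /in_slice; last by rewrite andbC; lia.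
move=> xM; have xi : (x - lo < M)%N by lia.
by exists (Ordinal xi) => //=; congr Posz; lia.
Qed.

Lemma sum_slice (h : int -> F) :
  \sum_(lo <= x < lo + M) h x%:Z = \sum_(i < M) h (lo + i)%N%:Z.
Proof.
rewrite -{1}[lo]add0n big_addn addKn big_mkord.
by apply: eq_bigr => i _; rewrite addnC.
Qed.

Lemma chi_psi j k : (j < M)%N -> (k < M)%N ->
  \sum_(lo <= x < lo + M) chi j x%:Z * psi k x%:Z = (j == k)%:R.
Proof.
move=> jM kM.
transitivity (dotw (hp j) (hp k) / dotw (hp j) (hp j)).
  by rewrite [dotw (hp j) (hp k)]/dotw mulr_suml; apply: eq_bigr => x _; rewrite /chi /psi; ring.
have [<-|jk] := eqVneq j k; first by rewrite divff// gt_eqF// dotw_hpoly_gt0.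
by rewrite dotw_hpoly_neq// mul0r.
Qed.

(** Completeness follows from biorthogonality, because there are as many
    functions as points: a one-sided inverse of a square matrix is two-sided. *)
Lemma psi_chi x y : in_slice x -> in_slice y ->
  \sum_(k < M) psi k x * chi k y = (x == y)%:R.
Proof.
move=> /in_sliceP[i -> _] /in_sliceP[j -> _].
pose X := \matrix_(k < M, i < M) chi k (lo + i)%N%:Z.
pose Y := \matrix_(i < M, k < M) psi k (lo + i)%N%:Z.
have /mulmx1C/matrixP/(_ i j) : X *m Y = 1%:M.
  apply/matrixP => k l; rewrite !mxE.
  under eq_bigr do rewrite !mxE.
  by rewrite -(sum_slice (fun x => chi k x * psi l x)) chi_psi.
rewrite !mxE eqz_nat eqn_add2l => <-; apply: eq_bigr => k _; by rewrite !mxE.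
Qed.

Lemma hahn_psi k x : (k < M)%N -> hahn N T S t (psi k) x = lamk k * psi k x.
Proof.
move=> kM; have Mle := slice_size_le.
rewrite /psi hahn_w2 hahn_hpoly; first by ring.
by lia.
Qed.

End Orthogonality.

(** * The correlation kernel in terms of Hahn polynomials *)

Section HahnKernel.
Variables (F : realFieldType) (N T S : nat).
Hypotheses (N0 : (0 < N)%N) (ST : (S <= T)%N).
Implicit Types (f g : int -> F) (x y : int).

Local Notation wt1 := (@w1 F N).
Local Notation wt2 := (@w2 F N T S).
Local Notation lo := (slice_lo T S).
Local Notation M := (slice_size N T S).
Local Notation lamk := (@hlam F N T).
Local Notation cst := (@hconst F N T).

Definition from_start (t : nat) (i : nat) y : F := binz F t (y - i%:Z).
Definition to_end (t : nat) (j : nat) x : F := binz F (T - t) ((S + j)%N%:Z - x).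

(** The binomial coefficient has the factorials of y - i and t + i - y in its
    denominator, and w1 those of y and t + N - 1 - y; the quotients are
    polynomials of degrees i and N - 1 - i. *)
Lemma from_start_span t (i : 'I_N) : exists2 f, ffspan N f &
  forall y, from_start t i y = wt1 t y * f y.
Proof.
have [i' iN] : exists i', (1 + i + i' = N)%N by exists (N - i.+1)%N; have := ltn_ord i; lia.
have := ffspan_mul_prod i' (fun l => (t + i + i')%:R - l%:R) (fun=> -1)
  (ffspan_mul_prod i (fun l => - l%:R) (fun=> 1) (ffspan1 F)).
rewrite iN => fs; exists (fun y => t`!%:R *
   (1 * (\prod_(l < i) (- l%:R + 1 * y%:~R)) * \prod_(l < i') ((t + i + i')%:R - l%:R + -1 * y%:~R))).
  case: fs => d dE; exists (fun j => t`!%:R * d j) => x.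
  by rewrite dE mulr_sumr; apply: eq_bigr => j _; rewrite mulrA.
move=> y; rewrite /from_start binz_ifac ifacB /w1.
rewrite (_ : t%:Z - (y - i%:Z) = t%:Z + N%:Z - 1 - y - i'%:Z); last by lia.
rewrite ifacB.
rewrite [X in ifac F y * X](eq_bigr (fun l : 'I_i => - l%:R + 1 * y%:~R)); last by move=> l _; ring.
rewrite [X in ifac F (_ - y) * X](eq_bigr (fun l : 'I_i' => (t + i + i')%:R - l%:R + -1 * y%:~R)); last first.
  move=> l _; rewrite -{1}iN !PoszD; ring.
ring.
Qed.

Lemma to_end_span t (j : 'I_N) : (t <= T)%N -> exists2 f, ffspan N f &
  forall x, to_end t j x = wt2 t x * f x.
Proof.
move=> tT; have [i' iN] : exists i', (1 + i' + j = N)%N.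
  by exists (N - j.+1)%N; have := ltn_ord j; lia.
have := ffspan_mul_prod j (fun l => T%:R - t%:R - S%:R - l%:R) (fun=> 1)
  (ffspan_mul_prod i' (fun l => (S + i' + j)%:R - l%:R) (fun=> -1) (ffspan1 F)).
rewrite iN => fs; exists (fun y => (T - t)`!%:R *
   (1 * (\prod_(l < i') ((S + i' + j)%:R - l%:R + -1 * y%:~R)) * \prod_(l < j) (T%:R - t%:R - S%:R - l%:R + 1 * y%:~R))).
  case: fs => d dE; exists (fun j => (T - t)`!%:R * d j) => x.
  by rewrite dE mulr_sumr; apply: eq_bigr => l _; rewrite mulrA.
move=> x; rewrite /to_end binz_ifac /w2.
rewrite (_ : (T - t)%N%:Z - ((S + j)%N%:Z - x) = T%:Z - t%:Z - S%:Z + x - j%:Z); last by lia.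
rewrite (_ : (S + j)%N%:Z - x = S%:Z + N%:Z - 1 - x - i'%:Z); last by lia.
rewrite !ifacB.
rewrite [X in ifac F (S%:Z + _ - _ - _) * X](eq_bigr (fun l : 'I_i' => (S + i' + j)%:R - l%:R + -1 * x%:~R)); last first.
  by move=> l _; rewrite -{1}iN !PoszD; ring.
rewrite [X in ifac F (T%:Z - _ - _ + _) * X](eq_bigr (fun l : 'I_j => T%:R - t%:R - S%:R - l%:R + 1 * x%:~R)); last first.
  by move=> l _; ring.
ring.
Qed.

Lemma binz_neg m z : z < 0 -> binz F m z = 0.
Proof. by case: z. Qed.

Lemma binz_gt m z : m%:Z < z -> binz F m z = 0.
Proof. by case: z => // k; rewrite ltz_nat => mk; rewrite /= bin_small. Qed.

(** Vandermonde's convolution; for z < L the sum over x < L contains all the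
    nonzero terms. *)
Lemma binz_convolution m n L i z : z < L%:Z ->
  \sum_(0 <= x < L) binz F m (x%:Z - i%:Z) * binz F n (z - x%:Z) =
  binz F (m + n) (z - i%:Z).
Proof.
move=> zL; elim: m i => [|m IH] i.
  rewrite add0n; have [iL|Li] := ltnP i L; last first.
    rewrite big_nat big1 => [|x xL]; first by rewrite binz_neg//; lia.
    by rewrite binz_neg ?mul0r//; lia.
  rewrite big_mkord (bigD1 (Ordinal iL))//= subrr binz0 mul1r big1 ?addr0// => x xi.
  rewrite binz0 subr_eq0 eqz_nat; case: eqVneq => [e|]; last by rewrite mul0r.
  by case/eqP: xi; apply: val_inj.
under eq_bigr do rewrite binzS mulrDl.
rewrite big_split /= IH addSn binzS; congr (_ + _).
rewrite (_ : z - i%:Z - 1 = z - i.+1%:Z); last by lia.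
rewrite -IH; apply: eq_bigr => x _; congr (binz F m _ * _).
by lia.
Qed.

Lemma from_start_to_end t (i j : 'I_N) : (t <= T)%N ->
  \sum_(lo t <= x < lo t + M t) from_start t i x%:Z * to_end t j x%:Z =
  gram F N T S i j.
Proof.
move=> tT; rewrite /gram mxE -[X in binz F X _](subnKC tT).
have iN := ltn_ord i; have jN := ltn_ord j.
rewrite -(@binz_convolution t (T - t) (S + N)); last by lia.
have lM := slice_sizeK N0 ST tT.
rewrite [RHS](big_cat_nat (n := lo t))//=; last by rewrite /slice_lo; lia.
rewrite [X in _ = _ + X](big_cat_nat (n := lo t + M t)%N)//=; [|lia|lia].
rewrite [X in _ = X + _]big_nat [X in _ = X + _]big1 ?add0r => [|x xlo]; last first.
  by rewrite (binz_gt (m := T - t)) ?mulr0//; move: xlo; rewrite /slice_lo; lia.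
rewrite [X in _ = _ + X]big_nat [X in _ = _ + X]big1 ?addr0 => [|x xlo]; first by [].
move: xlo => xlo.
have [xS|xS] := leqP (S + N) x; first by rewrite [X in _ * X]binz_neg ?mulr0//; lia.
by rewrite binz_gt ?mul0r//; lia.
Qed.

Lemma gram_unit : gram F N T S \in unitmx.
Proof.
rewrite unitmxE -card_nonintersecting unitfE pnatr_eq0 -lt0n.
exact: card_nonintersecting_gt0.
Qed.

(** The N functions to_end t j span the products of w2 with all the polynomials
    of degree less than N: they are linearly independent because the Gram matrix,
    which is invertible, factors through their coefficients. *)
Lemma w2_span_to_end t (m : 'I_N) : (t <= T)%N -> exists d : 'I_N -> F,
  forall x, wt2 t x * ff F m x = \sum_(j < N) to_end t j x * d j.
Proof.
move=> tT; have /fin_all_exists[b bP] : forall j : 'I_N, exists b : nat -> F,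
    forall x, to_end t j x = wt2 t x * \sum_(m < N) b m * ff F m x.
  by move=> j; have [f [b bE] fE] := to_end_span j tT; exists b => x; rewrite fE bE.
pose Bm : 'M[F]_N := \matrix_(m, j) b j m.
pose C : 'M[F]_N := \matrix_(i, m) \sum_(lo t <= x < lo t + M t)
  from_start t i x%:Z * (wt2 t x%:Z * ff F m x%:Z).
have CB : C *m Bm = gram F N T S.
  apply/matrixP => i j; rewrite -(from_start_to_end _ _ tT) !mxE.
  under eq_bigr do rewrite !mxE mulr_suml.
  rewrite exchange_big /=; apply: eq_bigr => x _; rewrite bP !mulr_sumr.
  by apply: eq_bigr => l _; ring.
have Bunit : Bm \in unitmx.
  by have := gram_unit; rewrite -CB unitmx_mul => /andP[].
exists (fun j => invmx Bm j m) => x; under eq_bigr do rewrite bP.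
transitivity (\sum_(l < N) wt2 t x * ff F l x * (Bm *m invmx Bm) l m); last first.
  transitivity (\sum_(l < N) \sum_(j < N) wt2 t x * ff F l x * (Bm l j * invmx Bm j m)).
    by apply: eq_bigr => l _; rewrite mxE mulr_sumr.
  rewrite exchange_big /=; apply: eq_bigr => j _; rewrite mulr_sumr mulr_suml.
  by apply: eq_bigr => l _; rewrite [Bm l j]mxE; ring.
rewrite mulmxV// (bigD1 m)//= mxE eqxx mulr1 big1 ?addr0// => l lm.
by rewrite mxE (negbTE lm) mulr0.
Qed.

Lemma forw_to_end t j x : (t < T)%N -> forw (to_end t.+1 j) x = to_end t j x.
Proof.
move=> tT; rewrite /forw /to_end -[in RHS](subnSK tT) binzS; congr (_ + _).
by congr (binz F _ _); lia.
Qed.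

Lemma forw_eq f g : f =1 g -> forw f =1 forw g.
Proof. by move=> fg x; rewrite /forw !fg. Qed.

Lemma iter_forw_eq n f g : f =1 g -> iter n (@forw F) f =1 iter n (@forw F) g.
Proof. by move=> fg; elim: n => //= n IH; apply: forw_eq. Qed.

Lemma iter_forw_to_end t n j : (t + n <= T)%N ->
  iter n (@forw F) (to_end (t + n) j) =1 to_end t j.
Proof.
elim: n => [|n IH] tn x; first by rewrite addn0.
rewrite iterSr -(IH (ltnW _))//; last by rewrite -addnS.
by apply: iter_forw_eq => z; rewrite addnS forw_to_end// -addnS.
Qed.

Lemma forw_sum n (g : 'I_n -> int -> F) (d : 'I_n -> F) x :
  forw (fun z => \sum_j g j z * d j) x = \sum_j forw (g j) x * d j.
Proof. by rewrite /forw -big_split /=; apply: eq_bigr => j _; rewrite mulrDl. Qed.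

Lemma iter_forw_sum m n (g : 'I_n -> int -> F) (d : 'I_n -> F) x :
  iter m (@forw F) (fun z => \sum_j g j z * d j) x =
  \sum_j iter m (@forw F) (g j) x * d j.
Proof.
elim: m x => //= m IH x.
by rewrite (forw_eq IH) (forw_sum (fun j => iter m (@forw F) (g j))).
Qed.

Section FromTime.
Variable t : nat.

Local Notation psi := (@psi F N T S t).
Local Notation chi := (@chi F N T S t).

Fixpoint iter_back (m : nat) f : int -> F :=
  if m is m'.+1 then back N T S (t + m') (iter_back m' f) else f.

Lemma hahn_iter_back m k x : (t <= T)%N -> (k < M t)%N ->
  hahn N T S (t + m) (iter_back m (psi k)) x = lamk k * iter_back m (psi k) x.
Proof.
move=> tT kM; elim: m x => [|m IH] x; first by rewrite addn0 hahn_psi.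
rewrite addnS /= hahn_back (back_eq _ _ _ _ IH) /back; ring.
Qed.

(** On an eigenfunction each forw undoes one back, up to the factor that the
    factorization of the Hahn operator gives. *)
Lemma iter_forw_back m k x : (t <= T)%N -> (k < M t)%N ->
  iter m (@forw F) (iter_back m (psi k)) x =
  (\prod_(r < m) (lamk k + cst (t + r))) * psi k x.
Proof.
move=> tT kM; elim: m x => [|m IH] x; first by rewrite big_ord0 mul1r.
rewrite iterSr big_ord_recr /= [_ * (_ + _)]mulrC -mulrA -IH.
pose v z := \sum_(j < 1) iter_back m (psi k) z * (lamk k + cst (t + m)).
rewrite (_ : _ * iter _ _ _ _ = iter m (@forw F) v x); last first.
  by rewrite iter_forw_sum big_ord1 mulrC.
apply: iter_forw_eq => z; rewrite forw_back hahn_iter_back// /v big_ord1; ring.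
Qed.

Lemma iter_back_w2 m k x : iter_back m (psi k) x = wt2 (t + m) x *
  \sum_(j < k.+1) (hcoef F N T S t k j * \prod_(r < m) ((t + r + N)%:R - j%:R)) * ff F j x.
Proof.
elim: m x => [|m IH] x.
  rewrite addn0 /= /psi /hpoly; congr (_ * _); apply: eq_bigr => j _.
  by rewrite big_ord0 mulr1.
rewrite /= (back_eq _ _ _ _ IH) back_w2 addnS; congr (_ * _).
rewrite !mulr_sumr -big_split /=; apply: eq_bigr => j _.
rewrite big_ord_recr /=.
transitivity (hcoef F N T S t k j * (\prod_(r < m) ((t + r + N)%:R - j%:R)) *
   (((t + m)%:R + N%:R - x%:~R) * ff F j x + x%:~R * ff F j (x - 1))); first by ring.
rewrite ff_pred ffS !natrD; ring.
Qed.

(** At macroscopic times the right-hand side is of the order of the square of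
    the scale, so the factors that appear in denominators stay away from zero
    after rescaling, uniformly in k < N. *)
Lemma hlam_hconst k r : (k < N)%N -> (r < T)%N ->
  r.+1%:R * (T%:R - r%:R) <= lamk k + cst r :> F.
Proof.
move=> kN rT; rewrite -subr_ge0.
have -> : lamk k + cst r - r.+1%:R * (T%:R - r%:R) = ((N - 1 - k) * (T + N - k))%:R.
  rewrite natrM natrB; last by lia.
  rewrite natrB; last by lia.
  rewrite natrB; last by lia.
  rewrite /hlam /hconst natrD -natr1; ring.
by rewrite ler0n.
Qed.

Lemma hlam_hconst_gt0 k r : (k < N)%N -> (r < T)%N -> 0 < lamk k + cst r.
Proof.
move=> kN rT; apply: lt_le_trans (hlam_hconst kN rT).
by rewrite mulr_gt0 ?ltr0n// subr_gt0 ltr_nat.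
Qed.

(** The part of the correlation kernel that goes through the starting and the end
    points: transitions from x at time s to the end points, and from the starting
    points to y at time t. *)
Definition end_start s x y : F :=
  \sum_(j < N) \sum_(i < N)
    to_end s j x * invmx (gram F N T S) j i * from_start t i y.

(** The function from_start t i is w1 times a polynomial of degree less than
    N, and so orthogonal to the Hahn polynomials of degree at least N. *)
Lemma from_start_psi (i : 'I_N) k : (t <= T)%N -> (N <= k)%N -> (k < M t)%N ->
  \sum_(lo t <= x < lo t + M t) from_start t i x%:Z * psi k x%:Z = 0.
Proof.
move=> tT Nk kM; have [f [d fE] aE] := from_start_span t i.
transitivity (dotw N T S t (@hpoly F N T S t k) (fun x => \sum_(j < N) d j * ff F j x)).
  by apply: eq_bigr => x _; rewrite aE fE /psi; ring.
rewrite dotw_sumr big1// => j _; rewrite dotwC dotw_ff_hpoly ?mulr0//.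
exact: leq_trans (ltn_ord j) Nk.
Qed.

(** As an operator the kernel is a projection followed by the inverse of the
    forw transitions: it annihilates psi k for k at least N by orthogonality;
    for k < N, psi k is a multiple of the m-fold forw of iter_back m (psi k),
    which is in the span of the functions to_end (t + m) j, and the inverse
    of the Gram matrix reproduces that span. *)
Lemma end_start_psi m k x : (t + m <= T)%N -> (k < M t)%N ->
  \sum_(lo t <= y < lo t + M t) end_start (t + m) x y%:Z * psi k y%:Z =
  if (k < N)%N then (\prod_(r < m) (lamk k + cst (t + r)))^-1 * iter_back m (psi k) x
  else 0.
Proof.
move=> tmT kM; have tT : (t <= T)%N by rewrite (leq_trans _ tmT)// leq_addr.
have -> : \sum_(lo t <= y < lo t + M t) end_start (t + m) x y%:Z * psi k y%:Z =
    \sum_(j < N) \sum_(i < N) to_end (t + m) j x * invmx (gram F N T S) j i *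
    \sum_(lo t <= y < lo t + M t) from_start t i y%:Z * psi k y%:Z.
  under eq_bigr do rewrite /end_start mulr_suml.
  rewrite exchange_big /=; apply: eq_bigr => j _.
  under eq_bigr do rewrite mulr_suml.
  rewrite exchange_big /=; apply: eq_bigr => i _.
  by rewrite mulr_sumr; apply: eq_bigr => y _; rewrite mulrA.
have [kN|Nk] := ltnP k N; last first.
  by rewrite big1// => j _; rewrite big1// => i _; rewrite from_start_psi ?mulr0.
set P := \prod_(r < m) _.
have P0 : P != 0.
  by apply/prodf_neq0 => r _; rewrite gt_eqF// hlam_hconst_gt0//; have := ltn_ord r; lia.
have [d dE] : exists d : 'I_N -> F, forall z,
    iter_back m (psi k) z = \sum_(j < N) to_end (t + m) j z * d j.
  have /fin_all_exists[e eP] : forall l : 'I_N, exists e : 'I_N -> F, forall z,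
     wt2 (t + m) z * ff F l z = \sum_(j < N) to_end (t + m) j z * e j.
    by move=> l; apply: w2_span_to_end.
  pose c (l : nat) := hcoef F N T S t k l * \prod_(r < m) ((t + r + N)%:R - l%:R).
  exists (fun j => \sum_(l < k.+1) c l * e (widen_ord kN l) j) => z.
  rewrite iter_back_w2 mulr_sumr; under [RHS]eq_bigr do rewrite mulr_sumr.
  rewrite exchange_big /=; apply: eq_bigr => l _.
  rewrite mulrCA (eP (widen_ord kN l)) mulr_sumr; apply: eq_bigr => j _.
  by rewrite /c; ring.
have psiE z : P * psi k z = \sum_(j < N) to_end t j z * d j.
  rewrite -iter_forw_back// (iter_forw_eq _ dE) iter_forw_sum.
  by apply: eq_bigr => j _; rewrite iter_forw_to_end.
apply: (mulfI P0); rewrite mulrA mulfV// mul1r dE mulr_sumr; apply: eq_bigr => j _.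
transitivity (\sum_(i < N) to_end (t + m) j x * invmx (gram F N T S) j i *
    \sum_l gram F N T S i l * d l).
  rewrite mulr_sumr; apply: eq_bigr => i _; rewrite mulrCA; congr (_ * _).
  transitivity (\sum_(lo t <= y < lo t + M t) from_start t i y%:Z * (P * psi k y%:Z)).
    by rewrite mulr_sumr; apply: eq_bigr => y _; ring.
  under eq_bigr do rewrite psiE mulr_sumr.
  rewrite exchange_big /=; apply: eq_bigr => l _.
  rewrite -(from_start_to_end _ _ tT) mulr_suml; apply: eq_bigr => y _; ring.
transitivity (\sum_(l < N) to_end (t + m) j x * (invmx (gram F N T S) *m gram F N T S) j l * d l).
  under eq_bigr do rewrite mulr_sumr.
  rewrite exchange_big /=; apply: eq_bigr => l _; rewrite mxE mulr_sumr mulr_suml.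
  by apply: eq_bigr => i _; ring.
rewrite mulVmx ?gram_unit// (bigD1 j)//= mxE eqxx mulr1 big1 ?addr0// => l lj.
by rewrite mxE eq_sym (negbTE lj) mulr0 mul0r.
Qed.

(** Expand the delta function at y by completeness and apply the operator to
    each psi k. *)
Lemma end_startE m x y : (t + m <= T)%N -> in_slice N T S t y ->
  end_start (t + m) x y =
  \sum_(k < N) (\prod_(r < m) (lamk k + cst (t + r)))^-1 *
    iter_back m (psi k) x * chi k y.
Proof.
move=> tmT yS; have tT : (t <= T)%N by rewrite (leq_trans _ tmT)// leq_addr.
have NM := slice_size_ge N0 ST tT.
transitivity (\sum_(lo t <= z < lo t + M t) end_start (t + m) x z%:Z * (z%:Z == y)%:R).
  rewrite (sum_slice _ _ _ _ (fun z => end_start (t + m) x z * (z == y)%:R)).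
  have [j -> _] := in_sliceP N0 ST tT yS; rewrite (bigD1 j)//= eqxx mulr1 big1 ?addr0// => i ij.
  by rewrite eqz_nat eqn_add2l (_ : _ == _ = false) ?mulr0//; apply/negbTE.
transitivity (\sum_(k < M t) (\sum_(lo t <= z < lo t + M t) end_start (t + m) x z%:Z * psi k z%:Z) * chi k y).
  under [RHS]eq_bigr do rewrite mulr_suml.
  rewrite exchange_big /= big_nat [RHS]big_nat; apply: eq_bigr => z zM.
  rewrite -(psi_chi F N0 ST tT (x := z%:Z) (y := y))//.
  by rewrite mulr_sumr; apply: eq_bigr => k _; rewrite mulrA.
rewrite (big_ord_widen (M t) (fun k => (\prod_(r < m) (lamk k + cst (t + r)))^-1 *
    iter_back m (psi k) x * chi k y) NM) [RHS]big_mkcond; apply: eq_bigr => k _.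
by rewrite end_start_psi//; case: ifP; rewrite ?mul0r.
Qed.

End FromTime.

Lemma end_start_forw s m x y : (s + m <= T)%N ->
  end_start (s + m) s x y = iter m (@forw F) (fun z => end_start (s + m) (s + m) z y) x.
Proof.
move=> smT; rewrite /end_start.
pose d (j : 'I_N) := \sum_(i < N) invmx (gram F N T S) j i * from_start (s + m) i y.
transitivity (\sum_(j < N) iter m (@forw F) (to_end (s + m) j) x * d j).
  apply: eq_bigr => j _; rewrite mulr_sumr; apply: eq_bigr => i _.
  by rewrite iter_forw_to_end// mulrA.
rewrite -(iter_forw_sum m (fun j : 'I_N => to_end (s + m) j)); apply: iter_forw_eq => z.
by apply: eq_bigr => j _; rewrite mulr_sumr; apply: eq_bigr => i _; rewrite mulrA.
Qed.

Lemma iter_forw_delta m x y :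
  iter m (@forw F) (fun z => (z == y)%:R) x = binz F m (y - x).
Proof.
elim: m x => [|m IH] x; first by rewrite binz0 subr_eq0 eq_sym.
rewrite iterS (forw_eq IH) /forw binzS; congr (_ + _).
by congr (binz F _ _); lia.
Qed.

Lemma iter_forwB m f g x :
  iter m (@forw F) (fun z => f z - g z) x = iter m (@forw F) f x - iter m (@forw F) g x.
Proof.
by elim: m x => //= m IH x; rewrite (forw_eq IH) /forw addrACA opprD.
Qed.

(** The sum stops at the number N of paths, before the number of points of
    the slice: the kernel is a spectral projection of the Hahn operator,
    composed with transitions. *)
Lemma kernel_mx_ge n (pt : 'I_n -> nat) (px : 'I_n -> int) a b m :
  (pt b + m = pt a)%N -> (pt a <= T)%N -> in_slice N T S (pt b) (px b) ->
  kernel_mx F N T S pt px a b =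
  \sum_(k < N) (\prod_(r < m) (lamk k + cst (pt b + r)))^-1 *
    iter_back (pt b) m (psi F N T S (pt b) k) (px a) * chi F N T S (pt b) k (px b).
Proof.
move=> ptm ptT inS; rewrite -end_startE// ?ptm// /kernel_mx !mxE.
rewrite ltnNge -ptm leq_addr /= subr0 /end_start ptm exchange_big /=.
apply: eq_bigr => i _; rewrite !mxE mulr_suml; apply: eq_bigr => j _.
by rewrite !mxE.
Qed.

(** The kernel at the later time is propagated back by forw; subtracting the
    direct transitions amounts to replacing the projection by minus the
    complementary one. *)
Lemma kernel_mx_lt n (pt : 'I_n -> nat) (px : 'I_n -> int) a b m :
  (pt a + m.+1 = pt b)%N -> (pt b <= T)%N -> in_slice N T S (pt b) (px b) ->
  kernel_mx F N T S pt px a b =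
  iter m.+1 (@forw F) (fun z =>
    \sum_(k < N) psi F N T S (pt b) k z * chi F N T S (pt b) k (px b) -
    (z == px b)%:R) (px a).
Proof.
move=> ptm ptT inS; rewrite iter_forwB iter_forw_delta.
have -> : iter m.+1 (@forw F) (fun z =>
    \sum_(k < N) psi F N T S (pt b) k z * chi F N T S (pt b) k (px b)) (px a) =
    end_start (pt b) (pt a) (px a) (px b).
  rewrite -ptm end_start_forw ?ptm//; apply: iter_forw_eq => z.
  rewrite -[X in end_start _ X](addn0 (pt b)) end_startE ?addn0//.
  by apply: eq_bigr => k _; rewrite big_ord0 invr1 mul1r.
rewrite /kernel_mx !mxE -ptm {1}(_ : (pt a < pt a + m.+1)%N) ?addKn; last by lia.
congr (_ - _); rewrite ptm /end_start exchange_big /=.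
apply: eq_bigr => i _; rewrite !mxE mulr_suml; apply: eq_bigr => j _.
by rewrite !mxE.
Qed.

End HahnKernel.

(** * Uniform approximation by polynomials *)

Section Bernstein.
Variable R : realType.
Implicit Types (f g : R -> R) (p : {poly R}).

(** Bernstein polynomial of a sequence of values: the expectation of g at the
    number of successes among n independent trials of success probability X. *)
Fixpoint bernstein (n : nat) (g : nat -> R) : {poly R} :=
  if n is m.+1 then 'X * bernstein m (fun k => g k.+1) + (1 - 'X) * bernstein m g
  else (g 0%N)%:P.

Lemma bernsteinS n (g : nat -> R) (x : R) : (bernstein n.+1 g).[x] =
  x * (bernstein n (fun k => g k.+1)).[x] + (1 - x) * (bernstein n g).[x].
Proof. by rewrite /= hornerD !hornerM hornerD hornerN hornerX hornerC. Qed.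

Lemma bernstein_lin n (a b : R) (g h : nat -> R) (x : R) :
  (bernstein n (fun k => a * g k + b * h k)).[x] =
  a * (bernstein n g).[x] + b * (bernstein n h).[x].
Proof.
elim: n g h => [|n IH] g h; first by rewrite /= !hornerC.
have /= e := IH (fun k => g k.+1) (fun k => h k.+1).
rewrite !bernsteinS e IH; ring.
Qed.

Lemma bernstein_eq n (g h : nat -> R) x : (forall k, g k = h k) ->
  (bernstein n g).[x] = (bernstein n h).[x].
Proof. by move=> /funext ->. Qed.

Lemma bernstein_cst n (c x : R) : (bernstein n (fun=> c)).[x] = c.
Proof. elim: n => [|n IH]; first by rewrite /= hornerC. by rewrite bernsteinS IH; ring. Qed.

Lemma le_bernstein n (g h : nat -> R) x : 0 <= x <= 1 ->
  (forall k, (k <= n)%N -> g k <= h k) -> (bernstein n g).[x] <= (bernstein n h).[x].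
Proof.
move=> /andP[x0 x1]; elim: n g h => [|n IH] g h gh; first by rewrite /= !hornerC gh.
rewrite !bernsteinS lerD// ler_wpM2l ?subr_ge0//; apply: IH => k kn; apply: gh => //.
exact: leqW.
Qed.

Lemma bernstein_mean n (a x : R) : (bernstein n (fun k => k%:R - a)).[x] = n%:R * x - a.
Proof.
elim: n a => [|n IH] a; first by rewrite /= hornerC; ring.
rewrite bernsteinS IH (bernstein_eq _ _ (h := fun k => k%:R - (a - 1))); last first.
  by move=> k; rewrite -natr1; ring.
rewrite IH -natr1; ring.
Qed.

Lemma bernstein_var n (x : R) :
  (bernstein n (fun k => (k%:R - n%:R * x) ^+ 2)).[x] = n%:R * (x * (1 - x)).
Proof.
elim: n => [|n IH]; first by rewrite /= hornerC; ring.
rewrite bernsteinS.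
have e (a : R) : (bernstein n (fun k => (k%:R - n%:R * x + a) ^+ 2)).[x] = n%:R * (x * (1 - x)) + a ^+ 2.
  rewrite -IH (bernstein_eq _ _ (h := fun k => 1 * (1 * (k%:R - n%:R * x) ^+ 2 +
     (2 * a) * (k%:R - n%:R * x)) + 1 * a ^+ 2)); last by move=> k; ring.
  rewrite bernstein_lin bernstein_cst bernstein_lin bernstein_mean; ring.
rewrite (bernstein_eq _ _ (h := fun k => (k%:R - n%:R * x + (1 - x)) ^+ 2)); last first.
  by move=> k; rewrite -!natr1; ring.
rewrite (bernstein_eq _ _ (g := fun k => (k%:R - n.+1%:R * x) ^+ 2)
  (h := fun k => (k%:R - n%:R * x + (- x)) ^+ 2)); last first.
  by move=> k; rewrite -!natr1; ring.
rewrite !e -natr1; ring.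
Qed.

Definition bounded_lipschitz f := exists B L : R, [/\ 0 <= B, 0 <= L,
  forall x, `|f x| <= B & forall x y, `|f x - f y| <= L * `|x - y|].

Lemma bernstein_approx f (L e : R) : 0 < e -> (forall x y, `|f x - f y| <= L * `|x - y|) ->
  exists p, forall x, 0 <= x <= 1 -> `|f x - p.[x]| <= e.
Proof.
move=> e0 fL; pose e' : R := e / 2; have e'0 : 0 < e' by rewrite divr_gt0.
pose K : R := L ^+ 2 / (4 * e').
(* By the inequality of arithmetic and geometric means, L d <= e' + K d ^ 2;
   this leaves only the variance of the trials to be bounded. *)
have fK x y : `|f x - f y| <= e' + K * (x - y) ^+ 2.
  apply: le_trans (fL x y) _; rewrite -[(x - y) ^+ 2]real_normK ?num_real//.
  set d := `|x - y|; rewrite -subr_ge0.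
  rewrite (_ : _ - _ = (2 * e' - L * d) ^+ 2 / (4 * e')); last by rewrite /K; field; rewrite gt_eqF.
  by rewrite divr_ge0 ?sqr_ge0// mulr_ge0// ltW.
have K0 : 0 <= K by rewrite divr_ge0 ?sqr_ge0// mulr_ge0// ltW.
have [n nP] : exists n : nat, K <= e' * n.+1%:R.
  exists (Num.truncn (K / e')); rewrite mulrC -ler_pdivrMr//.
  by apply: ltW; rewrite truncnS_gt.
exists (bernstein n.+1 (fun k => f (k%:R / n.+1%:R))) => x x01.
have n0 : 0 < n.+1%:R :> R by rewrite ltr0n.
have bound : (bernstein n.+1 (fun k => e' * 1 + (K / n.+1%:R ^+ 2) * (k%:R - n.+1%:R * x) ^+ 2)).[x] <= e.
  rewrite bernstein_lin bernstein_cst bernstein_var.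
  have : K * (x * (1 - x)) <= e' * n.+1%:R.
    apply: le_trans nP; rewrite ler_piMr//; case/andP: x01 => x0 x1.
    by rewrite mulr_ile1// ?subr_ge0//; lra.
  rewrite -ler_pdivrMr// => h.
  rewrite (_ : K / _ * _ = K * (x * (1 - x)) / n.+1%:R); last by field; rewrite gt_eqF.
  by move: h; rewrite /e'; set z : R := _ / n.+1%:R => h; lra.
have fkx k : `|f (k%:R / n.+1%:R) - f x| <= e' * 1 + K / n.+1%:R ^+ 2 * (k%:R - n.+1%:R * x) ^+ 2.
  apply: le_trans (fK _ _) _; rewrite mulr1 lerD2l le_eqVlt; apply/orP; left.
  by apply/eqP; field; rewrite gt_eqF.
have -> : f x - (bernstein n.+1 (fun k => f (k%:R / n.+1%:R))).[x] =
    - (bernstein n.+1 (fun k => 1 * f (k%:R / n.+1%:R) + (-1) * f x)).[x].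
  by rewrite bernstein_lin bernstein_cst; ring.
rewrite normrN ler_norml; apply/andP; split; last first.
  apply: le_trans bound; apply: le_bernstein => // k _; rewrite mul1r mulN1r.
  exact: le_trans (ler_norm _) (fkx k).
rewrite lerNl; apply: le_trans bound.
set P := (bernstein _ _).[x].
have -> : - P = (bernstein n.+1 (fun k => 0 * 0 + (-1) * (1 * f (k%:R / n.+1%:R) + (-1) * f x))).[x].
  by rewrite (bernstein_lin n.+1 0 (-1) (fun=> 0)) -/P; ring.
apply: le_bernstein => // k _; apply: le_trans (fkx k).
by rewrite -normrN; apply: le_trans (ler_norm _); rewrite le_eqVlt; apply/orP; left; apply/eqP; ring.
Qed.

Lemma weierstrass f (L b e : R) : 0 < b -> 0 < e ->
  (forall x y, `|f x - f y| <= L * `|x - y|) ->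
  exists p, forall x, `|x| <= b -> `|f x - p.[x]| <= e.
Proof.
move=> b0 e0 fL.
have [|p pP] := @bernstein_approx (fun x => f (2 * b * x - b)) (L * (2 * b)) e e0.
  move=> x y; apply: le_trans (fL _ _) _.
  rewrite (_ : 2 * b * x - b - (2 * b * y - b) = 2 * b * (x - y)); last by ring.
  by rewrite normrM (gtr0_norm (x := 2 * b)) ?mulrA// mulr_gt0.
exists (p \Po ((2 * b)^-1 *: ('X + b%:P))) => x xb.
rewrite horner_comp hornerZ hornerD hornerX hornerC.
have := pP ((2 * b)^-1 * (x + b)).
rewrite [2 * b * _ - b](_ : _ = x); last by field; rewrite gt_eqF.
apply; move: xb; rewrite ler_norml => /andP[xb1 xb2].
rewrite mulr_ge0 ?invr_ge0 ?mulr_ge0 ?(ltW b0)//=; last by lra.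
by rewrite mulrC ler_pdivrMr ?mulr_gt0//; lra.
Qed.

Lemma bounded_lipschitz_cst (c : R) : bounded_lipschitz (fun=> c).
Proof.
by exists `|c|, 0; split => // x y; rewrite subrr normr0 mul0r.
Qed.

Lemma bounded_lipschitzD f g : bounded_lipschitz f -> bounded_lipschitz g -> bounded_lipschitz (fun x => f x + g x).
Proof.
move=> [B [L [B0 L0 fB fL]]] [B' [L' [B'0 L'0 gB gL]]].
exists (B + B'), (L + L'); split; rewrite ?addr_ge0// => x.
  exact: le_trans (ler_normD _ _) (lerD (fB x) (gB x)).
move=> y; rewrite opprD addrACA mulrDl.
exact: le_trans (ler_normD _ _) (lerD (fL x y) (gL x y)).
Qed.

Lemma bounded_lipschitzM f g : bounded_lipschitz f -> bounded_lipschitz g -> bounded_lipschitz (fun x => f x * g x).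
Proof.
move=> [B [L [B0 L0 fB fL]]] [B' [L' [B'0 L'0 gB gL]]].
exists (B * B'), (L * B' + B * L'); split; rewrite ?addr_ge0 ?mulr_ge0// => x.
  by rewrite normrM ler_pM.
move=> y; rewrite (_ : _ - _ = (f x - f y) * g x + f y * (g x - g y)); last by ring.
apply: le_trans (ler_normD _ _) _; rewrite !normrM mulrDl lerD//.
  by rewrite mulrAC ler_pM.
by rewrite -mulrA ler_pM.
Qed.

Lemma bounded_lipschitzX f m : bounded_lipschitz f -> bounded_lipschitz (fun x => f x ^+ m).
Proof.
move=> ff; elim: m => [|m IH]; first exact: (bounded_lipschitz_cst 1).
rewrite (_ : (fun x => _) = (fun x => f x * f x ^+ m)); first exact: bounded_lipschitzM.
by apply/funext => x; rewrite exprS.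
Qed.

Lemma bounded_lipschitz_continuous f : bounded_lipschitz f -> continuous f.
Proof.
move=> [B [L [_ L0 _ fL]]] x; apply/cvgrPdist_le => e e0.
have L1 : 0 < L + 1 by rewrite ltr_wpDl.
have d0 : 0 < e / (L + 1) by rewrite divr_gt0.
apply: filterS (nbhsx_ballx x _ d0) => y /= /ltW xy.
apply: le_trans (fL x y) _.
apply: (@le_trans _ _ ((L + 1) * `|x - y|)); first by rewrite ler_wpM2r// lerDl.
by rewrite -ler_pdivlMl// mulrC.
Qed.

End Bernstein.

(** * Integrals of bounded functions *)

Section BoundedIntegral.
Variable R : realType.
Implicit Types (f g : R -> R) (a b : R).

Definition bmeas f := measurable_fun [set: R] f /\ exists B : R, forall x, `|f x| <= B.

Definition integ a b f : R := \int[@lebesgue_measure R]_(x in `[a, b]) f x.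

Lemma bmeas_integrable f a b : bmeas f ->
  (@lebesgue_measure R).-integrable `[a, b] (EFin \o f).
Proof.
move=> [mf [B fB]]; apply: measurable_bounded_integrable => //.
- by rewrite /= lebesgue_measure_itv /=; case: ifP => _; rewrite ltry.
- exact: measurable_funS mf.
- by exists B; split; rewrite ?num_real// => c Bc x _ /=; rewrite (le_trans (fB x))// ltW.
Qed.

Lemma bmeas_cst (c : R) : bmeas (fun=> c).
Proof. by split; [exact: measurable_cst | exists `|c|]. Qed.

Lemma bmeasD f g : bmeas f -> bmeas g -> bmeas (fun x => f x + g x).
Proof.
move=> [mf [B fB]] [mg [C gC]]; split; first exact: measurable_funD.
by exists (B + C) => x; apply: le_trans (ler_normD _ _) (lerD (fB x) (gC x)).
Qed.

Lemma bmeasM f g : bmeas f -> bmeas g -> bmeas (fun x => f x * g x).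
Proof.
move=> [mf [B fB]] [mg [C gC]]; split; first exact: measurable_funM.
by exists (B * C) => x; rewrite normrM ler_pM.
Qed.

Lemma bmeasX f m : bmeas f -> bmeas (fun x => f x ^+ m).
Proof.
move=> bf; elim: m => [|m IH]; first exact: (bmeas_cst 1).
rewrite (_ : (fun x => _) = (fun x => f x * f x ^+ m)); first exact: bmeasM.
by apply/funext => x; rewrite exprS.
Qed.

Lemma bmeas_sum n (F : 'I_n -> R -> R) : (forall i, bmeas (F i)) ->
  bmeas (fun x => \sum_i F i x).
Proof.
elim: n F => [|n IH] F bF.
  by rewrite (_ : (fun x => _) = fun=> 0); [exact: bmeas_cst | apply/funext => x; rewrite big_ord0].
rewrite (_ : (fun x => _) = (fun x => F ord0 x + \sum_i F (lift ord0 i) x)).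
  by apply: bmeasD => //; apply: IH.
by apply/funext => x; rewrite big_ord_recl.
Qed.

Lemma bmeas_norm f : bmeas f -> bmeas (fun x => `|f x|).
Proof.
move=> [mf [B fB]]; split; last by exists B => x; rewrite normr_id.
exact: measurableT_comp.
Qed.

Lemma bmeas_continuous f (B : R) : continuous f -> (forall x, `|f x| <= B) -> bmeas f.
Proof. by move=> cf fB; split; [exact: continuous_measurable_fun | exists B]. Qed.

Lemma integD a b f g : bmeas f -> bmeas g ->
  integ a b (fun x => f x + g x) = integ a b f + integ a b g.
Proof. by move=> bf bg; rewrite /integ RintegralD//; exact: bmeas_integrable. Qed.

Lemma integB a b f g : bmeas f -> bmeas g ->
  integ a b (fun x => f x - g x) = integ a b f - integ a b g.
Proof. by move=> bf bg; rewrite /integ RintegralB//; exact: bmeas_integrable. Qed.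

Lemma integZ a b f (c : R) : bmeas f -> integ a b (fun x => c * f x) = c * integ a b f.
Proof. by move=> bf; rewrite /integ RintegralZl//; exact: bmeas_integrable. Qed.

Lemma eq_integ a b f g : (forall x, a <= x <= b -> f x = g x) -> integ a b f = integ a b g.
Proof.
by move=> fg; apply: eq_Rintegral => x; rewrite inE /= in_itv /=; exact: fg.
Qed.

Lemma integ_sum a b n (F : 'I_n -> R -> R) : (forall i, bmeas (F i)) ->
  integ a b (fun x => \sum_i F i x) = \sum_i integ a b (F i).
Proof.
elim: n F => [|n IH] F bF.
  rewrite big_ord0 -[RHS](mul0r (integ a b (fun=> 0))) -(integZ _ _ _ (bmeas_cst 0)).
  by apply: eq_integ => x _; rewrite big_ord0 mul0r.
rewrite big_ord_recl -IH// -integD//; last exact: bmeas_sum.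
by apply: eq_integ => x _; rewrite big_ord_recl.
Qed.

Lemma le_integ a b f g : bmeas f -> bmeas g ->
  (forall x, a <= x <= b -> f x <= g x) -> integ a b f <= integ a b g.
Proof.
move=> bf bg fg; apply: le_Rintegral => //; exact: bmeas_integrable.
Qed.

Lemma integ_cst a b (c : R) : a <= b -> integ a b (fun=> c) = c * (b - a).
Proof.
move=> ab; rewrite /integ Rintegral_cst//= lebesgue_measure_itv /=.
case: ifPn; rewrite lte_fin; first by rewrite -EFinB.
by rewrite -leNgt => ba; rewrite (le_anti (introT andP (conj ab ba))) subrr /= mulr0.
Qed.

Lemma norm_integ a b f : bmeas f -> `|integ a b f| <= integ a b (fun x => `|f x|).
Proof. by move=> bf; apply: le_normr_Rintegral => //; exact: bmeas_integrable. Qed.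

Lemma norm_integ_le a b f g : bmeas f -> bmeas g ->
  (forall x, a <= x <= b -> `|f x| <= g x) -> `|integ a b f| <= integ a b g.
Proof.
move=> bf bg fg; apply: le_trans (norm_integ _ _ bf) _.
by apply: le_integ => //; exact: bmeas_norm.
Qed.

Lemma bmeas_restrict f a b : bmeas f -> bmeas (fun x => f x * \1_`[a, b] x).
Proof.
move=> bf; apply: bmeasM => //; split; first exact: measurable_indic.
by exists 1 => x; rewrite indicE; case: (_ \in _); rewrite /= ?normr1 ?normr0.
Qed.

Lemma restrict_indic f (A : set R) : f \_ A = (fun x => f x * \1_A x).
Proof.
apply/funext => x; rewrite patchE indicE; case: ifPn => _; rewrite ?mulr1//.
by rewrite mulr0.
Qed.

Lemma integ_restrict a b c d f : a <= c -> d <= b ->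
  integ a b (fun x => f x * \1_`[c, d] x) = integ c d f.
Proof.
move=> ac db; rewrite /integ -restrict_indic -Rintegral_mkcondr.
congr Rintegral; rewrite setIidr//.
by move=> x /=; rewrite !in_itv /= => /andP[cx xd]; rewrite (le_trans ac)//= (le_trans _ db).
Qed.

Lemma integ_indic_le a b c d (B : R) : 0 <= B -> c <= d ->
  integ a b (fun x => B * \1_`[c, d] x) <= B * (d - c).
Proof.
move=> B0 cd; rewrite -(integ_cst B cd).
rewrite -(@integ_restrict (Num.min a c) (Num.max b d) c d) ?ge_min ?le_max ?lexx ?orbT//.
rewrite -(@integ_restrict (Num.min a c) (Num.max b d) a b) ?ge_min ?le_max ?lexx ?orbT//.
have bB : bmeas (fun x => B * \1_`[c, d] x) by apply: bmeas_restrict; exact: bmeas_cst.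
apply: le_integ => // [|x _]; first exact: bmeas_restrict.
rewrite ler_piMr// ?mulr_ge0// indicE; by case: (_ \in _).
Qed.

Lemma integ_setU a b c f : bmeas f -> a <= b -> b <= c ->
  integ a c f = integ a b f + integ b c f.
Proof.
move=> bf ab bc; apply/eqP; rewrite addrC -subr_eq; apply/eqP.
rewrite /integ (Rintegral_itvB (f := f)) ?bnd_simp//; last exact: bmeas_integrable.
rewrite Rintegral_itv_obnd_cbnd//.
apply: integrableS (bmeas_integrable b c bf) => //.
by apply: subset_itvr; rewrite bnd_simp.
Qed.

End BoundedIntegral.

(** * Spectral projections and convergence of moments *)

Section Clamp.
Variable R : realType.

Definition clamp (x : R) : R := Num.max 0 (Num.min 1 x).

Lemma clamp_itv x : 0 <= clamp x <= 1.
Proof. by rewrite /clamp le_max lexx ge_max ler01 ge_min lexx. Qed.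

Lemma clamp_lip x y : `|clamp x - clamp y| <= `|x - y|.
Proof.
wlog yx : x y / y <= x => [H|].
  by have [/H//|/ltW/H] := leP y x; rewrite distrC (distrC x).
rewrite [X in _ <= X]ger0_norm ?subr_ge0// /clamp.
have [hx|hx] := lerP 1 x; have [hy|hy] := lerP 1 y; rewrite ?(max_r ler01);
  have [hx0|hx0] := lerP 0 x; have [hy0|hy0] := lerP 0 y; rewrite ler_norml; lra.
Qed.

Lemma clamp0 x : x <= 0 -> clamp x = 0.
Proof. by move=> x0; rewrite /clamp; apply/max_idPl; rewrite ge_min x0 orbT. Qed.

Lemma clamp1 x : 1 <= x -> clamp x = 1.
Proof. by move=> x1; rewrite /clamp (min_idPl x1) (max_idPr _). Qed.

Lemma bounded_lipschitz_clamp (g : R -> R) (L : R) : 0 <= L ->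
  (forall x y, `|g x - g y| <= L * `|x - y|) -> bounded_lipschitz (fun x => clamp (g x)).
Proof.
move=> L0 gL; exists 1, L; split => // [x|x y].
  by have /andP[c0 c1] := clamp_itv (g x); rewrite ger0_norm.
exact: le_trans (clamp_lip _ _) (gL x y).
Qed.

End Clamp.

Section SpectralLimit.
Variables (R : realType) (U : Type) (Fi : set_system U).
Hypothesis FF : ProperFilter Fi.
Variables (M : U -> nat) (lam : U -> nat -> R) (sym : R -> R) (L : R).
Hypothesis L0 : 0 < L.
Hypothesis lamL : \forall u \near Fi, forall k, (k < M u)%N -> `|lam u k| <= L.
Hypothesis symL : forall th, `|sym th| <= L.
Hypothesis sym_meas : bmeas sym.

Local Notation I := (integ 0 (pi : R)).

Definition wsum (g : U -> nat -> R) (a : U -> nat -> R) (u : U) : R :=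
  \sum_(k < M u) g u k * a u k.

(** The measures with mass a u k at lam u k converge, in the sense of
    moments, to the image under sym of the measure with density p on the
    interval from 0 to pi. *)
Definition moments_cvg (a : U -> nat -> R) (p : R -> R) := forall m,
  (wsum (fun u k => lam u k ^+ m) a u @[u --> Fi] --> I (fun th => sym th ^+ m * p th)).

Lemma bmeas_horner (P : {poly R}) : bmeas (fun th => P.[sym th]).
Proof.
rewrite (_ : (fun th => _) = (fun th => \sum_(i < size P) P`_i * sym th ^+ i)).
  by apply: bmeas_sum => i; apply: bmeasM; [exact: bmeas_cst | exact: bmeasX].
by apply/funext => th; rewrite horner_coef.
Qed.

Lemma bmeas_bounded_lipschitz (h : R -> R) : bounded_lipschitz h -> bmeas (fun th => h (sym th)).
Proof.
move=> hl; have [B [K [_ _ hB _]]] := hl; split; last by exists B => x.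
apply: (measurableT_comp (f := h)); last by case: sym_meas.
by apply: continuous_measurable_fun; exact: bounded_lipschitz_continuous.
Qed.

Lemma poly_cvg a p (P : {poly R}) : bmeas p -> moments_cvg a p ->
  wsum (fun u k => P.[lam u k]) a u @[u --> Fi] --> I (fun th => P.[sym th] * p th).
Proof.
move=> bp ap.
rewrite (_ : wsum _ _ = (fun u => \sum_(i < size P) P`_i * wsum (fun u k => lam u k ^+ i) a u)); last first.
  apply/funext => u; rewrite /wsum; under [RHS]eq_bigr do rewrite mulr_sumr.
  rewrite exchange_big /=; apply: eq_bigr => k _; rewrite horner_coef mulr_suml.
  by apply: eq_bigr => i _; rewrite mulrA.
have -> : I (fun th => P.[sym th] * p th) =
    \sum_(i < size P) P`_i * I (fun th => sym th ^+ i * p th).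
  have bi i : bmeas (fun th => sym th ^+ i * p th) by apply: bmeasM => //; exact: bmeasX.
  under eq_bigr => i _ do rewrite -(integZ _ _ _ (bi i)).
  rewrite -integ_sum => [|i]; last by apply: bmeasM; [exact: bmeas_cst|].
  apply: eq_integ => th _; rewrite horner_coef mulr_suml.
  by apply: eq_bigr => i _; rewrite mulrA.
apply: cvg_big => [|i _]; first exact: add_continuous.
by apply: cvgMl_tmp; exact: ap.
Qed.

Lemma wsum_diff_le g h a b (e : R) u :
  (forall k, (k < M u)%N -> `|g u k - h u k| <= e) ->
  (forall k, (k < M u)%N -> `|a u k| <= b u k) ->
  `|wsum g a u - wsum h a u| <= e * wsum (fun _ _ => 1) b u.
Proof.
move=> gh ab; rewrite /wsum -sumrB mulr_sumr.
apply: le_trans (ler_norm_sum _ _ _) _; apply: ler_sum => k _.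
by rewrite -mulrBl normrM mul1r ler_pM ?gh ?ab.
Qed.

(** Approximate h uniformly by a polynomial on the interval that contains the
    spectrum. The masses a may have any sign; the masses b, which are bounded
    in total, control the error. *)
Lemma bounded_lipschitz_cvg a b p q (h : R -> R) : bmeas p -> bmeas q ->
  moments_cvg a p -> moments_cvg b q -> bounded_lipschitz h ->
  (\forall u \near Fi, forall k, (k < M u)%N -> `|a u k| <= b u k) ->
  wsum (fun u k => h (lam u k)) a u @[u --> Fi] --> I (fun th => h (sym th) * p th).
Proof.
move=> bp bq ap bq_ hl ab; have [B [K [_ _ _ hK]]] := hl.
have pi0 := pi_ge0 R.
pose Q : R := `|I q| + 1; pose C : R := Q + I (fun th => `|p th|).
have Q0 : 0 < Q by rewrite ltr_wpDl.
have Ip0 : 0 <= I (fun th => `|p th|) by apply: Rintegral_ge0.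
have C0 : 0 < C by rewrite ltr_wpDr.
apply/cvgrPdist_le => e e0; have {}e0 : 0 < e :> R := e0.
have e3 : 0 < e / (2 * C) by rewrite divr_gt0 ?mulr_gt0.
have [P hP] := weierstrass L0 e3 hK.
have bPp : bmeas (fun th => P.[sym th] * p th) by apply: bmeasM => //; exact: bmeas_horner.
have bhp : bmeas (fun th => h (sym th) * p th) by apply: bmeasM => //; exact: bmeas_bounded_lipschitz.
have hPI : `|I (fun th => h (sym th) * p th) - I (fun th => P.[sym th] * p th)| <=
    e / (2 * C) * I (fun th => `|p th|).
  rewrite -integB// -integZ; last exact: bmeas_norm.
  apply: norm_integ_le.
  - by rewrite (_ : (fun x => _) = (fun x => h (sym x) * p x + (-1) * (P.[sym x] * p x)));
      [apply: bmeasD => //; apply: bmeasM => //; exact: bmeas_cst | apply/funext => x; ring].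
  - by apply: bmeasM; [exact: bmeas_cst | exact: bmeas_norm].
  - by move=> th _; rewrite -mulrBl normrM ler_wpM2r// hP.
have /cvgrPdist_le/(_ _ (divr_gt0 e0 (ltr0n _ 2 : 0 < 2))) := poly_cvg (P := P) bp ap.
have bqQ : \forall u \near Fi, wsum (fun _ _ => 1) b u <= Q.
  have := bq_ 0%N; rewrite (eq_integ (g := q)) => [|th _]; last by rewrite mul1r.
  move=> /cvgrPdist_le/(_ 1 ltr01); apply: filterS => u.
  rewrite /wsum => hu; rewrite /Q.
  apply: le_trans (ler_norm _) _; rewrite -lerBlDl.
  by rewrite distrC in hu; apply: le_trans (lerB_dist _ _) hu.
move=> H; near=> u.
have lu : forall k, (k < M u)%N -> `|lam u k| <= L by near: u.
have au : forall k, (k < M u)%N -> `|a u k| <= b u k by near: u.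
have bu : wsum (fun _ _ => 1) b u <= Q by near: u.
have Hu : `|I (fun th => P.[sym th] * p th) - wsum (fun u k => P.[lam u k]) a u| <= e / 2 by near: u.
have d : `|wsum (fun u k => P.[lam u k]) a u - wsum (fun u k => h (lam u k)) a u| <= e / (2 * C) * Q.
  apply: le_trans (wsum_diff_le (e := e / (2 * C)) _ au) _; last by rewrite ler_wpM2l// ltW.
  by move=> k kM; rewrite distrC hP// lu.
have eC : e / (2 * C) * I (fun th => `|p th|) + e / (2 * C) * Q = e / 2.
  by rewrite -mulrDr [_ + Q]addrC -/C; field; rewrite gt_eqF.
set X := I (fun th => h (sym th) * p th) in hPI *.
set Y := I (fun th => P.[sym th] * p th) in hPI Hu.
set Z := wsum (fun u k => P.[lam u k]) a u in Hu d.
set W := wsum _ a u in d *.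
rewrite (_ : X - W = (X - Y) + (Y - Z) + (Z - W)); last by ring.
apply: le_trans (ler_normD _ _) _; apply: le_trans (lerD (ler_normD _ _) (lexx _)) _.
by move: hPI Hu d eC; lra.
Unshelve. all: by end_near. Qed.

(** Moments determine the limit of the spectral projection: the step function is
    squeezed between continuous functions, which differ from it only on a short
    interval around the angle phi where the symbol crosses the threshold. *)
Lemma projection_cvg a b p (kap phi threshold B : R) (r : R -> R) (F : U -> nat -> R) :
  bmeas p -> (forall th, `|p th| <= kap) ->
  moments_cvg a p -> moments_cvg b (fun=> kap) ->
  (\forall u \near Fi, forall k, (k < M u)%N -> `|a u k| <= b u k) ->
  bounded_lipschitz r -> 0 < B -> (forall x, `|r x| <= B) -> 0 <= phi <= pi ->
  (forall eta : R, 0 < eta -> exists2 d : R, 0 < d & forall th : R, 0 <= th <= pi ->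
     (th <= phi - eta -> threshold + d <= sym th) /\ (phi + eta <= th -> sym th <= threshold - d)) ->
  (forall e : R, 0 < e -> \forall u \near Fi, forall k, (k < M u)%N ->
     [/\ threshold + e <= lam u k -> `|F u k - r (lam u k)| <= e,
         lam u k <= threshold - e -> F u k = 0 & `|F u k| <= B]) ->
  wsum F a u @[u --> Fi] --> integ 0 phi (fun th => r (sym th) * p th).
Proof.
move=> bp pk ap bk ab rl B0 rB /andP[phi0 phipi] sep FP.
have kap0 : 0 <= kap by apply: le_trans (pk 0).
have pi0 := pi_ge0 R.
apply/cvgrPdist_le => e e0; have {}e0 : 0 < e :> R := e0.
(* The errors, all multiples of B * kap * eta or e1 * kap * pi, and the two
   moment approximations at precision e / 8 add up to at most e. *)
pose eta : R := e / (24 * (B * kap + 1)).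
have Bk : 0 < B * kap + 1 by rewrite ltr_wpDl// mulr_ge0// ltW.
have eta0 : 0 < eta by rewrite divr_gt0// mulr_gt0.
have etaE : 6 * (B * kap * eta) <= e / 4.
  have : B * kap * eta <= (B * kap + 1) * eta by rewrite ler_wpM2r ?(ltW eta0)// lerDl.
  rewrite (_ : (B * kap + 1) * eta = e / 24); last by rewrite /eta; field; rewrite gt_eqF.
  lra.
pose e1 : R := e / (4 * (kap * pi + 1)).
have kp : 0 < kap * pi + 1 by rewrite ltr_wpDl// mulr_ge0.
have e10 : 0 < e1 by rewrite divr_gt0// mulr_gt0.
have e1E : e1 * kap * pi <= e / 4.
  have : e1 * (kap * pi) <= e1 * (kap * pi + 1) by rewrite ler_wpM2l ?(ltW e10)// lerDl.
  have cancel4 (X : R) : 0 < X -> e / (4 * X) * X = e / 4.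
    by move=> X0; field; rewrite gt_eqF.
  by rewrite cancel4// mulrA.
have [d d0 dP] := sep eta eta0.
pose del : R := d / 2; have del0 : 0 < del by rewrite divr_gt0.
(* The function ramp replaces the step at the threshold; tent is 1 wherever
   ramp differs from the step, up to distance del, and 0 from distance d on. *)
pose ramp x := clamp ((x - threshold) / (2 * del) + 1 / 2).
pose tent x := clamp (2 - `|x - threshold| / del).
have rampl : bounded_lipschitz ramp.
  apply: (@bounded_lipschitz_clamp _ _ (2 * del)^-1) => [|x y]; first by rewrite invr_ge0 mulr_ge0 ?ltW.
  rewrite (_ : _ - _ = (2 * del)^-1 * (x - y)); last by ring.
  by rewrite normrM gtr0_norm// invr_gt0 mulr_gt0.
have tentl : bounded_lipschitz tent.
  apply: (@bounded_lipschitz_clamp _ _ del^-1) => [|x y]; first by rewrite invr_ge0 ltW.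
  rewrite (_ : _ - _ = del^-1 * (`|y - threshold| - `|x - threshold|)); last by ring.
  rewrite normrM gtr0_norm ?invr_gt0// ler_wpM2l ?invr_ge0 ?(ltW del0)//.
  by apply: le_trans (ler_dist_dist _ _) _; rewrite opprB addrA subrK distrC.
pose h x := r x * ramp x.
have hl : bounded_lipschitz h by exact: bounded_lipschitzM.
pose tau x := 2 * B * tent x + e1.
have taul : bounded_lipschitz tau by apply: bounded_lipschitzD; [apply: bounded_lipschitzM => //; exact: bounded_lipschitz_cst | exact: bounded_lipschitz_cst].
have ramp1 x : threshold + del <= x -> ramp x = 1.
  move=> hx; apply: clamp1; rewrite -lerBlDr ler_pdivlMr ?mulr_gt0//; lra.
have ramp0 x : x <= threshold - del -> ramp x = 0.
  move=> hx; apply: clamp0; rewrite -lerBrDr ler_pdivrMr ?mulr_gt0//; lra.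
have tent0 x : d <= `|x - threshold| -> tent x = 0.
  by move=> hx; apply: clamp0; rewrite subr_le0 ler_pdivlMr// /del; lra.
have tent1 x : `|x - threshold| <= del -> tent x = 1.
  move=> hx; apply: clamp1; have : `|x - threshold| / del <= 1 by rewrite ler_pdivrMr// mul1r.
  lra.
have bk_ : bmeas (fun _ : R => kap) := bmeas_cst kap.
have b0 : \forall u \near Fi, forall k, (k < M u)%N -> `|b u k| <= b u k.
  apply: filterS ab => u abu k kM; rewrite ger0_norm//.
  exact: le_trans (abu k kM).
pose J := `[phi - eta, phi + eta]%classic.
have J0 (c : R) : 0 <= c -> bmeas (fun th => c * \1_J th).
  by move=> c0; apply: bmeas_restrict; exact: bmeas_cst.
have outJ th : 0 <= th <= pi -> th \notin J ->
    (th <= phi - eta /\ threshold + d <= sym th) \/ (phi + eta <= th /\ sym th <= threshold - d).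
  move=> thpi; rewrite notin_setE /J /= in_itv /= => /negP.
  rewrite negb_and -!ltNge => /orP[|] /ltW h1.
    by left; split=> //; have [H _] := dP th thpi; apply: H.
  by right; split=> //; have [_ H] := dP th thpi; apply: H.
have E1 : `|integ 0 phi (fun th => r (sym th) * p th) - I (fun th => h (sym th) * p th)| <=
    B * kap * (2 * eta).
  rewrite -(@integ_restrict _ 0 pi)//.
  have b1 : bmeas (fun th => r (sym th) * p th) by apply: bmeasM => //; exact: bmeas_bounded_lipschitz.
  have b2 : bmeas (fun th => h (sym th) * p th) by apply: bmeasM => //; exact: bmeas_bounded_lipschitz.
  rewrite -integB//; last exact: bmeas_restrict.
  apply: le_trans (_ : I (fun th => B * kap * \1_J th) <= _); last first.
    apply: le_trans (integ_indic_le _ _ _ _) _; rewrite ?mulr_ge0 ?(ltW B0)//; first by lra.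
    by rewrite ler_wpM2l ?mulr_ge0 ?(ltW B0)//; lra.
  apply: norm_integ_le.
  - rewrite (_ : (fun th => _) = (fun th => r (sym th) * p th * \1_`[0, phi] th + (-1) * (h (sym th) * p th))).
      apply: bmeasD; first exact: bmeas_restrict.
      by apply: bmeasM => //; exact: bmeas_cst.
    by apply/funext => th; ring.
  - by apply: J0; rewrite mulr_ge0// ltW.
  move=> th thpi; rewrite (_ : _ - _ = r (sym th) * p th * (\1_`[0, phi] th - ramp (sym th))); last first.
    by rewrite /h; ring.
  rewrite !normrM; have [thJ|/(outJ _ thpi)] := boolP (th \in J).
    rewrite [X in _ <= _ * X]indicE thJ mulr1 -[leRHS]mulr1; apply: ler_pM; rewrite ?mulr_ge0//.
      by apply: ler_pM.
    have /andP[c0 c1] := clamp_itv ((sym th - threshold) / (2 * del) + 1 / 2).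
    rewrite -/(ramp (sym th)) in c0 c1.
    rewrite indicE; case: (_ \in _); rewrite ler_norml /=; lra.
  have rhs0 : 0 <= B * kap * \1_J th by rewrite !mulr_ge0 ?(ltW B0)// indicE.
  move=> [[thl sl]|[thr sr]].
    rewrite ramp1 ?indicE; last by rewrite /del; lra.
    rewrite mem_set ?subrr ?normr0 ?mulr0//= in_itv /=; case/andP: thpi => ? ?; lra.
  rewrite ramp0 ?indicE; last by rewrite /del; lra.
  rewrite memNset ?subrr ?normr0 ?mulr0//= in_itv /=; apply/negP; rewrite negb_and -!ltNge.
  by apply/orP; right; lra.
have E3 : I (fun th => tau (sym th) * kap) <= 2 * B * kap * (2 * eta) + e1 * kap * pi.
  apply: le_trans (_ : I (fun th => 2 * B * kap * \1_J th + e1 * kap) <= _); last first.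
    rewrite integD; [|by apply: J0; rewrite !mulr_ge0 ?(ltW B0)|exact: bmeas_cst].
    apply: lerD; last by rewrite integ_cst// subr0.
    apply: le_trans (integ_indic_le _ _ _ _) _; rewrite ?mulr_ge0 ?(ltW B0)//; first by lra.
    by rewrite ler_wpM2l ?mulr_ge0 ?(ltW B0)//; lra.
  apply: le_integ.
  - by apply: bmeasM => //; exact: bmeas_bounded_lipschitz.
  - by apply: bmeasD; [apply: J0; rewrite !mulr_ge0 ?(ltW B0) | exact: bmeas_cst].
  move=> th thpi; rewrite /tau mulrDl lerD2r.
  rewrite [leLHS]mulrAC; apply: ler_wpM2l; first by rewrite !mulr_ge0 ?(ltW B0).
  have /andP[c0 c1] := clamp_itv (2 - `|sym th - threshold| / del).
  rewrite -/(tent (sym th)) in c0 c1.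
  rewrite indicE; have [//|/(outJ _ thpi) H] := boolP (th \in J).
  rewrite tent0//; case: H => -[_ H]; [rewrite ger0_norm|rewrite ler0_norm]; lra.
have e8 : 0 < e / 8 by rewrite divr_gt0.
have /cvgrPdist_le/(_ _ e8) H2 := bounded_lipschitz_cvg bp bk_ ap bk hl ab.
have /cvgrPdist_le/(_ _ e8) H3 := bounded_lipschitz_cvg bk_ bk_ bk bk taul b0.
have mind : 0 < Num.min del e1 by rewrite lt_min del0.
have H4 := FP _ mind.
near=> u.
have au : forall k, (k < M u)%N -> `|a u k| <= b u k by near: u.
have : `|I (fun th => h (sym th) * p th) - wsum (fun u k => h (lam u k)) a u| <= e / 8 by near: u.
have : `|I (fun th => tau (sym th) * kap) - wsum (fun u k => tau (lam u k)) b u| <= e / 8 by near: u.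
have Fu : forall k, (k < M u)%N ->
     [/\ threshold + Num.min del e1 <= lam u k -> `|F u k - r (lam u k)| <= Num.min del e1,
         lam u k <= threshold - Num.min del e1 -> F u k = 0 & `|F u k| <= B] by near: u.
have E4 : `|wsum (fun u k => h (lam u k)) a u - wsum F a u| <= wsum (fun u k => tau (lam u k)) b u.
  rewrite /wsum -sumrB; apply: le_trans (ler_norm_sum _ _ _) _; apply: ler_sum => k _.
  rewrite -mulrBl normrM; apply: ler_pM => //; last exact: au.
  have [F1 F2 F3] := Fu k (ltn_ord k); set x := lam u k in F1 F2 *.
  have /andP[c0 c1] := clamp_itv (2 - `|x - threshold| / del); rewrite -/(tent x) in c0 c1.
  have t0 : 0 <= 2 * B * tent x by rewrite !mulr_ge0 ?(ltW B0).
  have m1 : Num.min del e1 <= e1 by rewrite ge_min lexx orbT.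
  have m2 : Num.min del e1 <= del by rewrite ge_min lexx.
  have [x1|x1] := leP (threshold + del) x.
    have Fx : `|F u k - r x| <= Num.min del e1 by apply: F1; lra.
    rewrite /h ramp1// mulr1 distrC /tau; lra.
  have [x2|x2] := leP x (threshold - del).
    rewrite /h ramp0// F2; last by lra.
    by rewrite mulr0 subr0 normr0 /tau; lra.
  rewrite /tau tent1 ?mulr1; last by rewrite ler_norml; lra.
  apply: le_trans (ler_normB _ _) _.
  have : `|h x| <= B.
    rewrite /h normrM -[leRHS]mulr1; apply: ler_pM => //.
    by rewrite ger0_norm; have /andP[] := clamp_itv ((x - threshold) / (2 * del) + 1 / 2).
  lra.
move: E4; set W := wsum F a u; set V := wsum _ a u; set Y := wsum _ b u => E4.
set Q := I _ in E3 * => HQ.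
move: E1; set A := integ 0 phi _; set A' := I _ => E1 HA.
rewrite (_ : A - W = (A - A') + (A' - V) + (V - W)); last by ring.
apply: le_trans (ler_normD _ _) _; apply: le_trans (lerD (ler_normD _ _) (lexx _)) _.
have : Y <= Q + e / 8 by move: HQ; rewrite ler_norml; lra.
move: E1 HA E4 E3 etaE e1E.
rewrite (_ : 2 * B * kap * (2 * eta) = 4 * (B * kap * eta)); last by ring.
rewrite (_ : B * kap * (2 * eta) = 2 * (B * kap * eta)); last by ring.
lra.
Unshelve. all: by end_near. Qed.

End SpectralLimit.

(** * Cosine moments *)

Section ContinuousIntegral.
Variable R : realType.
Implicit Types (f F : R -> R).

Lemma integ_FTC (f F : R -> R) (a b : R) : a <= b ->
  (forall x : R, is_derive x (1 : R) F (f x)) -> continuous f ->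
  integ a b f = F b - F a.
Proof.
move=> ab dF cf; have [<-|aneb] := eqVneq a b.
  by rewrite subrr /integ set_itv1 Rintegral_set1.
have altb : a < b by rewrite lt_neqAle aneb.
have cF : continuous F.
  move=> x; have [dx _] := dF x.
  exact/differentiable_continuous/derivable1_diffP.
rewrite /integ /Rintegral (@continuous_FTC2 _ f F a b)//.
- exact: continuous_subspaceT.
- split; [by move=> x _; case: (dF x) | |].
    exact/cvg_at_right_filter/cF.
  exact/cvg_at_left_filter/cF.
- by move=> x _; rewrite derive1E; case: (dF x).
Qed.

Lemma integ_reflect f (r a b : R) : a <= b -> continuous f ->
  integ (r - b) (r - a) f = integ a b (fun x => f (r - x)).
Proof.
move=> ab cf; have dF (x : R) : is_derive x (1 : R) (fun x => r - x) (-1).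
  have := is_deriveB (is_derive_cst r x (1 : R)) (is_derive_id x (1 : R)).
  by rewrite sub0r.
have F'E : derive1 (fun x : R => r - x) = cst (-1).
  by apply/funext => x; rewrite derive1E; case: (dF x).
rewrite /integ /Rintegral (@integration_by_substitution_decreasing _ (fun x => r - x))//.
- congr fine; apply: eq_integral => x _; congr EFin.
  rewrite F'E; transitivity (f (r - x) * - (-1)); first by [].
  by rewrite opprK mulr1.
- by move=> x y _ _ xy; rewrite ltrD2l ltrN2.
- by rewrite F'E => x _; exact: cst_continuous.
- by rewrite F'E; exact: is_cvg_cst.
- by rewrite F'E; exact: is_cvg_cst.
- have cF (x : R) : (fun x : R => r - x) y @[y --> x] --> r - x.
    by apply: cvgB; [exact: cvg_cst | exact: cvg_id].
  split; [by move=> x _; case: (dF x) | |].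
    exact/cvg_at_right_filter/cF.
  exact/cvg_at_left_filter/cF.
- exact: continuous_subspaceT.
Qed.

Lemma integ_even f (B m h : R) : 0 <= h -> continuous f -> (forall x, `|f x| <= B) ->
  (forall x, f (2 * m - x) = f x) -> integ (m - h) (m + h) f = 2 * integ m (m + h) f.
Proof.
move=> h0 cf fB fE; have bf := bmeas_continuous cf fB.
rewrite (integ_setU (b := m)) ?lerBlDr ?lerDl//.
have := @integ_reflect f (2 * m) m (m + h) _ cf; rewrite lerDl => /(_ h0).
rewrite (_ : 2 * m - (m + h) = m - h); last by ring.
rewrite (_ : 2 * m - m = m); last by ring.
move=> ->; rewrite (_ : (fun x => _) = f); first by ring.
exact/funext.
Qed.

Lemma integ_odd f (B m h : R) : 0 <= h -> continuous f -> (forall x, `|f x| <= B) ->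
  (forall x, f (2 * m - x) = - f x) -> integ (m - h) (m + h) f = 0.
Proof.
move=> h0 cf fB fE; have bf := bmeas_continuous cf fB.
rewrite (integ_setU (b := m)) ?lerBlDr ?lerDl//.
have := @integ_reflect f (2 * m) m (m + h) _ cf; rewrite lerDl => /(_ h0).
rewrite (_ : 2 * m - (m + h) = m - h); last by ring.
rewrite (_ : 2 * m - m = m); last by ring.
move=> ->; rewrite (_ : (fun x => _) = (fun x => (-1) * f x)); first by rewrite integZ//; ring.
by apply/funext => x; rewrite fE mulN1r.
Qed.

End ContinuousIntegral.

Section Cosine.
Variable R : realType.
Implicit Types (c th : R) (n : int).

(** In the limit, psi_k (x) chi_k (y) with x - y = n, as a function of the
    angle th that parametrizes the spectrum. *)
Definition cosn c n th : R := c ^ n * cos (n%:~R * th) / pi.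

Lemma continuous_cosZ (r : R) : continuous (fun th : R => cos (r * th)).
Proof.
move=> th; apply: continuous_comp; last exact: continuous_cos.
by apply: cvgMl_tmp; exact: cvg_id.
Qed.

Lemma is_derive_sinZ (r th : R) :
  is_derive th (1 : R) (fun th => sin (r * th)) (r * cos (r * th)).
Proof.
have dr : is_derive th (1 : R) (fun th => r * th) r.
  by have := is_deriveZ r (is_derive_id th (1 : R)); rewrite /GRing.scale /= mulr1.
by rewrite mulrC; exact: (is_derive1_comp (is_derive_sin (r * th)) dr).
Qed.

Lemma cosn_le c n th : 0 < c -> `|cosn c n th| <= c ^ n / pi.
Proof.
move=> c0; have pi0 := pi_gt0 R.
rewrite /cosn !normrM (gtr0_norm (x := c ^ n)) ?exprz_gt0//.
rewrite (gtr0_norm (x := pi^-1)) ?invr_gt0// ler_pM2r ?invr_gt0//.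
rewrite ler_piMr ?exprz_ge0 ?(ltW c0)//.
by rewrite ler_norml cos_geN1 cos_le1.
Qed.

Lemma bmeas_cosn c n : 0 < c -> bmeas (cosn c n).
Proof.
move=> c0; apply: (@bmeas_continuous _ _ (c ^ n / pi)) => [th|th]; last exact: cosn_le.
by apply: cvgMr_tmp; apply: cvgMl_tmp; exact: continuous_cosZ.
Qed.

Lemma sin_intpi n : sin (n%:~R * pi) = 0 :> R.
Proof.
have sin_natpi (k : nat) : sin (k%:R * pi) = 0 :> R.
  elim: k => [|k IH]; first by rewrite mul0r sin0.
  by rewrite -natr1 mulrDl mul1r sinDpi IH oppr0.
case: n => k; first exact: sin_natpi.
by rewrite NegzE mulrNz mulNr sinN -pmulrn sin_natpi oppr0.
Qed.

Lemma integ_cosn c n : integ 0 pi (cosn c n) = (n == 0)%:R.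
Proof.
have pi0 := pi_gt0 R.
have [->|n0] := eqVneq n 0.
  rewrite (eq_integ (g := fun=> pi^-1)) => [|th _].
    by rewrite integ_cst ?subr0 ?mulVf ?gt_eqF// ltW.
  by rewrite /cosn expr0z mul0r cos0 !mul1r.
have nR0 : n%:~R != 0 :> R by rewrite intr_eq0.
rewrite (eq_integ (g := fun th => (c ^ n / pi) * cos (n%:~R * th))) => [|th _]; last first.
  by rewrite /cosn; ring.
rewrite integZ; last first.
  apply: (@bmeas_continuous _ _ 1); first exact: continuous_cosZ.
  by move=> th; rewrite ler_norml cos_geN1 cos_le1.
suff -> : integ 0 pi (fun th : R => cos (n%:~R * th)) = 0 by rewrite mulr0.
have dF (th : R) : is_derive th (1 : R) (fun th => n%:~R^-1 * sin (n%:~R * th)) (cos (n%:~R * th)).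
  have := is_deriveZ (n%:~R^-1 : R) (is_derive_sinZ n%:~R th).
  by rewrite /GRing.scale /= mulrA mulVf// mul1r.
rewrite (integ_FTC (ltW pi0) dF); last exact: continuous_cosZ.
by rewrite sin_intpi !mulr0 sin0 ?mulr0 subrr.
Qed.

End Cosine.

(** * Scaling limits *)

Section Scaling.
Variable R : realType.
Implicit Types (f g : R -> R) (l m : R).

Lemma near_eq_cvg_to f g l : (\forall rho \near +oo, f rho = g rho) ->
  g rho @[rho --> +oo] --> l -> f rho @[rho --> +oo] --> l.
Proof.
move=> fg; apply: cvg_trans; apply: near_eq_cvg.
by apply: filterS fg => rho ->.
Qed.

Definition scaled f l := f rho / rho @[rho --> +oo] --> l.

Lemma scaledD f g l m : scaled f l -> scaled g m -> scaled (fun rho => f rho + g rho) (l + m).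
Proof.
move=> fl gm; rewrite /scaled (_ : (fun rho => _) = (fun rho => f rho / rho + g rho / rho)).
  exact: cvgD.
by apply/funext => rho; rewrite mulrDl.
Qed.

Lemma scaledN f l : scaled f l -> scaled (fun rho => - f rho) (- l).
Proof.
move=> fl; rewrite /scaled (_ : (fun rho => _) = (fun rho => - (f rho / rho))).
  exact: cvgN.
by apply/funext => rho; rewrite mulNr.
Qed.

Lemma scaledB f g l m : scaled f l -> scaled g m -> scaled (fun rho => f rho - g rho) (l - m).
Proof. by move=> fl gm; apply: scaledD => //; exact: scaledN. Qed.

Lemma near_gt (a : R) : \forall rho \near +oo, a < rho.
Proof. by apply: nbhs_pinfty_gt; rewrite num_real. Qed.

Lemma scaled_bounded f (B : R) : (\forall rho \near +oo, `|f rho| <= B) -> scaled f 0.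
Proof.
move=> fB; apply/cvgrPdist_le => e e0; have {}e0 : 0 < e :> R := e0.
near=> rho.
have rho0 : 0 < rho by near: rho; exact: near_gt.
have rhoB : B / e < rho by near: rho; exact: near_gt.
rewrite sub0r normrN normrM normfV (gtr0_norm rho0) ler_pdivrMr//.
have fBr : `|f rho| <= B by near: rho.
by apply: le_trans fBr _; rewrite mulrC -ler_pdivrMr// ltW.
Unshelve. all: by end_near. Qed.

Lemma scaled_cst (c : R) : scaled (fun=> c) 0.
Proof. by apply: (@scaled_bounded _ `|c|); apply: nearW. Qed.

Lemma scaled_mul f g l m : scaled f l -> scaled g m ->
  (f rho * g rho) / rho ^+ 2 @[rho --> +oo] --> l * m.
Proof.
move=> fl gm; rewrite (_ : (fun rho => _) = (fun rho => (f rho / rho) * (g rho / rho))).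
  exact: cvgM.
by apply/funext => rho; rewrite expr2 invfM mulrACA.
Qed.

Lemma scaled_near_gt f l m : scaled f l -> m < l -> \forall rho \near +oo, m * rho < f rho.
Proof.
move=> fl ml; near=> rho.
have rho0 : 0 < rho by near: rho; exact: near_gt.
rewrite -ltr_pdivlMr//; near: rho.
exact: (cvgr_gt _ fl).
Unshelve. all: by end_near. Qed.

Lemma scaled_pos f l : scaled f l -> 0 < l -> \forall rho \near +oo, 0 < f rho.
Proof. by move=> fl l0; have := scaled_near_gt fl l0; under eq_near do rewrite mul0r. Qed.

Lemma scaled_littleo f l : (fun rho => f rho - rho * l) =o_ +oo (fun rho : R => rho) ->
  scaled f l.
Proof.
move=> /eqoP fo; apply/cvgrPdist_le => e e0; have {}e0 : 0 < e :> R := e0.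
near=> rho.
have rho0 : 0 < rho by near: rho; exact: near_gt.
rewrite (_ : l - _ = - ((f rho - rho * l) / rho)); last by field; rewrite gt_eqF.
rewrite normrN normrM normfV ler_pdivrMr ?normr_gt0 ?gt_eqF//.
by near: rho; apply: fo.
Unshelve. all: by end_near. Qed.

Lemma scaled_floor (a : R) (z : int) :
  scaled (fun rho => (Num.floor (rho * a) + z)%:~R) a.
Proof.
rewrite -[a]addr0.
have h : scaled (fun rho => rho * a) a.
  apply/cvgrPdist_le => e e0; near=> rho.
  have rho0 : 0 < rho by near: rho; exact: near_gt.
  by rewrite mulrAC divff ?gt_eqF// mul1r subrr normr0 ltW.
have := scaledD h (@scaled_bounded (fun rho => (Num.floor (rho * (a + 0)) + z)%:~R - rho * a) (1 + `|z%:~R|) _).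
rewrite (_ : (fun rho => rho * a + _) = (fun rho => (Num.floor (rho * (a + 0)) + z)%:~R)).
  apply; apply: nearW => rho; rewrite addr0 intrD addrAC.
  apply: le_trans (ler_normD _ _) _; rewrite lerD2r distrC.
  have /andP[f1 f2] := floor_itv (rho * a).
  rewrite ger0_norm ?subr_ge0// lerBlDr; rewrite intrD in f2.
  by rewrite ltW// addrC.
by apply/funext => rho; rewrite addrC subrK.
Unshelve. all: by end_near. Qed.

End Scaling.

(** * Local limit of the kernel *)

Section LocalLimit.
Variable R : realType.
Variables (N S T tt : R -> nat) (X : R -> int) (N0 S0 T0 t0 x0 : R).
Hypotheses (hN0 : 0 < N0) (hS0 : 0 < S0) (hST0 : S0 < T0) (ht0 : 0 < t0) (htT0 : t0 < T0).
Hypotheses (hx0 : 0 < x0) (hxl : t0 + S0 - T0 < x0) (hxt : x0 < N0 + t0) (hxS : x0 < N0 + S0).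
Hypotheses (sN : scaled (fun rho => (N rho)%:R) N0) (sS : scaled (fun rho => (S rho)%:R) S0)
  (sT : scaled (fun rho => (T rho)%:R) T0) (st : scaled (fun rho => (tt rho)%:R) t0)
  (sX : forall z, scaled (fun rho => (X rho + z)%:~R) x0).
Hypothesis hmodel : \forall rho \near +oo, (1 <= N rho)%N /\ (S rho <= T rho)%N.

Local Notation Msz rho := (slice_size (N rho) (T rho) (S rho) (tt rho)).

(** Divided by the square of the scale, the coefficients of the conjugated
    Hahn operator have limits: al2 for f (x + 1), be2 for f (x - 1), and al2
    + be2 - cst0 for f x. The limit operator is translation invariant, and
    conjugation by the powers of cratio makes it symmetric; symb is its
    symbol. *)
Definition al2 : R := (T0 - t0 - S0 + x0) * (t0 + N0 - x0).
Definition be2 : R := (S0 + N0 - x0) * x0.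
Definition cst0 : R := (t0 + N0) * (T0 - t0 + N0).
Definition cratio : R := Num.sqrt (be2 / al2).
Definition symb (th : R) : R := al2 + be2 - cst0 + 2 * (al2 * cratio) * cos th.
(** The limit of the rescaled eigenvalue of index N, where the sum over k < N
    stops. *)
Definition threshold : R := - (N0 * (T0 + N0)).

Lemma al2_gt0 : 0 < al2.
Proof.
have p1 : 0 < T0 - t0 - S0 + x0 by move: hxl; lra.
have p2 : 0 < t0 + N0 - x0 by move: hxt; lra.
exact: mulr_gt0.
Qed.

Lemma be2_gt0 : 0 < be2.
Proof.
have p1 : 0 < S0 + N0 - x0 by move: hxS; lra.
exact: mulr_gt0.
Qed.

Lemma cratio_gt0 : 0 < cratio.
Proof. by rewrite sqrtr_gt0 divr_gt0 ?al2_gt0 ?be2_gt0. Qed.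

Lemma cratio2 : al2 * cratio ^+ 2 = be2.
Proof.
have := al2_gt0; have := be2_gt0 => b0 a0.
by rewrite sqr_sqrtr ?divr_ge0 ?ltW//; field; rewrite gt_eqF.
Qed.

Lemma near_params : \forall rho \near +oo,
  [/\ (0 < N rho)%N, (S rho <= T rho)%N & (tt rho < T rho)%N].
Proof.
have h : \forall rho \near +oo, 0 < ((T rho)%:R - (tt rho)%:R : R).
  by apply: scaled_pos; [apply: scaledB; [exact: sT|exact: st] | rewrite subr_gt0].
near=> rho; have [] : (1 <= N rho)%N /\ (S rho <= T rho)%N by near: rho.
have : 0 < ((T rho)%:R - (tt rho)%:R : R) by near: rho.
by rewrite subr_gt0 ltr_nat.
Unshelve. all: by end_near. Qed.

Lemma near_slice z : \forall rho \near +oo,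
  in_slice (N rho) (T rho) (S rho) (tt rho) (X rho + z).
Proof.
have h1 : \forall rho \near +oo, 0 < ((X rho + z)%:~R : R) by exact: scaled_pos (sX z) _.
have h2 : \forall rho \near +oo, 0 < ((X rho + z)%:~R - ((tt rho)%:R + (S rho)%:R - (T rho)%:R) : R).
  have p : 0 < x0 - (t0 + S0 - T0) by move: hxl; lra.
  exact: scaled_pos (scaledB (sX z) (scaledB (scaledD st sS) sT)) p.
have h3 : \forall rho \near +oo, 0 < ((N rho)%:R + (tt rho)%:R - (X rho + z)%:~R : R).
  have p : 0 < N0 + t0 - x0 by move: hxt; lra.
  exact: scaled_pos (scaledB (scaledD sN st) (sX z)) p.
have h4 : \forall rho \near +oo, 0 < ((N rho)%:R + (S rho)%:R - (X rho + z)%:~R : R).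
  have p : 0 < N0 + S0 - x0 by move: hxS; lra.
  exact: scaled_pos (scaledB (scaledD sN sS) (sX z)) p.
near=> rho.
have [Np ST tT] : [/\ (0 < N rho)%N, (S rho <= T rho)%N & (tt rho < T rho)%N].
  by near: rho; exact: near_params.
have : 0 < ((X rho + z)%:~R : R) by near: rho.
have : 0 < ((X rho + z)%:~R - ((tt rho)%:R + (S rho)%:R - (T rho)%:R) : R) by near: rho.
have : 0 < ((N rho)%:R + (tt rho)%:R - (X rho + z)%:~R : R) by near: rho.
have : 0 < ((N rho)%:R + (S rho)%:R - (X rho + z)%:~R : R) by near: rho.
set x := X rho + z; rewrite !pmulrn -!(intrD, mulrNz) !ltr0z => g4 g3 g2 g1.
rewrite /in_slice (slice_sizeK Np ST (ltnW tT)) /slice_lo; lia.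
Unshelve. all: by end_near. Qed.

Definition lamr (rho : R) (k : nat) : R := hlam R (N rho) (T rho) k / rho ^+ 2.
Definition psiz z rho k := psi R (N rho) (T rho) (S rho) (tt rho) k (X rho + z).
Definition chiz z rho k := chi R (N rho) (T rho) (S rho) (tt rho) k (X rho + z).

Lemma hahn_psiz z : \forall rho \near +oo, forall k, (k < Msz rho)%N ->
  lamr rho k * psiz z rho k =
  ((T rho)%:R - (tt rho)%:R - (S rho)%:R + (X rho + z)%:~R + 1) *
    ((tt rho)%:R + (N rho)%:R - (X rho + z)%:~R - 1) / rho ^+ 2 * psiz (z + 1) rho k +
  ((T rho)%:R - (tt rho)%:R - (S rho)%:R + (X rho + z)%:~R) *
     ((tt rho)%:R + (N rho)%:R - (X rho + z)%:~R) / rho ^+ 2 * psiz z rho k +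
  ((S rho)%:R + (N rho)%:R - (X rho + z)%:~R - 1) * ((X rho + z)%:~R + 1) / rho ^+ 2 * psiz z rho k -
  ((tt rho)%:R + (N rho)%:R) * ((T rho)%:R - (tt rho)%:R + (N rho)%:R - 1) / rho ^+ 2 * psiz z rho k +
  ((S rho)%:R + (N rho)%:R - (X rho + z)%:~R) * (X rho + z)%:~R / rho ^+ 2 * psiz (z - 1) rho k.
Proof.
apply: filterS near_params => rho [Np ST tT] k kM.
rewrite /lamr mulrAC -(hahn_psi R Np ST (ltnW tT) _ kM) /hahn /hconst /psiz !addrA.
ring.
Qed.

Lemma coef1_cvg z : ((T rho)%:R - (tt rho)%:R - (S rho)%:R + (X rho + z)%:~R + 1) *
    ((tt rho)%:R + (N rho)%:R - (X rho + z)%:~R - 1) / rho ^+ 2 @[rho --> +oo] --> al2.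
Proof.
have one0 := @scaled_cst R 1.
rewrite (_ : al2 = (T0 - t0 - S0 + x0 + 0) * (t0 + N0 - x0 - 0)); last by rewrite addr0 subr0.
exact: scaled_mul (scaledD (scaledD (scaledB (scaledB sT st) sS) (sX z)) one0)
  (scaledB (scaledB (scaledD st sN) (sX z)) one0).
Qed.

Lemma coef2_cvg z : ((T rho)%:R - (tt rho)%:R - (S rho)%:R + (X rho + z)%:~R) *
     ((tt rho)%:R + (N rho)%:R - (X rho + z)%:~R) / rho ^+ 2 @[rho --> +oo] --> al2.
Proof.
exact: scaled_mul (scaledD (scaledB (scaledB sT st) sS) (sX z)) (scaledB (scaledD st sN) (sX z)).
Qed.

Lemma coef3_cvg z : ((S rho)%:R + (N rho)%:R - (X rho + z)%:~R - 1) * ((X rho + z)%:~R + 1) / rho ^+ 2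
   @[rho --> +oo] --> be2.
Proof.
have one0 := @scaled_cst R 1.
rewrite (_ : be2 = (S0 + N0 - x0 - 0) * (x0 + 0)); last by rewrite addr0 subr0.
exact: scaled_mul (scaledB (scaledB (scaledD sS sN) (sX z)) one0) (scaledD (sX z) one0).
Qed.

Lemma coef4_cvg : ((tt rho)%:R + (N rho)%:R) * ((T rho)%:R - (tt rho)%:R + (N rho)%:R - 1) / rho ^+ 2
   @[rho --> +oo] --> cst0.
Proof.
rewrite (_ : cst0 = (t0 + N0) * (T0 - t0 + N0 - 0)); last by rewrite subr0.
exact: scaled_mul (scaledD st sN) (scaledB (scaledD (scaledB sT st) sN) (@scaled_cst R 1)).
Qed.

Lemma coef5_cvg z : ((S rho)%:R + (N rho)%:R - (X rho + z)%:~R) * (X rho + z)%:~R / rho ^+ 2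
   @[rho --> +oo] --> be2.
Proof. exact: scaled_mul (scaledB (scaledD sS sN) (sX z)) (sX z). Qed.

Lemma cosn_rec n th : al2 * cosn cratio (n + 1) th + (al2 + be2 - cst0) * cosn cratio n th +
  be2 * cosn cratio (n - 1) th = symb th * cosn cratio n th.
Proof.
have c0 : cratio != 0 by rewrite gt_eqF// cratio_gt0.
have e1 : cratio ^ (n + 1) = cratio ^ n * cratio by rewrite expfzDr.
have e2 : cratio ^ (n - 1) = cratio ^ n / cratio by rewrite expfzDr.
have e3 : (n + 1)%:~R * th = n%:~R * th + th by ring.
have e4 : (n - 1)%:~R * th = n%:~R * th - th by ring.
have p0 : (pi : R) != 0 by rewrite gt_eqF// pi_gt0.
rewrite /cosn /symb e1 e2 e3 e4 cosD cosB -cratio2.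
move: (cratio ^ n) (cos (n%:~R * th)) (sin (n%:~R * th)) (cos th) (sin th) => e C D C' D'.
move: (pi : R) p0 al2 cst0 cratio c0 => p p0 a b c c0.
by field; rewrite c0 p0.
Qed.

Lemma symb_meas : bmeas symb.
Proof.
have c1 := @bmeas_cst R; apply: bmeasD => //; apply: bmeasM => //.
apply: (@bmeas_continuous _ _ 1); first exact: continuous_cos.
by move=> th; rewrite ler_norml cos_geN1 cos_le1.
Qed.

(** The case m = 0 is completeness. A further factor of the eigenvalue is an
    application of the Hahn operator, whose limit acts on cosn as
    multiplication by the symbol. *)
Lemma moments z y : @moments_cvg R R (pinfty_nbhs R) (fun rho => Msz rho) lamr symb
  (fun rho k => psiz z rho k * chiz y rho k) (cosn cratio (z - y)).
Proof.
move=> m; elim: m z => [|m IH] z.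
  rewrite (eq_integ (g := cosn cratio (z - y))) => [|th _]; last by rewrite mul1r.
  rewrite integ_cosn; apply: near_eq_cvg_to; last exact: cvg_cst.
  near=> rho.
  have [Np ST tT] : [/\ (0 < N rho)%N, (S rho <= T rho)%N & (tt rho < T rho)%N].
    by near: rho; exact: near_params.
  have inz : in_slice (N rho) (T rho) (S rho) (tt rho) (X rho + z) by near: rho; exact: near_slice.
  have iny : in_slice (N rho) (T rho) (S rho) (tt rho) (X rho + y) by near: rho; exact: near_slice.
  rewrite subr_eq0 -(inj_eq (addrI (X rho))) -(psi_chi R Np ST (ltnW tT) inz iny).
  by apply: eq_bigr => k _; rewrite mul1r.
have bcos n := bmeas_cosn n cratio_gt0.
have bsc k n : bmeas (fun th => symb th ^+ k * cosn cratio n th) by apply: bmeasM => //; apply: bmeasX; exact: symb_meas.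
have -> : integ 0 pi (fun th => symb th ^+ m.+1 * cosn cratio (z - y) th) =
  al2 * integ 0 pi (fun th => symb th ^+ m * cosn cratio (z + 1 - y) th) +
  al2 * integ 0 pi (fun th => symb th ^+ m * cosn cratio (z - y) th) +
  be2 * integ 0 pi (fun th => symb th ^+ m * cosn cratio (z - y) th) -
  cst0 * integ 0 pi (fun th => symb th ^+ m * cosn cratio (z - y) th) +
  be2 * integ 0 pi (fun th => symb th ^+ m * cosn cratio (z - 1 - y) th).
  rewrite (_ : z + 1 - y = z - y + 1); last by lia.
  rewrite (_ : z - 1 - y = z - y - 1); last by lia.
  set I1 := integ _ _ _; set I2 := integ _ _ _; set I3 := integ _ _ _; set I4 := integ _ _ _.
  transitivity (al2 * I2 + (al2 + be2 - cst0) * I3 + be2 * I4); last by ring.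
  have bz k n e : bmeas (fun th => e * (symb th ^+ k * cosn cratio n th)).
    by apply: bmeasM; [exact: bmeas_cst|].
  rewrite /I2 /I3 /I4 -!integZ// -!integD//; last exact: bmeasD.
  apply: eq_integ => th _; rewrite exprSr -mulrA -cosn_rec; ring.
apply: (near_eq_cvg_to (g := fun rho =>
  ((T rho)%:R - (tt rho)%:R - (S rho)%:R + (X rho + z)%:~R + 1) *
    ((tt rho)%:R + (N rho)%:R - (X rho + z)%:~R - 1) / rho ^+ 2 *
    wsum (fun rho => Msz rho) (fun u k => lamr u k ^+ m) (fun rho k => psiz (z + 1) rho k * chiz y rho k) rho +
  ((T rho)%:R - (tt rho)%:R - (S rho)%:R + (X rho + z)%:~R) *
     ((tt rho)%:R + (N rho)%:R - (X rho + z)%:~R) / rho ^+ 2 *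
    wsum (fun rho => Msz rho) (fun u k => lamr u k ^+ m) (fun rho k => psiz z rho k * chiz y rho k) rho +
  ((S rho)%:R + (N rho)%:R - (X rho + z)%:~R - 1) * ((X rho + z)%:~R + 1) / rho ^+ 2 *
    wsum (fun rho => Msz rho) (fun u k => lamr u k ^+ m) (fun rho k => psiz z rho k * chiz y rho k) rho -
  ((tt rho)%:R + (N rho)%:R) * ((T rho)%:R - (tt rho)%:R + (N rho)%:R - 1) / rho ^+ 2 *
    wsum (fun rho => Msz rho) (fun u k => lamr u k ^+ m) (fun rho k => psiz z rho k * chiz y rho k) rho +
  ((S rho)%:R + (N rho)%:R - (X rho + z)%:~R) * (X rho + z)%:~R / rho ^+ 2 *
    wsum (fun rho => Msz rho) (fun u k => lamr u k ^+ m) (fun rho k => psiz (z - 1) rho k * chiz y rho k) rho)).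
  apply: filterS (hahn_psiz z) => rho H.
  rewrite /wsum !mulr_sumr -!big_split -sumrB -big_split /=; apply: eq_bigr => k _.
  transitivity (lamr rho k ^+ m * chiz y rho k * (lamr rho k * psiz z rho k)).
    by rewrite exprSr; ring.
  rewrite (H _ (ltn_ord k)).
  ring.
have l1 := coef1_cvg z; have l2 := coef2_cvg z; have l3 := coef3_cvg z.
have l4 := coef4_cvg; have l5 := coef5_cvg z.
by apply: cvgD; [apply: cvgB; [apply: cvgD; [apply: cvgD|]|]|]; apply: cvgM => //; exact: IH.
Unshelve. all: by end_near. Qed.

Local Notation W1 rho x := (w1 R (N rho) (tt rho) x).
Local Notation W2 rho x := (w2 R (N rho) (T rho) (S rho) (tt rho) x).

(** What is bounded is the ratio of psi_k (z) chi_k (y) to psi_k (y) chi_k (z), which does not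
    depend on k; see psi_chi_bound. *)
Definition ratio_bounded (z y : int) := exists2 kap : R, 0 < kap & \forall rho \near +oo,
  W1 rho (X rho + y) * W2 rho (X rho + z) <= kap * (W1 rho (X rho + z) * W2 rho (X rho + y)).

Lemma near_weights z : \forall rho \near +oo,
  0 < W1 rho (X rho + z) /\ 0 < W2 rho (X rho + z).
Proof.
near=> rho.
have [Np ST tT] : [/\ (0 < N rho)%N, (S rho <= T rho)%N & (tt rho < T rho)%N].
  by near: rho; exact: near_params.
have inz : in_slice (N rho) (T rho) (S rho) (tt rho) (X rho + z) by near: rho; exact: near_slice.
have [i -> _] := in_sliceP Np ST (ltnW tT) inz.
have xM : (slice_lo (T rho) (S rho) (tt rho) <= slice_lo (T rho) (S rho) (tt rho) + i <
   slice_lo (T rho) (S rho) (tt rho) + slice_size (N rho) (T rho) (S rho) (tt rho))%N.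
  by rewrite leq_addr ltn_add2l ltn_ord.
by split; [exact: (w1_gt0 R Np ST (ltnW tT) xM) | exact: (w2_gt0 R Np ST (ltnW tT) xM)].
Unshelve. all: by end_near. Qed.

Lemma ratio_bounded_trans z y v : ratio_bounded z y -> ratio_bounded y v -> ratio_bounded z v.
Proof.
move=> [k k0 zy] [k' k'0 yv]; exists (k' * k); first exact: mulr_gt0.
near=> rho.
have [a1 a2] : 0 < W1 rho (X rho + y) /\ 0 < W2 rho (X rho + y) by near: rho; exact: near_weights.
have [b1 b2] : 0 < W1 rho (X rho + z) /\ 0 < W2 rho (X rho + z) by near: rho; exact: near_weights.
have [c1 c2] : 0 < W1 rho (X rho + v) /\ 0 < W2 rho (X rho + v) by near: rho; exact: near_weights.
have h1 : W1 rho (X rho + y) * W2 rho (X rho + z) <= k * (W1 rho (X rho + z) * W2 rho (X rho + y)) by near: rho.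
have h2 : W1 rho (X rho + v) * W2 rho (X rho + y) <= k' * (W1 rho (X rho + y) * W2 rho (X rho + v)) by near: rho.
rewrite -(ler_pM2l (mulr_gt0 a1 a2)).
have := ler_pM (ltW (mulr_gt0 a1 b2)) (ltW (mulr_gt0 c1 a2)) h1 h2.
move: (W1 rho _) (W1 rho _) (W1 rho _) (W2 rho _) (W2 rho _) (W2 rho _) => A B C D E G.
by congr (_ <= _); ring.
Unshelve. all: by end_near. Qed.

(** The ratio for neighbours is a quotient of two coefficients of the Hahn
    operator, which both have positive limits after rescaling. *)
Lemma ratio_bounded_step z : ratio_bounded z (z + 1) /\ ratio_bounded (z + 1) z.
Proof.
have a0 := al2_gt0; have b0 := be2_gt0.
have step rho : W1 rho (X rho + (z + 1)) * W2 rho (X rho + z) *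
   (((S rho)%:R + (N rho)%:R - (X rho + z)%:~R - 1) * ((X rho + z)%:~R + 1) / rho ^+ 2) =
   W1 rho (X rho + z) * W2 rho (X rho + (z + 1)) *
   (((T rho)%:R - (tt rho)%:R - (S rho)%:R + (X rho + z)%:~R + 1) *
    ((tt rho)%:R + (N rho)%:R - (X rho + z)%:~R - 1) / rho ^+ 2).
  rewrite addrA; have := w1S R (N rho) (tt rho) (X rho + z).
  have := w2S R (N rho) (T rho) (S rho) (tt rho) (X rho + z).
  set x := X rho + z; set x' : R := x%:~R => h2 h1.
  transitivity (W1 rho (x + 1) * (x' + 1) * (W2 rho x * ((S rho)%:R + (N rho)%:R - 1 - x')) / rho ^+ 2).
    ring.
  rewrite h1 -h2; ring.
pose e1 rho : R := ((T rho)%:R - (tt rho)%:R - (S rho)%:R + (X rho + z)%:~R + 1) *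
    ((tt rho)%:R + (N rho)%:R - (X rho + z)%:~R - 1) / rho ^+ 2.
pose e3 rho : R := ((S rho)%:R + (N rho)%:R - (X rho + z)%:~R - 1) * ((X rho + z)%:~R + 1) / rho ^+ 2.
have l1 : e1 rho @[rho --> +oo] --> al2 := coef1_cvg z.
have l3 : e3 rho @[rho --> +oo] --> be2 := coef3_cvg z.
have pos1 := cvgr_gt _ l1 _ a0; have pos3 := cvgr_gt _ l3 _ b0.
have up1 : al2 < 2 * al2 by rewrite ltr_pMl// ltr1n.
have up3 : be2 < 2 * be2 by rewrite ltr_pMl// ltr1n.
have dn1 : al2 / 2 < al2 by rewrite ltr_pdivrMr// ltr_pMr// ltr1n.
have dn3 : be2 / 2 < be2 by rewrite ltr_pdivrMr// ltr_pMr// ltr1n.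
have ub1 := cvgr_lt _ l1 _ up1; have ub3 := cvgr_lt _ l3 _ up3.
have lb1 := cvgr_gt _ l1 _ dn1; have lb3 := cvgr_gt _ l3 _ dn3.
have key (p q c d u v : R) : 0 < q -> 0 < c -> 0 < d -> 0 < v ->
  p * v = q * u -> u <= 2 * c -> d / 2 <= v -> p <= 4 * c / d * q.
  move=> q0 c0 d0 v0 pq uc dv.
  have -> : p = q * u / v by rewrite -pq mulfK// gt_eqF.
  rewrite ler_pdivrMr// (_ : 4 * c / d * q * v = q * (4 * c * (v / d))); last first.
    by field; rewrite gt_eqF.
  rewrite ler_pM2l//; apply: le_trans uc _.
  rewrite (_ : 2 * c = 4 * c * (1 / 2)); last by field.
  by rewrite ler_pM2l ?mulr_gt0// ler_pdivlMr//; lra.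
split.
  exists (4 * al2 / be2); first by apply: divr_gt0 => //; exact: mulr_gt0.
  near=> rho.
  have [b1 b2] : 0 < W1 rho (X rho + z) /\ 0 < W2 rho (X rho + z) by near: rho; exact: near_weights.
  have [c1 c2] : 0 < W1 rho (X rho + (z + 1)) /\ 0 < W2 rho (X rho + (z + 1)).
    by near: rho; exact: near_weights.
  apply: (key _ _ _ _ _ _ (mulr_gt0 b1 c2) a0 b0 _ (step rho)).
  - by near: rho; exact: pos3.
  - by apply: ltW; near: rho; exact: ub1.
  - by apply: ltW; near: rho; exact: lb3.
exists (4 * be2 / al2); first by apply: divr_gt0 => //; exact: mulr_gt0.
near=> rho.
have [b1 b2] : 0 < W1 rho (X rho + z) /\ 0 < W2 rho (X rho + z) by near: rho; exact: near_weights.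
have [c1 c2] : 0 < W1 rho (X rho + (z + 1)) /\ 0 < W2 rho (X rho + (z + 1)).
  by near: rho; exact: near_weights.
have step' := esym (step rho).
rewrite [W1 rho (X rho + z) * _]mulrC [W1 rho (X rho + (z + 1)) * _]mulrC in step'.
rewrite [W1 rho (X rho + z) * _]mulrC [W1 rho (X rho + (z + 1)) * _]mulrC.
apply: (key _ _ _ _ _ _ (mulr_gt0 b2 c1) b0 a0 _ step').
- by near: rho; exact: pos1.
- by apply: ltW; near: rho; exact: ub3.
- by apply: ltW; near: rho; exact: lb1.
Unshelve. all: by end_near. Qed.

Lemma ratio_boundedP z y : ratio_bounded z y.
Proof.
have nat_ z' (n : nat) : ratio_bounded z' (z' + n%:Z) /\ ratio_bounded (z' + n%:Z) z'.
  elim: n => [|n [IH1 IH2]].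
    by rewrite addr0; split; exists 1 => //; apply: nearW => rho; rewrite mul1r.
  rewrite (_ : z' + n.+1%:Z = z' + n%:Z + 1); last by lia.
  have [s1 s2] := ratio_bounded_step (z' + n%:Z).
  by split; [exact: ratio_bounded_trans IH1 s1 | exact: ratio_bounded_trans s2 IH2].
have [zy|yz] := leP z y.
  have := nat_ z `|y - z|%N; rewrite (_ : z + `|y - z|%N = y); last by lia.
  by case.
have := nat_ y `|z - y|%N; rewrite (_ : y + `|z - y|%N = z); last by lia.
by case.
Qed.

(** The inequality of arithmetic and geometric means for the weights; the
    right-hand side is a combination of the positive diagonal terms, whose
    moments converge. *)
Lemma psi_chi_bound z y (kap : R) : (\forall rho \near +oo,
    W1 rho (X rho + y) * W2 rho (X rho + z) <= kap * (W1 rho (X rho + z) * W2 rho (X rho + y))) ->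
  \forall rho \near +oo, forall k, (k < Msz rho)%N ->
  `|psiz z rho k * chiz y rho k| <=
    2^-1 * (psiz z rho k * chiz z rho k + kap * (psiz y rho k * chiz y rho k)).
Proof.
move=> hk; near=> rho => k kM.
have [a1 a2] : 0 < W1 rho (X rho + y) /\ 0 < W2 rho (X rho + y) by near: rho; exact: near_weights.
have [b1 b2] : 0 < W1 rho (X rho + z) /\ 0 < W2 rho (X rho + z) by near: rho; exact: near_weights.
have h : W1 rho (X rho + y) * W2 rho (X rho + z) <= kap * (W1 rho (X rho + z) * W2 rho (X rho + y)) by near: rho.
have [Np ST tT] : [/\ (0 < N rho)%N, (S rho <= T rho)%N & (tt rho < T rho)%N].
  by near: rho; exact: near_params.
have n0 := dotw_hpoly_gt0 R Np ST (ltnW tT) kM.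
rewrite /psiz /chiz /psi /chi.
set hz := hpoly _ _ _ _ _ _ (X rho + z); set hy := hpoly _ _ _ _ _ _ (X rho + y).
move: (W1 rho _) (W2 rho _) (W1 rho _) (W2 rho _) (dotw _ _ _ _ _ _) a1 a2 b1 b2 n0 h => A B C D n C0 D0 A0 B0 n0 h.
rewrite !normrM (gtr0_norm B0) (gtr0_norm C0) (gtr0_norm (x := n^-1)) ?invr_gt0//.
rewrite -subr_ge0.
have sq (u : R) : u * u = `|u| * `|u| by rewrite -normrM ger0_norm// -expr2 sqr_ge0.
have -> : 2^-1 * (B * hz * (A * hz / n) + kap * (D * hy * (C * hy / n))) - B * `|hz| * (C * `|hy| / n) =
    (B / A * (A * `|hz| - C * `|hy|) ^+ 2 + (kap * (A * D) - C * B) * (C / A) * `|hy| ^+ 2) / (2 * n).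
  transitivity (2^-1 * (B * A * (hz * hz) / n + kap * (D * C * (hy * hy) / n)) - B * `|hz| * (C * `|hy| / n)).
    ring.
  by rewrite (sq hz) (sq hy); field; rewrite !gt_eqF.
apply: divr_ge0; last by rewrite mulr_ge0// ltW.
have h' : 0 <= kap * (A * D) - C * B by rewrite subr_ge0.
have ba := ltW (divr_gt0 B0 A0); have ca := ltW (divr_gt0 C0 A0).
by apply: addr_ge0; apply: mulr_ge0; rewrite ?sqr_ge0//; exact: mulr_ge0.
Unshelve. all: by end_near. Qed.

(** A lower bound for the rescaled factors of iter_forw_back, half of the
    limit of the bound in hlam_hconst. *)
Definition mgap : R := t0 * (T0 - t0) / 2.

Lemma mgap_gt0 : 0 < mgap.
Proof.
have p : 0 < T0 - t0 by rewrite subr_gt0.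
by apply: divr_gt0 => //; exact: mulr_gt0.
Qed.

Lemma threshold_cst0 : threshold + cst0 = 2 * mgap.
Proof. by rewrite /threshold /cst0 /mgap; field. Qed.

(** The inverse of x + cst0, cut off below mgap so as to be Lipschitz on the
    whole line; the cut-off does not act on the part of the spectrum with k <
    N. *)
Definition resolvent (x : R) : R := (Num.max (x + cst0) mgap)^-1.

Lemma resolvent_bound x : 0 <= resolvent x <= mgap^-1.
Proof.
have m0 := mgap_gt0; have v0 : 0 < Num.max (x + cst0) mgap by rewrite lt_max m0 orbT.
by rewrite invr_ge0 (ltW v0) lef_pV2 ?posrE// le_max lexx orbT.
Qed.

Lemma inv_diff_le (u v w : R) : 0 < w -> w <= u -> w <= v -> `|u^-1 - v^-1| <= `|u - v| / w ^+ 2.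
Proof.
move=> w0 wu wv; have u0 := lt_le_trans w0 wu; have v0 := lt_le_trans w0 wv.
rewrite (_ : u^-1 - v^-1 = (v - u) / (u * v)); last by field; rewrite !gt_eqF.
rewrite normrM distrC ler_wpM2l// normfV gtr0_norm ?mulr_gt0//.
by rewrite lef_pV2 ?posrE ?mulr_gt0 ?exprn_gt0// expr2 ler_pM// ltW.
Qed.

Lemma max_lip (x y w : R) : `|Num.max x w - Num.max y w| <= `|x - y|.
Proof.
wlog xy : x y / y <= x => [H|].
  by have [/H//|/ltW/H] := leP y x; rewrite distrC (distrC x).
rewrite [X in _ <= X]ger0_norm ?subr_ge0//.
by have [h1|h1] := lerP x w; have [h2|h2] := lerP y w; rewrite ler_norml; lra.
Qed.

Lemma bounded_lipschitz_resolvent m : bounded_lipschitz (fun x => resolvent x ^+ m).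
Proof.
apply: bounded_lipschitzX; have m0 := mgap_gt0.
have i1 : 0 <= mgap^-1 by rewrite invr_ge0 ltW.
have i2 : 0 <= (mgap ^+ 2)^-1 by rewrite invr_ge0 exprn_ge0// ltW.
exists mgap^-1, (mgap ^+ 2)^-1; split; [exact: i1|exact: i2|move=> x|move=> x y].
  by have /andP[r0 r1] := resolvent_bound x; rewrite ger0_norm.
rewrite /resolvent.
apply: le_trans (inv_diff_le m0 _ _) _; rewrite ?le_max ?lexx ?orbT//.
rewrite mulrC ler_wpM2l//.
apply: le_trans (max_lip _ _ _) _.
by rewrite (_ : x + cst0 - (y + cst0) = x - y)//; ring.
Qed.

Definition shiftc (rho : R) (r : nat) (k : nat) : R :=
  (hlam R (N rho) (T rho) k + hconst R (N rho) (T rho) (tt rho + r)) / rho ^+ 2.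

Lemma shiftc_ge r : \forall rho \near +oo, forall k, (k < N rho)%N ->
  mgap <= shiftc rho r k.
Proof.
have h : ((tt rho)%:R + r.+1%:R) * ((T rho)%:R - (tt rho)%:R - r%:R) / rho ^+ 2 @[rho --> +oo] --> 2 * mgap.
  rewrite (_ : 2 * mgap = (t0 + 0) * (T0 - t0 - 0)); last by rewrite /mgap; field.
  exact: scaled_mul (scaledD st (@scaled_cst R _)) (scaledB (scaledB sT st) (@scaled_cst R _)).
have hg : mgap < 2 * mgap by rewrite ltr_pMl ?mgap_gt0// ltr1n.
have h1 := cvgr_gt _ h _ hg.
have Tt : \forall rho \near +oo, 0 < ((T rho)%:R - (tt rho)%:R - r%:R : R).
  have p : 0 < T0 - t0 - 0 by rewrite subr0 subr_gt0.
  exact: scaled_pos (scaledB (scaledB sT st) (@scaled_cst R _)) p.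
near=> rho => k kN.
have rho0 : 0 < rho by near: rho; exact: near_gt.
have p : 0 < ((T rho)%:R - (tt rho)%:R - r%:R : R) by near: rho.
have trT : (tt rho + r < T rho)%N by rewrite -(ltr_nat R) natrD -subr_gt0 opprD addrA.
apply: le_trans (_ : ((tt rho)%:R + r.+1%:R) * ((T rho)%:R - (tt rho)%:R - r%:R) / rho ^+ 2 <= _).
  by apply: ltW; near: rho; exact: h1.
rewrite /shiftc ler_pM2r ?invr_gt0 ?exprn_gt0//.
have [Np ST tT] : [/\ (0 < N rho)%N, (S rho <= T rho)%N & (tt rho < T rho)%N].
  by near: rho; exact: near_params.
apply: le_trans _ (hlam_hconst R Np ST kN trT).
by rewrite -addnS !natrD opprD addrA.
Unshelve. all: by end_near. Qed.

Lemma shiftc_resolvent r (e : R) : 0 < e -> \forall rho \near +oo, forall k, (k < N rho)%N ->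
  `|(shiftc rho r k)^-1 - resolvent (lamr rho k)| <= e.
Proof.
move=> e0; have m0 := mgap_gt0.
have hc : hconst R (N rho) (T rho) (tt rho + r) / rho ^+ 2 @[rho --> +oo] --> cst0.
  rewrite (_ : cst0 = (t0 + 0 + N0) * (T0 - (t0 + 0) + N0 - 0)); last by rewrite !addr0 subr0.
  have s := scaled_mul (scaledD (scaledD st (@scaled_cst R r%:R)) sN)
    (scaledB (scaledD (scaledB sT (scaledD st (@scaled_cst R r%:R))) sN) (@scaled_cst R 1)).
  apply: near_eq_cvg_to s; apply: nearW => rho; by rewrite /hconst natrD.
have e1 : 0 < e * mgap ^+ 2 by rewrite mulr_gt0 ?exprn_gt0.
have /cvgrPdistC_le/(_ _ e1) h1 := hc.
near=> rho => k kN.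
have hm : mgap <= shiftc rho r k by move: k kN; near: rho; exact: shiftc_ge.
rewrite /resolvent; apply: le_trans (inv_diff_le m0 hm _) _; first by rewrite le_max lexx orbT.
have e3 : Num.max (shiftc rho r k) mgap = shiftc rho r k := max_idPl hm.
rewrite ler_pdivrMr ?exprn_gt0// -{1}e3.
apply: le_trans (max_lip _ _ _) _.
rewrite /shiftc /lamr mulrDl opprD addrACA subrr add0r.
by near: rho; exact: h1.
Unshelve. all: by end_near. Qed.

Lemma prod_shiftc m (e : R) : 0 < e -> \forall rho \near +oo, forall k, (k < N rho)%N ->
  `|(\prod_(r < m) shiftc rho r k)^-1 - resolvent (lamr rho k) ^+ m| <= e /\
  0 <= (\prod_(r < m) shiftc rho r k)^-1 <= mgap^-1 ^+ m.
Proof.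
have m0 := mgap_gt0.
elim: m e => [|m IH] e e0.
  by apply: nearW => rho k _; rewrite big_ord0 invr1 expr0 subrr normr0 ler01 lexx ltW.
have i0 : 0 < mgap^-1 by rewrite invr_gt0.
pose e1 : R := e / 2 * mgap; have e10 : 0 < e1 by rewrite mulr_gt0// divr_gt0.
pose e2 : R := e / 2 * mgap ^+ m; have e20 : 0 < e2 by rewrite mulr_gt0 ?divr_gt0// exprn_gt0.
have H1 := IH _ e10; have H2 := shiftc_resolvent m e20; have H3 := shiftc_ge m.
near=> rho.
have g1 : forall k, (k < N rho)%N ->
  `|(\prod_(r < m) shiftc rho r k)^-1 - resolvent (lamr rho k) ^+ m| <= e1 /\
  0 <= (\prod_(r < m) shiftc rho r k)^-1 <= mgap^-1 ^+ m by near: rho.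
have g2 : forall k, (k < N rho)%N -> `|(shiftc rho m k)^-1 - resolvent (lamr rho k)| <= e2 by near: rho.
have g3 : forall k, (k < N rho)%N -> mgap <= shiftc rho m k by near: rho.
move=> k kN; have [h1 /andP[h2 h3]] := g1 k kN; have h4 := g2 k kN; have h5 := g3 k kN.
have s0 := lt_le_trans m0 h5.
have h6 : 0 <= (shiftc rho m k)^-1 by rewrite invr_ge0 ltW.
have h7 : (shiftc rho m k)^-1 <= mgap^-1 by rewrite lef_pV2 ?posrE.
rewrite big_ord_recr /= invfM exprSr [mgap^-1 ^+ m.+1]exprSr; split; last first.
  by rewrite mulr_ge0//= ler_pM.
set P := (\prod_(r < m) _)^-1 in h1 h2 h3 *; set Q := resolvent _ in h1 h4 *.
have /andP[q0 q1] := resolvent_bound (lamr rho k); rewrite -/Q in q0 q1.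
rewrite (_ : P * _ - _ = (P - Q ^+ m) * (shiftc rho m k)^-1 + Q ^+ m * ((shiftc rho m k)^-1 - Q)); last by ring.
apply: le_trans (ler_normD _ _) _; rewrite !normrM.
have b1 : `|P - Q ^+ m| * `|(shiftc rho m k)^-1| <= e / 2.
  rewrite (_ : e / 2 = e1 * mgap^-1); last by rewrite /e1 mulfK// gt_eqF.
  by apply: ler_pM => //; rewrite ger0_norm.
have b2 : `|Q ^+ m| * `|(shiftc rho m k)^-1 - Q| <= e / 2.
  rewrite (_ : e / 2 = mgap^-1 ^+ m * e2); last first.
    by rewrite /e2 mulrCA exprVn mulVf ?mulr1// gt_eqF// exprn_gt0.
  apply: ler_pM => //; rewrite ger0_norm ?exprn_ge0//.
  by rewrite lerXn2r ?nnegrE// ltW.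
by move: b1 b2; lra.
Unshelve. all: by end_near. Qed.

Definition lam_max : R := (T0 + N0 + N0 + 1) ^+ 2 + `|al2 + be2 - cst0| + 2 * (al2 * cratio).

Lemma lam_max_gt0 : 0 < lam_max.
Proof.
have p : 0 < T0 + N0 + N0 + 1 by move: hN0 ht0 htT0; lra.
have c0 := cratio_gt0; have a0 := al2_gt0.
have a1 : 0 <= 2 * (al2 * cratio) by apply: mulr_ge0 => //; apply/ltW/mulr_gt0.
by apply: ltr_wpDr => //; apply: ltr_wpDr => //; exact: exprn_gt0.
Qed.

Lemma symb_le th : `|symb th| <= lam_max.
Proof.
have c0 := cratio_gt0; have a0 := al2_gt0.
have a1 : 0 <= 2 * (al2 * cratio) by apply: mulr_ge0 => //; apply/ltW/mulr_gt0.
apply: le_trans (ler_normD _ _) _; rewrite /lam_max -[leRHS]addrA; apply: ler_wpDl (sqr_ge0 _) _.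
rewrite lerD2l normrM (ger0_norm a1) ler_piMr//.
by rewrite ler_norml cos_geN1 cos_le1.
Qed.

Lemma double_index_le (k m t n : nat) : (k < m)%N -> (m.*2 <= t + n.*2)%N ->
  (k.+1 + k.+1 <= t + n + n)%N.
Proof. lia. Qed.

Lemma lamr_le : \forall rho \near +oo, forall k, (k < Msz rho)%N -> `|lamr rho k| <= lam_max.
Proof.
have s := scaledD (scaledD sT sN) sN.
have up : T0 + N0 + N0 < T0 + N0 + N0 + 1 by rewrite ltrDl.
have h := cvgr_lt _ s _ up.
have aux (q v n B : R) : 0 <= q -> q + 1 <= v + n + n -> v + n + n < B ->
    `|q * (v + 2 * n - 1 - q)| <= B ^+ 2.
  move=> q0 q1 B1; rewrite ger0_norm; last by apply: mulr_ge0 => //; lra.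
  by rewrite expr2; apply: ler_pM => //; lra.
near=> rho => k kM.
have rho0 : 0 < rho by near: rho; exact: near_gt.
have [Np ST tT] : [/\ (0 < N rho)%N, (S rho <= T rho)%N & (tt rho < T rho)%N].
  by near: rho; exact: near_params.
have fr : ((T rho)%:R + (N rho)%:R + (N rho)%:R) / rho < T0 + N0 + N0 + 1 by near: rho; exact: h.
have Mle := slice_size_le Np ST (ltnW tT).
have kle : k.+1%:R <= (T rho)%:R + (N rho)%:R + (N rho)%:R :> R.
  by rewrite -!natrD ler_nat (leq_trans (leq_addr _ _) (double_index_le kM Mle)).
rewrite -natr1 in kle; have k0 : 0 <= k%:R :> R by [].
apply: le_trans (_ : (T0 + N0 + N0 + 1) ^+ 2 <= _); last first.
  have c0 := cratio_gt0; have a0 := al2_gt0.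
  have a1 : 0 <= 2 * (al2 * cratio) by apply: mulr_ge0 => //; apply/ltW/mulr_gt0.
  by rewrite /lam_max -[leRHS]addrA lerDl addr_ge0.
rewrite /lamr /hlam normrM normrN normfV (gtr0_norm (x := rho ^+ 2)) ?exprn_gt0//.
rewrite ltr_pdivrMr// in fr; rewrite ler_pdivrMr ?exprn_gt0// -exprMn.
exact: aux k0 kle fr.
Unshelve. all: by end_near. Qed.

(** The eigenvalues decrease with k < Msz rho, so that asymptotically the indices k < N
    are those of the eigenvalues above the threshold; lamr_outside is the
    other half. *)
Lemma lamr_inside (e : R) : 0 < e -> \forall rho \near +oo, forall k, (k < N rho)%N ->
  threshold - e < lamr rho k.
Proof.
move=> e0; have lim : - ((N rho)%:R * ((T rho)%:R + (N rho)%:R) / rho ^+ 2) @[rho --> +oo] --> threshold.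
  by apply: cvgN; exact: scaled_mul sN (scaledD sT sN).
have dn : threshold - e < threshold by rewrite ltrBlDr ltrDl.
have aux (q s n : R) : 0 <= q -> q + 1 <= n -> 0 <= s ->
    q * (s + 2 * n - 1 - q) <= n * (s + n).
  move=> q0 q1 s0; rewrite -subr_ge0.
  rewrite (_ : _ - _ = (n - 1 - q) * (s + n - q) + (s + n)); last by ring.
  by apply: addr_ge0; [apply: mulr_ge0; lra | lra].
have h := cvgr_gt _ lim _ dn.
near=> rho => k kN.
have rho0 : 0 < rho by near: rho; exact: near_gt.
apply: lt_le_trans (_ : - ((N rho)%:R * ((T rho)%:R + (N rho)%:R) / rho ^+ 2) <= _).
  by near: rho; exact: h.
rewrite /lamr -mulNr ler_pM2r ?invr_gt0 ?exprn_gt0// /hlam lerN2.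
have kle : k.+1%:R <= (N rho)%:R :> R by rewrite ler_nat.
rewrite -natr1 in kle; have k0 : 0 <= k%:R :> R by [].
have n0 : 0 <= (N rho)%:R :> R by []; have T0' : 0 <= (T rho)%:R :> R by [].
exact: aux.
Unshelve. all: by end_near. Qed.

Lemma lamr_outside (e : R) : 0 < e -> \forall rho \near +oo, forall k,
  (N rho <= k)%N -> (k < Msz rho)%N -> lamr rho k < threshold + e.
Proof.
move=> e0; have lim : - ((N rho)%:R * ((T rho)%:R + (N rho)%:R - 1) / rho ^+ 2) @[rho --> +oo] --> threshold.
  rewrite (_ : threshold = - (N0 * (T0 + N0 - 0))); last by rewrite subr0.
  by apply: cvgN; exact: scaled_mul sN (scaledB (scaledD sT sN) (@scaled_cst R 1)).
have up : threshold < threshold + e by rewrite ltrDl.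
have aux (q s n : R) : n <= q -> q + 1 + (q + 1) <= s + n + n -> 0 <= s ->
    n * (s + n - 1) <= q * (s + 2 * n - 1 - q).
  move=> q0 q1 s0; rewrite -subr_ge0.
  rewrite (_ : _ - _ = (q - n) * (s + n - 1 - q)); last by ring.
  by apply: mulr_ge0; lra.
have h := cvgr_lt _ lim _ up.
near=> rho => k Nk kM.
have rho0 : 0 < rho by near: rho; exact: near_gt.
have [Np ST tT] : [/\ (0 < N rho)%N, (S rho <= T rho)%N & (tt rho < T rho)%N].
  by near: rho; exact: near_params.
have Mle := slice_size_le Np ST (ltnW tT).
apply: le_lt_trans (_ : _ <= - ((N rho)%:R * ((T rho)%:R + (N rho)%:R - 1) / rho ^+ 2)) _; last first.
  by near: rho; exact: h.
rewrite /lamr -[leRHS]mulNr ler_pM2r ?invr_gt0 ?exprn_gt0// /hlam lerN2.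
have kle : k.+1%:R + k.+1%:R <= (T rho)%:R + (N rho)%:R + (N rho)%:R :> R.
  by rewrite -!natrD ler_nat (double_index_le kM Mle).
have Nk' : (N rho)%:R <= k%:R :> R by rewrite ler_nat.
rewrite -natr1 in kle; have T0' : 0 <= (T rho)%:R :> R by [].
exact: aux.
Unshelve. all: by end_near. Qed.

(** The symbol crosses the threshold where the cosine takes this value. *)
Definition cphi : R := (threshold - (al2 + be2 - cst0)) / (2 * (al2 * cratio)).

Lemma symb_threshold th : symb th - threshold = 2 * (al2 * cratio) * (cos th - cphi).
Proof.
have c0 := cratio_gt0; have a0 := al2_gt0; rewrite /symb /cphi.
by field; rewrite !gt_eqF.
Qed.

Variable phi : R.
Hypotheses (phi_itv : 0 <= phi <= pi) (phi_lt : phi < pi -> cos phi <= cphi)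
  (phi_gt : 0 < phi -> cphi <= cos phi).

Lemma threshold_sep (eta : R) : 0 < eta -> exists2 d : R, 0 < d & forall th : R, 0 <= th <= pi ->
  (th <= phi - eta -> threshold + d <= symb th) /\ (phi + eta <= th -> symb th <= threshold - d).
Proof.
move=> eta0; have /andP[p0 p1] := phi_itv.
have c0 := cratio_gt0; have a0 := al2_gt0.
pose A : R := 2 * (al2 * cratio); have A0 : 0 < A by apply: mulr_gt0 => //; exact: mulr_gt0.
have cosl (u v : R) : 0 <= u -> u < v -> v <= pi -> cos v < cos u.
  by move=> u0 uv vp; rewrite ltr_cos ?in_itv /= ?u0 ?vp ?(le_trans u0 (ltW uv)) ?(le_trans (ltW uv) vp).
have cosle (u v : R) : 0 <= u -> u <= v -> v <= pi -> cos v <= cos u.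
  move=> u0; rewrite le_eqVlt => /orP[/eqP ->//|uv vp]; exact/ltW/cosl.
(* If the angle phi - eta or phi + eta is outside the range, there is nothing
   to separate on that side and any positive number will do. *)
pose d1 : R := if 0 <= phi - eta then A * (cos (phi - eta) - cos phi) else 1.
pose d2 : R := if phi + eta <= pi then A * (cos phi - cos (phi + eta)) else 1.
have d10 : 0 < d1.
  rewrite /d1; case: ifP => // h; apply: mulr_gt0 => //; rewrite subr_gt0; apply: cosl => //.
  by rewrite ltrBlDr ltrDl.
have d20 : 0 < d2.
  rewrite /d2; case: ifP => // h; apply: mulr_gt0 => //; rewrite subr_gt0; apply: cosl => //.
  by rewrite ltrDl.
exists (Num.min d1 d2); first by rewrite lt_min d10.
move=> th /andP[th0 thp]; split => h.
  have h1 : 0 <= phi - eta by apply: le_trans h.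
  have phi0 : 0 < phi by apply: lt_le_trans eta0 _; rewrite -subr_ge0.
  apply: le_trans (_ : threshold + d1 <= _); first by rewrite lerD2l ge_min lexx.
  rewrite -lerBrDl symb_threshold /d1 h1 -/A ler_pM2l//; apply: lerB; last exact: phi_gt.
  by apply: cosle => //; rewrite (le_trans _ p1)// lerBlDr lerDl ltW.
have h1 : phi + eta <= pi by apply: le_trans h thp.
have phi1 : phi < pi by apply: lt_le_trans h1; rewrite ltrDl.
apply: le_trans (_ : threshold - d2 <= _); last by rewrite lerD2l lerN2 ge_min lexx orbT.
rewrite -lerBlDl symb_threshold /d2 h1 -/A lerNr -mulrN opprB ler_pM2l//; apply: lerB; first exact: phi_lt.
by apply: cosle => //; rewrite addr_ge0// ltW.
Qed.

(** The diagonal terms for z and y, with kap as the ratio of the weights, are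
    the dominating masses of projection_cvg; kap is also taken large enough
    for kc to bound cosn. *)
Lemma projection_limit m z y :
  \sum_(k < N rho) (\prod_(r < m) shiftc rho r k)^-1 * (psiz z rho k * chiz y rho k)
  @[rho --> +oo] --> integ 0 phi (fun th => resolvent (symb th) ^+ m * cosn cratio (z - y) th).
Proof.
have m0 := mgap_gt0; have c0 := cratio_gt0; have pi0 := pi_gt0 R.
pose F rho k : R := if (k < N rho)%N then (\prod_(r < m) shiftc rho r k)^-1 else 0.
pose a rho k : R := psiz z rho k * chiz y rho k.
apply: (near_eq_cvg_to (g := wsum (fun rho => Msz rho) F a)).
  near=> rho.
  have [Np ST tT] : [/\ (0 < N rho)%N, (S rho <= T rho)%N & (tt rho < T rho)%N].
    by near: rho; exact: near_params.
  have NM := slice_size_ge Np ST (ltnW tT).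
  rewrite (big_ord_widen (Msz rho) (fun k => (\prod_(r < m) shiftc rho r k)^-1 * a rho k) NM).
  rewrite big_mkcond /wsum; apply: eq_bigr => k _; rewrite /F.
  by case: ifP => //; rewrite mul0r.
have [k0 k00 kb] := ratio_boundedP z y.
pose kap : R := k0 + 2 * cratio ^ (z - y).
have cz : 0 < cratio ^ (z - y) by rewrite exprz_gt0.
have kapk : k0 <= kap by rewrite lerDl mulr_ge0// ltW.
have kap0 : 0 < kap by apply: lt_le_trans k00 kapk.
pose b rho k : R := 2^-1 * (psiz z rho k * chiz z rho k + kap * (psiz y rho k * chiz y rho k)).
pose kc : R := (1 + kap) / (2 * pi).
have cosn0 (n : int) th : n = 0 -> cosn cratio n th = pi^-1.
  by move=> ->; rewrite /cosn expr0z mul0r cos0 !mul1r.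
apply: (@projection_cvg R R _ _ _ _ _ lam_max lam_max_gt0 lamr_le symb_le symb_meas a b
  (cosn cratio (z - y)) kc phi threshold (mgap^-1 ^+ m) (fun x => resolvent x ^+ m) F).
- exact: bmeas_cosn.
- move=> th; apply: le_trans (cosn_le _ _ c0) _.
  rewrite /kc invfM mulrA ler_pM2r ?invr_gt0// ler_pdivlMr//.
  by rewrite /kap; move: (cratio ^ (z - y)) cz k00 => q cz k00; lra.
- exact: moments.
- move=> l; apply: (near_eq_cvg_to (g := fun rho =>
    2^-1 * (wsum (fun rho => Msz rho) (fun u k => lamr u k ^+ l) (fun rho k => psiz z rho k * chiz z rho k) rho +
     kap * wsum (fun rho => Msz rho) (fun u k => lamr u k ^+ l) (fun rho k => psiz y rho k * chiz y rho k) rho))).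
    apply: nearW => rho; rewrite /wsum !mulr_sumr -big_split /= mulr_sumr.
    by apply: eq_bigr => k _; rewrite /b; ring.
  have -> : integ 0 pi (fun th => symb th ^+ l * kc) =
      2^-1 * (integ 0 pi (fun th => symb th ^+ l * cosn cratio (z - z) th) +
        kap * integ 0 pi (fun th => symb th ^+ l * cosn cratio (y - y) th)).
    have bs n : bmeas (fun th => symb th ^+ l * cosn cratio n th).
      by apply: bmeasM; [apply: bmeasX; exact: symb_meas | exact: bmeas_cosn].
    rewrite -integZ// -integD//; last by apply: bmeasM => //; exact: bmeas_cst.
    rewrite -integZ; last by apply: bmeasD => //; apply: bmeasM => //; exact: bmeas_cst.
    apply: eq_integ => th _; rewrite !cosn0 ?subrr// /kc invfM; ring.
  by apply: cvgMl_tmp; apply: cvgD; [|apply: cvgMl_tmp]; exact: moments.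
- apply: psi_chi_bound; near=> rho.
  have [q1 q2] : 0 < W1 rho (X rho + y) /\ 0 < W2 rho (X rho + y) by near: rho; exact: near_weights.
  have [r1 r2] : 0 < W1 rho (X rho + z) /\ 0 < W2 rho (X rho + z) by near: rho; exact: near_weights.
  have kb' : W1 rho (X rho + y) * W2 rho (X rho + z) <= k0 * (W1 rho (X rho + z) * W2 rho (X rho + y)) by near: rho.
  by apply: le_trans kb' _; rewrite ler_pM2r// mulr_gt0.
- exact: bounded_lipschitz_resolvent.
- by rewrite exprn_gt0// invr_gt0.
- move=> x; have /andP[r0 r1] := resolvent_bound x.
  by rewrite ger0_norm ?exprn_ge0// lerXn2r ?nnegrE// (le_trans r0).
- exact: phi_itv.
- exact: threshold_sep.
- move=> e e0.
  have H1 := prod_shiftc m e0; have H2 := lamr_inside e0; have H3 := lamr_outside e0.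
  near=> rho.
  have g1 : forall k, (k < N rho)%N ->
    `|(\prod_(r < m) shiftc rho r k)^-1 - resolvent (lamr rho k) ^+ m| <= e /\
    0 <= (\prod_(r < m) shiftc rho r k)^-1 <= mgap^-1 ^+ m by near: rho.
  have g2 : forall k, (k < N rho)%N -> threshold - e < lamr rho k by near: rho.
  have g3 : forall k, (N rho <= k)%N -> (k < Msz rho)%N -> lamr rho k < threshold + e by near: rho.
  move=> k kM; rewrite /F; case: ltnP => [kN|Nk].
    have [h1 /andP[h2 h3]] := g1 k kN; split => //; last by rewrite ger0_norm.
    by move=> h; have := g2 k kN; rewrite ltNge h.
  split => // [h|]; first by have := g3 k Nk kM; rewrite ltNge h.
  by rewrite normr0 exprn_ge0// invr_ge0 ltW.
Unshelve. all: by end_near. Qed.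

(** Each transition multiplies by the limits al2 and be2 of the coefficients
    of back divided by the square of the scale. *)
Fixpoint back_symbol (j : nat) (n : int) (th : R) : R :=
  if j is j'.+1 then al2 * back_symbol j' n th + be2 * back_symbol j' (n - 1) th
  else cosn cratio n th.

Lemma bmeas_back_symbol j n : bmeas (back_symbol j n).
Proof.
elim: j n => [|j IH] n /=; first exact: bmeas_cosn cratio_gt0.
by apply: bmeasD; apply: bmeasM => //; exact: bmeas_cst.
Qed.

Definition back_sum m j z y rho : R := \sum_(k < N rho) (\prod_(r < m) shiftc rho r k)^-1 *
  (iter_back (N rho) (T rho) (S rho) (tt rho) j (psi R (N rho) (T rho) (S rho) (tt rho) k) (X rho + z) /
    (rho ^+ 2) ^+ j * chiz y rho k).

Lemma back_sum_cvg m j z y : back_sum m j z y @ +oo -->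
  integ 0 phi (fun th => resolvent (symb th) ^+ m * back_symbol j (z - y) th).
Proof.
elim: j z => [|j IH] z.
  apply: (near_eq_cvg_to _ (@projection_limit m z y)); apply: nearW => rho.
  by apply: eq_bigr => k _; rewrite expr0 divr1.
have cst := @bmeas_cst R.
have br : bmeas (fun th => resolvent (symb th) ^+ m).
  exact: (bmeas_bounded_lipschitz symb_meas (bounded_lipschitz_resolvent m)).
have bb n e : bmeas (fun th => e * (resolvent (symb th) ^+ m * back_symbol j n th)).
  by apply: bmeasM => //; apply: bmeasM => //; exact: bmeas_back_symbol.
have b1 n : bmeas (fun th => resolvent (symb th) ^+ m * back_symbol j n th).
  by apply: bmeasM => //; exact: bmeas_back_symbol.
have -> : integ 0 phi (fun th => resolvent (symb th) ^+ m * back_symbol j.+1 (z - y) th) =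
   al2 * integ 0 phi (fun th => resolvent (symb th) ^+ m * back_symbol j (z - y) th) +
   be2 * integ 0 phi (fun th => resolvent (symb th) ^+ m * back_symbol j (z - 1 - y) th).
  rewrite -!integZ// -integD//; apply: eq_integ => th _ /=.
  by rewrite [z - 1 - y]addrAC; ring.
have stj := scaledD st (@scaled_cst R j%:R).
have l1 : ((T rho)%:R - (tt rho + j)%N%:R - (S rho)%:R + (X rho + z)%:~R) *
     ((tt rho + j)%N%:R + (N rho)%:R - (X rho + z)%:~R) / rho ^+ 2 @[rho --> +oo] --> al2.
  rewrite (_ : al2 = (T0 - (t0 + 0) - S0 + x0) * (t0 + 0 + N0 - x0)); last by rewrite addr0.
  have s := scaled_mul (scaledD (scaledB (scaledB sT stj) sS) (sX z)) (scaledB (scaledD stj sN) (sX z)).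
  by apply: near_eq_cvg_to s; apply: nearW => rho; rewrite natrD.
have l5 := coef5_cvg z.
apply: (near_eq_cvg_to _ (cvgD (cvgM l1 (IH z)) (cvgM l5 (IH (z - 1))))).
apply: nearW => rho; rewrite /back_sum /= !mulr_sumr -big_split /=; apply: eq_bigr => k _.
rewrite /back exprS invfM !addrA; ring.
Qed.

(** The m transitions and the m denominators are rescaled by the same power of
    the scale. *)
Lemma kernel_ge_cvg m z y :
  \sum_(k < N rho) (\prod_(r < m) (hlam R (N rho) (T rho) k + hconst R (N rho) (T rho) (tt rho + r)))^-1 *
    iter_back (N rho) (T rho) (S rho) (tt rho) m (psi R (N rho) (T rho) (S rho) (tt rho) k) (X rho + z) *
    chi R (N rho) (T rho) (S rho) (tt rho) k (X rho + y) @[rho --> +oo] -->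
  integ 0 phi (fun th => resolvent (symb th) ^+ m * back_symbol m (z - y) th).
Proof.
apply: (near_eq_cvg_to _ (@back_sum_cvg m m z y)); near=> rho.
have rho0 : 0 < rho by near: rho; exact: near_gt.
apply: eq_bigr => k _; set P := \prod_(r < m) (_ + _).
have -> : \prod_(r < m) shiftc rho r k = P / (rho ^+ 2) ^+ m.
  by rewrite /shiftc big_split /= prodr_const card_ord exprVn.
have q0 : (rho ^+ 2) ^+ m != 0 by rewrite !expf_neq0// gt_eqF.
rewrite invf_div; move: (P^-1) ((rho ^+ 2) ^+ m) q0 => P' q q0.
by rewrite /chiz; field.
Unshelve. all: by end_near. Qed.

Fixpoint forw_limit (j : nat) (n : int) : R :=
  if j is j'.+1 then forw_limit j' n + forw_limit j' (n + 1)
  else integ 0 phi (cosn cratio n) - (n == 0)%:R.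

Lemma kernel_lt_cvg j z y :
  iter j (@forw R) (fun w =>
    \sum_(k < N rho) psi R (N rho) (T rho) (S rho) (tt rho) k w *
       chi R (N rho) (T rho) (S rho) (tt rho) k (X rho + y) -
    (w == X rho + y)%:R) (X rho + z) @[rho --> +oo] --> forw_limit j (z - y).
Proof.
elim: j z => [|j IH] z /=.
  have h := @projection_limit 0 z y.
  have -> : integ 0 phi (cosn cratio (z - y)) - (z - y == 0)%:R =
     integ 0 phi (fun th => resolvent (symb th) ^+ 0 * cosn cratio (z - y) th) - (z - y == 0)%:R.
    by congr (_ - _); apply: eq_integ => th _; rewrite expr0 mul1r.
  apply: (near_eq_cvg_to _ (cvgB h (cvg_cst ((z - y == 0)%:R : R)))); apply: nearW => rho.
  congr (_ - _%:R); last by rewrite (inj_eq (addrI _)) subr_eq0.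
  by apply: eq_bigr => k _; rewrite big_ord0 invr1 mul1r.
rewrite (_ : z - y + 1 = z + 1 - y); last by rewrite addrAC.
apply: (near_eq_cvg_to _ (cvgD (IH z) (IH (z + 1)))); apply: nearW => rho.
by rewrite /forw addrA.
Qed.

End LocalLimit.

(** * The integrals over arcs *)

Section Expi.
Variable R : realType.
Implicit Types (u v : R) (n : int).

Lemma expiD u v : expi (u + v) = expi u * expi v.
Proof.
apply/eqP; rewrite eq_complex /= cosD sinD; apply/andP; split; apply/eqP; ring.
Qed.

Lemma expi0 : expi (0 : R) = 1.
Proof. by rewrite /expi cos0 sin0. Qed.

Lemma expi_neq0 u : expi u != 0.
Proof.
apply/eqP => e0; have := expi0; rewrite -(subrr u) expiD e0 mul0r => /eqP.
by rewrite eq_sym oner_eq0.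
Qed.

Lemma expi_exp u n : expi u ^ n = expi (n%:~R * u).
Proof.
have nat_ (k : nat) : expi u ^+ k = expi (k%:R * u).
  elim: k => [|k IH]; first by rewrite mul0r expi0.
  by rewrite exprS IH -expiD -natr1; congr expi; ring.
case: n => k; first exact: nat_.
rewrite -[LHS]/((expi u ^+ k.+1)^-1); apply: (mulIf (expi_neq0 (k.+1%:R * u))).
rewrite -expiD [in RHS](_ : _ + _ = 0); last by rewrite NegzE mulrNz; ring.
by rewrite expi0 nat_ mulVf// expi_neq0.
Qed.

Lemma expi_conj u : (expi u)^* = expi (- u).
Proof. by rewrite /expi cosN sinN. Qed.

Lemma expi2piB u : expi (2 * pi - u) = expi (- u).
Proof.
rewrite expiD (_ : expi (2 * pi) = 1) ?mul1r//.
by rewrite /expi mulr_natl cos2pi sin2pi.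
Qed.

Definition cbounded (g : R -> R[i]) := exists B : R,
  [/\ continuous (fun u => complex.Re (g u)), continuous (fun u => complex.Im (g u)),
    forall u, `|complex.Re (g u)| <= B & forall u, `|complex.Im (g u)| <= B].

Lemma cbounded_mul g h : cbounded g -> cbounded h -> cbounded (fun u => g u * h u).
Proof.
move=> [B [g1 g2 gB1 gB2]] [C [h1 h2 hC1 hC2]]; exists (B * C + B * C); split.
- rewrite (_ : (fun u => _) = (fun u => complex.Re (g u) * complex.Re (h u) - complex.Im (g u) * complex.Im (h u))).
    by move=> u; apply: cvgB; apply: cvgM; [exact: g1|exact: h1|exact: g2|exact: h2].
  by apply/funext => u; case: (g u) (h u) => [? ?] [? ?].
- rewrite (_ : (fun u => _) = (fun u => complex.Re (g u) * complex.Im (h u) + complex.Im (g u) * complex.Re (h u))).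
    by move=> u; apply: cvgD; apply: cvgM; [exact: g1|exact: h2|exact: g2|exact: h1].
  by apply/funext => u; case: (g u) (h u) => [? ?] [? ?] /=; ring.
- move=> u; rewrite (_ : complex.Re _ = complex.Re (g u) * complex.Re (h u) - complex.Im (g u) * complex.Im (h u)).
    by apply: le_trans (ler_normB _ _) _; rewrite !normrM lerD// ler_pM.
  by case: (g u) (h u) => [? ?] [? ?].
- move=> u; rewrite (_ : complex.Im _ = complex.Re (g u) * complex.Im (h u) + complex.Im (g u) * complex.Re (h u)).
    by apply: le_trans (ler_normD _ _) _; rewrite !normrM lerD// ler_pM.
  by case: (g u) (h u) => [? ?] [? ?] /=; ring.
Qed.

Lemma cbounded_add g h : cbounded g -> cbounded h -> cbounded (fun u => g u + h u).
Proof.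
move=> [B [g1 g2 gB1 gB2]] [C [h1 h2 hC1 hC2]]; exists (B + C).
have reD (x y : R[i]) : complex.Re (x + y) = complex.Re x + complex.Re y by case: x y => [? ?] [? ?].
have imD (x y : R[i]) : complex.Im (x + y) = complex.Im x + complex.Im y by case: x y => [? ?] [? ?].
split.
- by under eq_fun do rewrite reD; move=> u; apply: cvgD; [exact: g1|exact: h1].
- by under eq_fun do rewrite imD; move=> u; apply: cvgD; [exact: g2|exact: h2].
- by move=> u; rewrite reD; apply: le_trans (ler_normD _ _) _; rewrite lerD.
- by move=> u; rewrite imD; apply: le_trans (ler_normD _ _) _; rewrite lerD.
Qed.

Lemma cbounded_real (r : R -> R) (B : R) : continuous r -> (forall u, `|r u| <= B) ->
  cbounded (fun u => (r u)%:C).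
Proof.
move=> cr rB; exists B; split => //= [u|u]; first exact: cvg_cst.
by rewrite normr0 (le_trans _ (rB u)).
Qed.

Lemma cbounded_exp g m : cbounded g -> cbounded (fun u => g u ^+ m).
Proof.
move=> cg; elim: m => [|m IH].
  by apply: (@cbounded_real (fun=> 1) 1) => [u|u]; [exact: cvg_cst | rewrite normr1].
by under eq_fun do rewrite exprS; exact: cbounded_mul.
Qed.

Lemma continuous_sinZ (r : R) : continuous (fun u : R => sin (r * u)).
Proof.
move=> u; apply: continuous_comp; last exact: continuous_sin.
by apply: cvgMl_tmp; exact: cvg_id.
Qed.

Lemma cbounded_expi n : cbounded (fun u => expi u ^ n).
Proof.
under eq_fun do rewrite expi_exp; exists 1; split => /=.
- exact: continuous_cosZ.
- exact: continuous_sinZ.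
- by move=> u; rewrite ler_norml cos_geN1 cos_le1.
- by move=> u; rewrite ler_norml sin_geN1 sin_le1.
Qed.

(** An arc symmetric about the real axis: the integrand takes conjugate values
    at conjugate points, so that only the integral of its real part over half of
    the arc remains. *)
Lemma complex_integral_sym (g : R -> R[i]) (m h : R) : 0 <= h -> cbounded g ->
  (forall u, g (2 * m - u) = (g u)^*) ->
  complex_integral (m - h) (m + h) (fun u => (0 +i* 1) * g u) =
  0 +i* (2 * integ m (m + h) (fun u => complex.Re (g u))).
Proof.
move=> h0 [B [g1 g2 gB1 gB2]] gE; rewrite /complex_integral.
have E1 : \int[lebesgue_measure]_(u in `[(m - h), (m + h)]) complex.Re ((0 +i* 1) * g u) =
    integ (m - h) (m + h) (fun u => (-1) * complex.Im (g u)).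
  by apply: eq_Rintegral => u _; case: (g u) => [x y] /=; ring.
have E2 : \int[lebesgue_measure]_(u in `[(m - h), (m + h)]) complex.Im ((0 +i* 1) * g u) =
    integ (m - h) (m + h) (fun u => complex.Re (g u)).
  by apply: eq_Rintegral => u _; case: (g u) => [x y] /=; ring.
rewrite E1 E2 integZ; last exact: bmeas_continuous g2 gB2.
rewrite (@integ_odd _ _ B)//; last by move=> u; rewrite gE; case: (g u).
rewrite (@integ_even _ _ B)//; last by move=> u; rewrite gE; case: (g u).
by rewrite mulr0.
Qed.

Lemma complex_integral_point (a : R) g : complex_integral a a g = 0.
Proof. by rewrite /complex_integral set_itv1 !Rintegral_set1. Qed.

Lemma eq_complex_integral (a b : R) g h : (forall u, a <= u <= b -> g u = h u) ->
  complex_integral a b g = complex_integral a b h.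
Proof.
move=> gh; congr (_ +i* _); apply: eq_Rintegral => u; rewrite inE /= in_itv /= => ab;
  by rewrite gh.
Qed.

Lemma divide_2pii (x : R) : (2 * pi%:C * (0 +i* 1))^-1 * (0 +i* (2 * x)) = (x / pi)%:C.
Proof.
have p0 : (pi : R) != 0 by rewrite gt_eqF// pi_gt0.
have i0 : (0 +i* 1 : R[i]) != 0 by rewrite eq_complex /= eqxx oner_eq0.
have q0 : (2 * pi%:C : R[i]) != 0.
  by rewrite mulf_neq0 ?pnatr_eq0// eq_complex /= eqxx andbT.
have e : (2 * pi%:C * (0 +i* 1)) * (x / pi)%:C = 0 +i* (2 * x).
  rewrite (_ : 2 = (2%:R)%:C); last by rewrite rmorph_nat.
  apply/eqP; rewrite eq_complex /=; apply/andP; split; apply/eqP.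
    ring.
  by move: (pi : R) p0 => p p0; field.
by rewrite -e mulKf// mulf_neq0.
Qed.

End Expi.

(** * Identification of the limit with the contour integral *)

Section LimitKernel.
Variable R : realType.
Variables (N0 S0 T0 t0 x0 phi : R).
Hypotheses (hN0 : 0 < N0) (hS0 : 0 < S0) (hST0 : S0 < T0) (ht0 : 0 < t0) (htT0 : t0 < T0).
Hypotheses (hx0 : 0 < x0) (hxl : t0 + S0 - T0 < x0) (hxt : x0 < N0 + t0) (hxS : x0 < N0 + S0).
Local Notation aa := (al2 N0 S0 T0 t0 x0).
Local Notation bb := (be2 N0 S0 x0).
Local Notation kk := (cst0 N0 T0 t0).
Local Notation c := (cratio N0 S0 T0 t0 x0).
Local Notation sy := (symb N0 S0 T0 t0 x0).
Local Notation rs := (resolvent N0 T0 t0).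
Local Notation mg := (mgap T0 t0).
Local Notation cph := (cphi N0 S0 T0 t0 x0).
Local Notation bsym := (back_symbol N0 S0 T0 t0 x0).
Local Notation flim := (forw_limit N0 S0 T0 t0 x0 phi).

Hypotheses (phi_itv : 0 <= phi <= pi) (phi_lt : phi < pi -> cos phi <= cph)
  (phi_gt : 0 < phi -> cph <= cos phi).

Lemma Re_add (x y : R[i]) : complex.Re (x + y) = complex.Re x + complex.Re y.
Proof. by case: x y => [? ?] [? ?]. Qed.

Lemma Re_scale (r : R) (y : R[i]) : complex.Re (r%:C * y) = r * complex.Re y.
Proof. by case: y => [? ?] /=; ring. Qed.

Definition onecw (u : R) : R[i] := 1 + c%:C * expi u.

Lemma cpos : 0 < c. Proof. exact: cratio_gt0. Qed.

Lemma cosnE n th : cosn c n th = c ^ n / pi * complex.Re (expi th ^ n).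
Proof. by rewrite expi_exp /= /cosn mulrAC. Qed.

Lemma back_symbolE j n th : bsym j n th =
  c ^ n / pi * complex.Re ((aa%:C * (onecw th)^* ) ^+ j * expi th ^ n).
Proof.
have c0 := cpos; elim: j n => [|j IH] n /=; first by rewrite expr0 mul1r cosnE.
rewrite !IH.
have e2 : c ^ (n - 1) = c ^ n / c by rewrite expfzDr// gt_eqF.
have e3 : expi th ^ (n - 1) = (expi th)^* * expi th ^ n.
  rewrite expfzDr ?expi_neq0// mulrC; congr (_ * _).
  by rewrite expi_exp expi_conj mulN1r.
have cE : (onecw th)^* = 1 + c%:C * (expi th)^*.
  rewrite /onecw rmorphD rmorph1 rmorphM; congr (_ + _ * _).
  by apply/eqP; rewrite eq_complex /= oppr0 !eqxx.
have b2 : bb = aa * c ^+ 2 by rewrite cratio2.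
rewrite e2 e3 exprSr.
set Q := (aa%:C * _) ^+ j; set E := expi th ^ n.
have -> : Q * (aa%:C * (onecw th)^* ) * E =
    aa%:C * (Q * E) + (aa * c)%:C * (Q * ((expi th)^* * E)).
  have e4 : (aa * c)%:C = aa%:C * c%:C :> R[i] by rewrite rmorphM.
  by rewrite cE e4; ring.
rewrite Re_add !Re_scale b2.
set A := complex.Re (Q * E); set B := complex.Re (Q * ((expi th)^* * E)).
set C := c ^ n / pi; rewrite (_ : c ^ n / c / pi = C / c); last by rewrite /C; ring.
by move: c c0 => d d0; field; rewrite gt_eqF.
Qed.

Lemma continuous_symb : continuous sy.
Proof.
move=> u; apply: cvgD; first exact: cvg_cst.
by apply: cvgMl_tmp; exact: continuous_cos.
Qed.

Lemma symbN u : sy (- u) = sy u.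
Proof. by rewrite /symb cosN. Qed.

Lemma cbounded_onecw : cbounded onecw.
Proof.
apply: cbounded_add.
  by apply: (@cbounded_real R (fun=> 1) 1) => [u|u]; [exact: cvg_cst | rewrite normr1].
apply: cbounded_mul; last exact: (cbounded_expi R 1).
by apply: (@cbounded_real R (fun=> c) `|c|) => [u|u//]; exact: cvg_cst.
Qed.

Lemma cbounded_conj (g : R -> R[i]) : cbounded g -> cbounded (fun u => (g u)^*).
Proof.
move=> [B [g1 g2 gB1 gB2]]; exists B; split.
- by rewrite (_ : (fun u => _) = (fun u => complex.Re (g u))) //; apply/funext => u; case: (g u).
- rewrite (_ : (fun u => _) = (fun u => - complex.Im (g u))); last by apply/funext => u; case: (g u).
  by move=> u; apply: cvgN; exact: g2.
- by move=> u; have := gB1 u; case: (g u).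
- by move=> u; have := gB2 u; case: (g u) => [a b] /=; rewrite normrN.
Qed.

Lemma onecw_conj u : onecw (- u) = (onecw u)^*.
Proof.
rewrite /onecw rmorphD rmorph1 rmorphM; congr (_ + _ * _); last exact/esym/expi_conj.
by apply/eqP; rewrite eq_complex /= oppr0 !eqxx.
Qed.

(** In terms of w = expi u, the symbol plus cst0 is al2 |1 + c w|^2; this is
    why dividing by it turns the conjugate factors that come from the
    transitions into inverse powers of 1 + c w. *)
Lemma onecw_norm u : aa%:C * (onecw u * (onecw u)^*) = (sy u + kk)%:C.
Proof.
have b2 : bb = aa * c ^+ 2 by rewrite cratio2.
apply/eqP; rewrite eq_complex /symb b2 /onecw /expi /=; apply/andP; split; apply/eqP; last by ring.
have := cos2Dsin2 u; move: (cos u) (sin u) => C D CD.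
rewrite (_ : aa + aa * c ^+ 2 = aa * (1 + c ^+ 2 * (C ^+ 2 + D ^+ 2))); last by rewrite CD; ring.
ring.
Qed.

(** On the right arc the symbol is above the threshold, hence the cut-off in
    the resolvent does not act. *)
Lemma onecw_inv u : 0 < phi -> - phi <= u <= phi ->
  (onecw u)^-1 = (aa * rs (sy u))%:C * (onecw u)^*.
Proof.
move=> phi0 /andP[u1 u2]; have m0 : 0 < mg by exact: mgap_gt0.
have /andP[_ ppi] := phi_itv.
have a0 : 0 < aa by exact: al2_gt0.
have cosu : cos phi <= cos u.
  wlog u0 : u u1 u2 / 0 <= u => [H|].
    have [/H H'|/ltW] := leP 0 u; first exact: H'.
    by rewrite -oppr_ge0 -(cosN u) => u0; apply: H => //; [rewrite lerN2|rewrite lerNl].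
  rewrite le_eqVlt; have [->|un] := eqVneq u phi; first by rewrite eqxx.
  apply/orP; right; rewrite ltr_cos ?lt_neqAle ?un// in_itv /= ?(ltW phi0) ?u0//.
  exact: le_trans u2 ppi.
have s : 2 * mg <= sy u + kk.
  rewrite -(threshold_cst0 N0 T0 t0) lerD2r -subr_ge0 symb_threshold//.
  have A0 : 0 < 2 * (aa * c) by apply: mulr_gt0 => //; apply: mulr_gt0 => //; exact: cpos.
  by apply: mulr_ge0 (ltW A0) _; rewrite subr_ge0 (le_trans (phi_gt phi0) cosu).
have s0 : 0 < sy u + kk by apply: lt_le_trans s; rewrite mulr_gt0.
have rE : rs (sy u) = (sy u + kk)^-1.
  rewrite /resolvent (max_idPl _)//; apply: le_trans s.
  by rewrite ler_peMl ?(ltW m0)// ler1n.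
have sC : (sy u + kk)%:C != 0 :> R[i] by rewrite eq_complex /= eqxx andbT gt_eqF.
have n0 : onecw u != 0.
  by apply: contraNneq sC => e0; rewrite -onecw_norm e0 mul0r mulr0.
apply: (mulfI n0); rewrite divff// mulrCA mulrC rE rmorphM fmorphV /=.
by rewrite mulrA [_ * aa%:C]mulrC onecw_norm divff.
Qed.

(** The integrand over the arc takes conjugate values at conjugate points, so
    twice the integral of its real part over half of the arc remains; there
    onecw_inv rewrites the negative power of 1 + c w. *)
Lemma sine_kernel_geE (x y t : int) (m : nat) :
  (integ 0 phi (fun th => rs (sy th) ^+ m * bsym m (x - y) th))%:C =
  (c ^ (x - y))%:C * sine_kernel c phi (x, t + m%:Z) (y, t).
Proof.
have /andP[p0 ppi] := phi_itv; set n := x - y.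
pose g u := ((aa * rs (sy u)) ^+ m)%:C * ((onecw u)^* ^+ m * expi u ^ n).
have cg : cbounded g.
  apply: cbounded_mul.
    have [B [L [_ _ rB _]]] := bounded_lipschitz_resolvent N0 ht0 htT0 m.
    have cr : continuous (fun u => rs u ^+ m) by exact: bounded_lipschitz_continuous (bounded_lipschitz_resolvent N0 ht0 htT0 m).
    apply: (@cbounded_real R (fun u => (aa * rs (sy u)) ^+ m) (`|aa ^+ m| * B)) => u.
      rewrite (_ : (fun u => _) = (fun u => aa ^+ m * rs (sy u) ^+ m)); last first.
        by apply/funext => v; rewrite exprMn.
      apply: cvgMl_tmp; apply: (continuous_comp (f := sy) (g := fun u => rs u ^+ m)).
        exact: continuous_symb.
      exact: cr.
    by rewrite exprMn normrM; apply: ler_pM.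
  apply: cbounded_mul; last exact: cbounded_expi.
  by apply: cbounded_exp; apply: cbounded_conj; exact: cbounded_onecw.
have gN u : g (- u) = (g u)^*.
  rewrite /g symbN onecw_conj [RHS]rmorphM [X in _ = _ * X]rmorphM; congr (_ * (_ * _)).
  - by apply/eqP; rewrite eq_complex /= oppr0 !eqxx.
  - by rewrite rmorphXn.
  - by rewrite !expi_exp mulrN; exact/esym/expi_conj.
rewrite /sine_kernel /= lerDl lez_nat leq0n.
set f := (X in arc_integral _ _ X).
rewrite /arc_integral (_ : - phi <= phi); last by rewrite (le_trans _ p0)// oppr_le0.
have -> : complex_integral (- phi) phi (fun u => f (expi u) * ((0 +i* 1) * expi u)) =
    0 +i* (2 * integ 0 phi (fun u => complex.Re (g u))).
  have [phi0|phi0] := eqVneq phi 0.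
    by rewrite phi0 oppr0 complex_integral_point /integ set_itv1 Rintegral_set1 mulr0.
  have phi1 : 0 < phi by rewrite lt_neqAle eq_sym phi0.
  have gN0 u : g (2 * 0 - u) = (g u)^* by rewrite mulr0 sub0r.
  have := complex_integral_sym p0 cg gN0; rewrite !sub0r !add0r => <-.
  apply: eq_complex_integral => u uphi; rewrite /f.
  have -> : t - (t + m%:Z) = - m%:Z by ring.
  rewrite -exprnN -/(onecw u) -exprVn onecw_inv// exprMn.
  rewrite (_ : x - y - 1 = n + (- 1)) // expfzDr ?expi_neq0//.
  rewrite (_ : expi u ^ (-1) = (expi u)^-1) // /g rmorphXn /=.
  by field; exact: expi_neq0.
rewrite divide_2pii -rmorphM; congr (_%:C).
rewrite [_ / pi]mulrC mulrA -integZ; last first.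
  have [B [g1 _ gB _]] := cg; exact: bmeas_continuous g1 gB.
apply: eq_integ => u _; rewrite back_symbolE /g Re_scale.
rewrite (_ : (aa%:C * (onecw u)^*) ^+ m * expi u ^ n = (aa ^+ m)%:C * ((onecw u)^* ^+ m * expi u ^ n)); last first.
  by rewrite exprMn rmorphXn /= mulrA.
rewrite Re_scale [(aa * rs _) ^+ m]exprMn; set P := c ^ n / pi; ring.
Qed.

(** The integral of cosn over the whole interval is the delta function, so
    its difference with the integral from 0 to phi is an integral over the
    complementary interval. *)
Lemma forw_limitE j n : flim j n =
  - (c ^ n / pi) * integ phi pi (fun u => complex.Re (onecw u ^+ j * expi u ^ n)).
Proof.
have /andP[p0 ppi] := phi_itv; have c0 := cpos.
have bm i k : bmeas (fun u => complex.Re (onecw u ^+ i * expi u ^ k)).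
  have [B [g1 _ gB _]] : cbounded (fun u => onecw u ^+ i * expi u ^ k).
    by apply: cbounded_mul; [apply: cbounded_exp; exact: cbounded_onecw | exact: cbounded_expi].
  exact: bmeas_continuous g1 gB.
elim: j n => [|j IH] n /=.
  have := integ_cosn c n; rewrite (integ_setU (bmeas_cosn n c0) p0 ppi) => <-.
  rewrite opprD addNKr mulNr -integZ//; congr (- _).
  by apply: eq_integ => u _; rewrite expr0 mul1r cosnE.
rewrite !IH expfzDr ?gt_eqF// !mulNr -opprD; congr (- _).
rewrite -!integZ// -integD; last 2 first.
- by apply: bmeasM => //; exact: bmeas_cst.
- by apply: bmeasM => //; exact: bmeas_cst.
apply: eq_integ => u _; rewrite expfzDr ?expi_neq0//.
have -> : onecw u ^+ j.+1 * expi u ^ n =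
   onecw u ^+ j * expi u ^ n + c%:C * (onecw u ^+ j * (expi u ^ n * expi u ^ 1)).
  rewrite exprSr (_ : expi u ^ 1 = expi u) // {2}/onecw; ring.
by rewrite Re_add Re_scale (_ : c ^ 1 = c)//; ring.
Qed.

Lemma sine_kernel_ltE (x y s : int) (j : nat) :
  (flim j.+1 (x - y))%:C = (c ^ (x - y))%:C * sine_kernel c phi (x, s) (y, s + j.+1%:Z).
Proof.
have /andP[p0 ppi] := phi_itv; set n := x - y.
pose g u := onecw u ^+ j.+1 * expi u ^ n.
have cg : cbounded g.
  by apply: cbounded_mul; [apply: cbounded_exp; exact: cbounded_onecw | exact: cbounded_expi].
have gE u : g (2 * pi - u) = (g u)^*.
  rewrite /g [RHS]rmorphM; congr (_ * _).
    by rewrite rmorphXn /= -onecw_conj /onecw expi2piB.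
  by rewrite expi2piB !expi_exp mulrN; exact/esym/expi_conj.
have [B [g1 _ gB _]] := cg.
have hphi : 0 <= pi - phi by rewrite subr_ge0.
have ci : complex_integral phi (2 * pi - phi) (fun u => (0 +i* 1) * g u) =
    0 +i* (2 * integ phi pi (fun u => complex.Re (g u))).
  have := complex_integral_sym hphi cg gE.
  rewrite (_ : pi - (pi - phi) = phi); last by ring.
  rewrite (_ : pi + (pi - phi) = 2 * pi - phi); last by ring.
  move=> ->; congr (0 +i* (2 * _)).
  have := @integ_reflect R (fun u => complex.Re (g u)) (2 * pi) phi pi ppi g1.
  rewrite (_ : 2 * pi - pi = pi); last by ring.
  move=> ->; apply: eq_integ => u _; rewrite gE; by case: (g u).
rewrite forw_limitE /sine_kernel /= [X in if X then _ else _](_ : _ = false); last by rewrite gerDl lez_nat.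
set f := (X in arc_integral _ _ X).
have fE u : f (expi u) * ((0 +i* 1) * expi u) = (0 +i* 1) * g u.
  rewrite /f (_ : s + j.+1%:Z - s = j.+1%:Z); last by ring.
  rewrite -/(onecw u) (_ : x - y - 1 = n + (- 1)) // expfzDr ?expi_neq0//.
  rewrite (_ : expi u ^ (-1) = (expi u)^-1) // /g (_ : onecw u ^ j.+1%:Z = onecw u ^+ j.+1)//.
  by field; exact: expi_neq0.
have -> : arc_integral (2 * pi - phi) phi f =
   0 +i* (2 * - integ phi pi (fun u => complex.Re (g u))).
  rewrite /arc_integral; case: ifP => h.
    have ep : phi = pi by apply/eqP; rewrite eq_le ppi /=; move: h; lra.
    rewrite ep (_ : 2 * pi - pi = pi); last by ring.
    by rewrite complex_integral_point /integ set_itv1 Rintegral_set1 oppr0 mulr0.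
  rewrite (eq_complex_integral (h := fun u => (0 +i* 1) * g u)) => [|u _]; last exact: fE.
  by rewrite ci; apply/eqP; rewrite eq_complex /= oppr0 mulrN !eqxx.
rewrite divide_2pii -rmorphM; congr (_%:C).
by rewrite /g /n; move: (integ _ _ _) => I; ring.
Qed.

End LimitKernel.

(** * A random set with prescribed word probabilities *)

Section WordMeasure.
Variables (R : realType) (m : seq bool -> R).
Hypotheses (m1 : m [::] = 1) (m_ge0 : forall v, 0 <= m v)
  (mS : forall v, m (false :: v) + m (true :: v) = m v).

Fixpoint cell_start (v : seq bool) : R :=
  if v is b :: v' then cell_start v' + (if b then m (false :: v') else 0) else 0.

(** Successive subdivision of the interval from 0 to 1: the cell of a word
    has the probability of the word as its length. Words have their latest
    bit first. *)
Definition cell (v : seq bool) : set R := `[cell_start v, cell_start v + m v[.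

Lemma cellE v w : cell v w <-> (cell_start v <= w) /\ (w < cell_start v + m v).
Proof. by rewrite /cell /= in_itv /=; split => [/andP|/andP]. Qed.

Lemma cell_cons b v : cell (b :: v) `<=` cell v.
Proof.
move=> w /cellE/=[h1 h2]; apply/cellE; have := mS v; have := m_ge0 (true :: v).
have := m_ge0 (false :: v).
by case: b h1 h2 => h1 h2 m0 m0' e; split; lra.
Qed.

Lemma cell_split v w : cell v w -> exists b, cell (b :: v) w.
Proof.
move=> /cellE[h1 h2]; have e := mS v.
have [h|h] := ltP w (cell_start v + m (false :: v)); [exists false|exists true]; apply/cellE => /=;
  split; lra.
Qed.

Lemma cell_cover n w : 0 <= w < 1 -> exists2 v, size v = n & cell v w.
Proof.
move=> w01; elim: n => [|n [v sv vw]].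
  by exists [::] => //; apply/cellE; rewrite /= m1 add0r; apply/andP.
by have [b bv] := cell_split vw; exists (b :: v) => //=; rewrite sv.
Qed.

Lemma cell_inj v v' w : size v = size v' -> cell v w -> cell v' w -> v = v'.
Proof.
elim: v v' => [|b v IH] [|b' v'] //= [sv] h h'.
have e := IH _ sv (cell_cons h) (cell_cons h'); rewrite -{}e {v' sv} in h' *.
congr cons; move: h h' => /cellE/= [h1 h2] /cellE/= [h1' h2'].
by case: b b' h1 h2 h1' h2' => -[] // h1 h2 h1' h2'; lra.
Qed.

Lemma cell_sub v : cell v `<=` `[0, 1[%classic.
Proof.
elim: v => [|b v IH]; first by move=> w /cellE; rewrite /= m1 add0r in_itv /= => -[-> ->].
exact: (subset_trans (@cell_cons b v)).
Qed.

Fixpoint bit (v : seq bool) (k : nat) : bool :=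
  if v is b :: v' then if k == size v' then b else bit v' k else false.

(** The random set, as a function of a uniform random number w: k belongs to
    it when the bit k of the words whose cells contain w is 1. Nothing
    belongs to it when w is outside the interval from 0 to 1. *)
Definition marked (k : nat) : set R :=
  [set w | exists2 v, size v = k & cell (true :: v) w].

Lemma marked_bit v k w : (k < size v)%N -> cell v w -> marked k w <-> bit v k.
Proof.
elim: v => // b v IH /=; rewrite ltnS leq_eqVlt => kv vw.
case: eqP kv => [->|_ /= kv]; last by apply: IH kv _; exact: cell_cons vw.
move=> _; split => [[v' sv' vw']|b1]; last by exists v => //; rewrite -b1.
suff [<- _] : [:: true & v'] = b :: v by [].
by apply: cell_inj vw' vw => /=; rewrite sv'.
Qed.

Lemma measurable_marked k : measurable (marked k).
Proof.
rewrite (_ : marked k = \big[setU/set0]_(v : k.-tuple bool) cell (true :: v)).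
  by apply: bigsetU_measurable => v _; exact: measurable_itv.
apply/seteqP; split => w.
  move=> [v /eqP sv vw]; rewrite -bigcup_seq /=.
  by exists (Tuple sv) => //=; rewrite mem_index_enum.
by rewrite -bigcup_seq => -[v _ vw]; exists v => //; exact: size_tuple.
Qed.

Local Notation P01 := (uniform_prob (@ltr01 R)).

Lemma uniform_cell v : P01 (cell v) = (m v)%:E.
Proof.
rewrite /uniform_prob integral_uniform_pdf setIidl; last first.
  by move=> w /cell_sub /=; rewrite !in_itv /= => /andP[-> /ltW].
transitivity (\int[lebesgue_measure]_(x in cell v) (cst 1%:E : R -> \bar R) x)%E.
  apply: eq_integral => w /[!inE] /cell_sub /=; rewrite in_itv /= => /andP[w0 w1].
  by rewrite /uniform_pdf w0 (ltW w1) subr0 invr1.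
rewrite integral_cst; last exact: measurable_itv.
rewrite mul1e; etransitivity; [exact: (lebesgue_measure_itv `[cell_start v, cell_start v + m v[)|rewrite /= lte_fin].
case: ifPn => [_|]; first by rewrite -EFinB addrAC subrr add0r.
rewrite -leNgt gerDl => h; congr EFin; apply/eqP; by rewrite eq_le m_ge0.
Qed.

(** The event is a disjoint union of cells; some k must be required to belong
    to the random set, so that the event contains no w outside the interval
    from 0 to 1. *)
Lemma uniform_marked n (A : {pred nat}) : (exists k, A k) -> (forall k, A k -> (k < n)%N) ->
  P01 [set w | forall k, A k -> marked k w] =
  (\sum_(v : n.-tuple bool | [forall k : 'I_n, A k ==> bit v k]) m v)%:E.
Proof.
move=> [k0 Ak0] An.
pose D : set (n.-tuple bool) := [set v | [forall k : 'I_n, A k ==> bit v k]].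
rewrite (_ : mkset _ = \bigcup_(v in D) cell v).
  rewrite measure_fin_bigcup; last first.
  - by move=> v _; exact: measurable_itv.
  - by move=> v v' _ _ [w [vw vw']]; apply: val_inj; apply: cell_inj vw vw'; rewrite !size_tuple.
  - exact: finite_finset.
  rewrite (@fsbigE _ _ _ _ D [seq v : n.-tuple bool <- index_enum _ | [forall k : 'I_n, A k ==> bit v k]]); last 3 first.
  - by rewrite filter_uniq// index_enum_uniq.
  - by move=> v /=; rewrite mem_filter => /andP[].
  - by move=> v Dv; rewrite mem_filter (_ : [forall k : 'I_n, _]) ?mem_index_enum.
  rewrite big_filter_cond -sumEFin; apply: eq_big => [v|v _]; last exact: uniform_cell.
  by rewrite mem_setE andbb.
apply/seteqP; split => w.
  move=> Aw; have [v0 _ /cell_sub/=] := Aw _ Ak0.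
  rewrite in_itv /= => /(cell_cover n)[v /eqP sv vw].
  exists (Tuple sv) => //=; apply/forallP => k; apply/implyP => Ak.
  by apply/(marked_bit _ vw); [rewrite (eqP sv)|exact: Aw].
move=> [v /= /forallP Av vw] k Ak.
have kn := An _ Ak; apply/(marked_bit _ vw); first by rewrite size_tuple.
by have /implyP := Av (Ordinal kn); apply.
Qed.

End WordMeasure.

(** * A random set from limits of finite models *)

Section FiniteProbability.
Variables (R : realType) (F : finType) (A : {set F}).
Local Notation prob := (Defs.uniform_prob R A).

Lemma uniform_probE (E : pred F) : prob E = (\sum_(f in A) (E f)%:R) / #|A|%:R.
Proof.
rewrite /Defs.uniform_prob; congr (_ / _).
rewrite -sum1_card natr_sum big_mkcond [RHS]big_mkcond /=; apply: eq_bigr => f _.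
by rewrite inE; case: (f \in A); case: (E f).
Qed.

Lemma uniform_prob_ge0 (E : pred F) : 0 <= prob E.
Proof. by rewrite /Defs.uniform_prob mulr_ge0 ?invr_ge0. Qed.

Lemma eq_uniform_prob (E E' : pred F) : E =1 E' -> prob E = prob E'.
Proof. by move=> e; rewrite !uniform_probE; under eq_bigr do rewrite e. Qed.

Lemma uniform_prob_true : (0 < #|A|)%N -> prob predT = 1.
Proof.
move=> A0; rewrite uniform_probE sumr_const divff// pnatr_eq0 -lt0n//.
Qed.

Lemma uniform_probD (E E1 E2 : pred F) : (forall f, E f = E1 f + E2 f :> nat)%N ->
  prob E1 + prob E2 = prob E.
Proof.
move=> e; rewrite !uniform_probE -mulrDl -big_split /=; congr (_ / _).
by apply: eq_bigr => f _; rewrite e natrD.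
Qed.

Variable occ : F -> nat -> bool.

Fixpoint word (f : F) (n : nat) : seq bool :=
  if n is n'.+1 then occ f n' :: word f n' else [::].

Lemma size_word f n : size (word f n) = n.
Proof. by elim: n => //= n ->. Qed.

Lemma bit_word f n k : (k < n)%N -> bit (word f n) k = occ f k.
Proof.
elim: n => //= n IH; rewrite ltnS leq_eqVlt size_word.
by case: eqP => [->|] //= _ /IH.
Qed.

Lemma sum_prob_word n (U : seq nat) : (forall k, k \in U -> (k < n)%N) ->
  \sum_(v : n.-tuple bool | [forall k : 'I_n, ((k : nat) \in U) ==> bit v k])
    prob (fun f => word f n == v) = prob (fun f => all (occ f) U).
Proof.
move=> Un; under eq_bigr do rewrite uniform_probE.
rewrite -mulr_suml exchange_big /= uniform_probE; congr (_ / _).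
apply: eq_bigr => f _; have sw : size (word f n) == n by rewrite size_word.
rewrite -[word f n]/(val (Tuple sw)).
transitivity (\sum_(v : n.-tuple bool |
    [forall k : 'I_n, ((k : nat) \in U) ==> bit v k] && (v == Tuple sw)) (1 : R)).
  rewrite big_mkcondr /=; apply: eq_bigr => v _.
  by rewrite -val_eqE eq_sym; case: eqP.
have -> : all (occ f) U = [forall k : 'I_n, ((k : nat) \in U) ==> bit (Tuple sw) k].
  apply/allP/forallP => [h k|h k kU].
    by apply/implyP => kU; rewrite /= bit_word// h.
  have kn := Un _ kU; have /implyP := h (Ordinal kn).
  by move=> /(_ kU); rewrite /= bit_word.
case: (boolP [forall k : 'I_n, _]) => h.
  by rewrite (big_pred1 (Tuple sw))// => v /=; case: eqP => [->|]; rewrite ?h ?andbF.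
by rewrite big_pred0// => v /=; case: eqP => [->|]; rewrite ?(negbTE h) ?andbF.
Qed.

End FiniteProbability.

Section ProcessOfLimits.
Variables (R : realType) (F : R -> finType) (A : forall rho, {set F rho}).
Variable occ : forall rho, F rho -> nat -> bool.
Local Notation prob rho := (Defs.uniform_prob R (A rho)).
Hypothesis A_gt0 : \forall rho \near +oo, (0 < #|A rho|)%N.
Hypothesis occ_cvg : forall U : seq nat,
  cvg (prob rho (fun f => all (occ f) U) @[rho --> +oo]).

(** Inclusion and exclusion: requiring a point to be unoccupied subtracts the
    probability that it is occupied. The list U collects the points that are
    required to be occupied. *)
Lemma word_cvg (v : seq bool) (U : seq nat) :
  cvg (prob rho (fun f => (word (@occ rho) f (size v) == v) && all (occ f) U) @[rho --> +oo]).
Proof.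
elim: v U => [|b v IH] U; first exact: occ_cvg.
have c1 := IH (size v :: U); case: b.
  rewrite [X in cvg (fmap X _)](_ : _ = (fun rho =>
    prob rho (fun f => (word (@occ rho) f (size v) == v) && all (occ f) (size v :: U)))) //.
  apply/funext => rho; apply: eq_uniform_prob => f /=; rewrite eqseq_cons.
  by case: (occ f _) => //=; rewrite andbF.
rewrite [X in cvg (fmap X _)](_ : _ = (fun rho =>
    prob rho (fun f => (word (@occ rho) f (size v) == v) && all (occ f) U) -
    prob rho (fun f => (word (@occ rho) f (size v) == v) && all (occ f) (size v :: U)))).
  exact: is_cvgB.
apply/funext => rho; apply/eqP; rewrite eq_sym subr_eq eq_sym; apply/eqP.
apply: uniform_probD => f /=; rewrite eqseq_cons.
by case: (occ f _) => /=; case: (_ == v); case: (all _ _).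
Qed.

Definition word_limit (v : seq bool) : R :=
  lim (prob rho (fun f => word (@occ rho) f (size v) == v) @[rho --> +oo]).

Lemma word_limitP v :
  prob rho (fun f => word (@occ rho) f (size v) == v) @[rho --> +oo] --> word_limit v.
Proof.
have := @word_cvg v [::]; rewrite /word_limit.
rewrite [X in cvg (fmap X _) -> _](_ : _ = (fun rho =>
  prob rho (fun f => word (@occ rho) f (size v) == v))) //.
by apply/funext => rho; apply: eq_uniform_prob => f /=; rewrite andbT.
Qed.

(** The word probabilities pass to the limit together with their positivity,
    total mass and consistency; the probability that the points of U are all
    occupied is a finite sum of word probabilities. *)
Lemma process_of_limits : exists X : R -> set nat,
  (forall k, measurable [set w | X w k]) /\
  (forall U : seq nat, (0 < size U)%N ->
    fine (uniform_prob (@ltr01 R) [set w | forall k, k \in U -> X w k]) =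
    lim (prob rho (fun f => all (occ f) U) @[rho --> +oo])).
Proof.
have l1 : word_limit [::] = 1.
  apply: cvg_lim => //; apply: (near_eq_cvg_to _ (cvg_cst (1 : R))).
  near=> rho; rewrite -(@uniform_prob_true R _ (A rho)); last by near: rho.
  exact: eq_uniform_prob.
have l2 v : 0 <= word_limit v.
  apply: limr_ge; first exact: word_limitP.
  by apply: nearW => rho; exact: uniform_prob_ge0.
have l3 v : word_limit (false :: v) + word_limit (true :: v) = word_limit v.
  apply/esym/cvg_lim => //.
  apply: (near_eq_cvg_to _ (cvgD (@word_limitP (false :: v)) (@word_limitP (true :: v)))).
  apply: nearW => rho; apply/esym/uniform_probD => f /=; rewrite !eqseq_cons.
  by case: (occ f _); case: (_ == v).
exists (fun w k => marked word_limit k w); split=> [k|U U0].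
  exact: measurable_marked.
pose n := (\max_(k <- U) k).+1.
have Un k : k \in U -> (k < n)%N by move=> kU; rewrite ltnS; exact: leq_bigmax_seq.
rewrite (@uniform_marked _ _ l1 l2 l3 n (fun k => k \in U)) //=; last first.
  by case: U U0 {n Un} => // k U _; exists k; rewrite inE eqxx.
apply/esym/cvg_lim => //.
apply: (near_eq_cvg_to (g := fun rho => \sum_(v : n.-tuple bool |
   [forall k : 'I_n, ((k : nat) \in U) ==> bit v k]) prob rho (fun f => word (@occ rho) f n == v))).
  by apply: nearW => rho; rewrite sum_prob_word.
apply: cvg_big => [|v _]; first exact: add_continuous.
by have := @word_limitP v; rewrite size_tuple.
Unshelve. all: by end_near. Qed.

End ProcessOfLimits.

Lemma int_le_add (t s : int) : t <= s -> exists m : nat, s = t + m%:Z.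
Proof. by move=> ts; exists (absz (s - t)); lia. Qed.

Lemma int_lt_add (s t : int) : s < t -> exists m : nat, t = s + m.+1%:Z.
Proof. by move=> st; exists (absz (t - s)).-1; lia. Qed.

(** * Convergence of the hitting probabilities *)

(** Conjugation by a diagonal matrix. *)
Lemma det_gauge (F : fieldType) n (K : 'I_n -> 'I_n -> F) (u : 'I_n -> F) :
  (forall i, u i != 0) ->
  \det (\matrix_(i, j) (u i / u j * K i j)) = \det (\matrix_(i, j) K i j).
Proof.
move=> u0.
rewrite (_ : \matrix_(i, j) (u i / u j * K i j) =
  diag_mx (\row_i u i) *m (\matrix_(i, j) K i j) *m diag_mx (\row_i (u i)^-1)); last first.
  by rewrite mul_diag_mx mul_mx_diag; apply/matrixP => i j; rewrite !mxE mulrAC.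
rewrite !det_mulmx !det_diag mulrAC -big_split /= big1 ?mul1r// => i _.
by rewrite !mxE divff.
Qed.

Lemma det_cvg (R : realType) n (M : R -> 'M[R]_n) (L : 'M[R]_n) :
  (forall i j, M rho i j @[rho --> +oo] --> L i j) -> \det (M rho) @[rho --> +oo] --> \det L.
Proof.
move=> ML; rewrite /determinant; apply: cvg_big => [|s _]; first exact: add_continuous.
apply: cvgMl_tmp; apply: cvg_big => [|i _]; first exact: mul_continuous.
exact: ML.
Qed.

Lemma cvg_real_complex (R : realType) (h : R -> R) (d : R) :
  h rho @[rho --> +oo] --> d ->
  ((h rho)%:C : R[i]^o) @[rho --> +oo] --> (d%:C : R[i]^o).
Proof.
move=> hd; apply/cvgrPdist_le => /= e; rewrite ltcE /= => /andP[/eqP e1 e2].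
have /cvgrPdist_le/(_ _ e2) := hd; apply: filterS => rho hrho.
rewrite -rmorphB normc_def /= expr0n addr0 sqrtr_sqr lecE /= e1 eqxx /=.
exact: hrho.
Qed.

#[local] Arguments sine_kernel : simpl never.

Section Assembly.
Variables (R : realType) (N0 S0 T0 t0 x0 : R).
Hypotheses (hN0 : 0 < N0) (hS0 : 0 < S0) (hST0 : S0 < T0) (ht0 : 0 < t0) (htT0 : t0 < T0).
Hypotheses (hx0 : 0 < x0) (hxl : t0 + S0 - T0 < x0) (hxt : x0 < N0 + t0) (hxS : x0 < N0 + S0).
Local Notation c := (cratio N0 S0 T0 t0 x0).
Local Notation phi := (kernel_phi N0 T0 S0 t0 x0).
Local Notation cph := (cphi N0 S0 T0 t0 x0).

Lemma kernel_cE : kernel_c N0 T0 S0 t0 x0 = c.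
Proof. by rewrite /kernel_c /cratio /al2 /be2 [x0 * _]mulrC. Qed.

Lemma cos_phiE : cos_phi N0 T0 S0 t0 x0 = cph.
Proof.
have a0 : 0 < al2 N0 S0 T0 t0 x0 by exact: al2_gt0.
have c0 : 0 < c by exact: cratio_gt0.
rewrite /cos_phi /cphi; congr (_ / (2 * _)); first by rewrite /threshold /al2 /be2 /cst0; ring.
rewrite -[RHS]gtr0_norm; last exact: mulr_gt0.
rewrite -sqrtr_sqr; congr Num.sqrt.
have := cratio2 hx0 hxl hxt hxS => e.
rewrite exprMn expr2 -[in RHS]mulrA e /al2 /be2; ring.
Qed.

(** If the argument of the arc cosine is outside its domain, phi is an end of
    the interval and one of the two inequalities is vacuous. *)
Lemma kernel_phiP : [/\ 0 <= phi <= pi, phi < pi -> cos phi <= cph & 0 < phi -> cph <= cos phi].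
Proof.
rewrite /kernel_phi cos_phiE; move: cph => a; case: ltP => h1.
  by rewrite lexx pi_ge0 cos0 (ltW h1) ltxx; split.
case: ltP => h2; first by rewrite lexx pi_ge0 cospi (ltW h2) ltxx; split.
have a1 : -1 <= a <= 1 by rewrite h1 h2.
by rewrite acos_ge0 ?acos_lepi ?acosK//=.
Qed.

Variables (N S T : R -> nat).
Hypotheses (sN : scaled (fun rho => (N rho)%:R) N0) (sS : scaled (fun rho => (S rho)%:R) S0)
  (sT : scaled (fun rho => (T rho)%:R) T0).
Hypothesis hmodel : \forall rho \near +oo, (1 <= N rho)%N /\ (S rho <= T rho)%N.

(** The floor is eventually positive, since t0 > 0. *)
Definition time (z : int) (rho : R) : nat := absz (Num.floor (rho * t0) + z).

Lemma near_time z : \forall rho \near +oo, Num.floor (rho * t0) + z = (time z rho)%:Z.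
Proof.
have h : \forall rho \near +oo, 0 < ((Num.floor (rho * t0) + z)%:~R : R).
  exact: scaled_pos (@scaled_floor R t0 z) ht0.
by apply: filterS h => rho; rewrite ltr0z /time => /ltW /gez0_abs ->.
Qed.

Lemma scaled_time z : scaled (fun rho => (time z rho)%:R) t0.
Proof.
apply: (near_eq_cvg_to _ (@scaled_floor R t0 z)); near=> rho.
suff -> : Num.floor (rho * t0) + z = (time z rho)%:Z by rewrite pmulrn.
by near: rho; exact: near_time.
Unshelve. all: by end_near. Qed.

Lemma near_time_le z : \forall rho \near +oo, (time z rho <= T rho)%N.
Proof.
have : \forall rho \near +oo, 0 < ((T rho)%:R - (time z rho)%:R : R).
  have p : 0 < T0 - t0 by rewrite subr_gt0.
  exact: scaled_pos (scaledB sT (@scaled_time z)) p.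
by apply: filterS => rho; rewrite subr_gt0 ltr_nat => /ltnW.
Qed.

Let X rho := Num.floor (rho * x0).

(** The factor with a power of c is removed from determinants by det_gauge. *)
Lemma kernel_mx_cvg n (pts : 'I_n -> int * int) a b :
  kernel_mx R (N rho) (T rho) (S rho) (fun a => time (pts a).2 rho)
    (fun a => X rho + (pts a).1) a b @[rho --> +oo] -->
  complex.Re ((c ^ ((pts a).1 - (pts b).1))%:C * sine_kernel c phi (pts a) (pts b)).
Proof.
have [phi1 phi2 phi3] := kernel_phiP.
have sX z : scaled (fun rho => (X rho + z)%:~R) x0 by exact: scaled_floor.
have st z : scaled (fun rho => (time z rho)%:R) t0 by exact: scaled_time.
case ea: (pts a) => [x s]; case eb: (pts b) => [y t] /=.
have [ts|st'] := leP t s.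
  have [m em] := int_le_add ts.
  rewrite em -(sine_kernel_geE ht0 htT0 hx0 hxl hxt hxS phi1 phi3) /=.
  apply: (near_eq_cvg_to _ (kernel_ge_cvg hN0 hS0 hST0 ht0 htT0 hx0 hxl hxt hxS sN sS sT (st t) sX
    hmodel phi1 phi2 phi3 (m := m) (z := x) (y := y))).
  near=> rho.
  have [Np ST] : (1 <= N rho)%N /\ (S rho <= T rho)%N by near: rho.
  have e1 : Num.floor (rho * t0) + s = (time s rho)%:Z by near: rho; exact: near_time.
  have e2 : Num.floor (rho * t0) + t = (time t rho)%:Z by near: rho; exact: near_time.
  have A : (time (pts b).2 rho + m = time (pts a).2 rho)%N.
    by rewrite ea eb /=; move: e1; rewrite {1}em addrA e2 -PoszD => -[].
  have B : (time (pts a).2 rho <= T rho)%N by rewrite ea; near: rho; exact: near_time_le.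
  have C : in_slice (N rho) (T rho) (S rho) (time (pts b).2 rho) (X rho + (pts b).1).
    rewrite eb; near: rho.
    exact: (near_slice hN0 hS0 hST0 ht0 htT0 hx0 hxl hxt hxS sN sS sT (st t) sX hmodel).
  by rewrite (@kernel_mx_ge R _ _ _ Np ST _ _ (fun a => X rho + (pts a).1) a b m A B C) ea eb.
have [m em] := int_lt_add st'.
rewrite em -(sine_kernel_ltE hx0 hxl hxt hxS phi1).
apply: (near_eq_cvg_to _ (kernel_lt_cvg hN0 hS0 hST0 ht0 htT0 hx0 hxl hxt hxS sN sS sT (st t) sX
    hmodel phi1 phi2 phi3 (j := m.+1) (z := x) (y := y))).
near=> rho.
have [Np ST] : (1 <= N rho)%N /\ (S rho <= T rho)%N by near: rho.
have e1 : Num.floor (rho * t0) + s = (time s rho)%:Z by near: rho; exact: near_time.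
have e2 : Num.floor (rho * t0) + t = (time t rho)%:Z by near: rho; exact: near_time.
have A : (time (pts a).2 rho + m.+1 = time (pts b).2 rho)%N.
  by rewrite ea eb /=; move: e2; rewrite {1}em addrA e1 -PoszD => -[].
have B : (time (pts b).2 rho <= T rho)%N by rewrite eb; near: rho; exact: near_time_le.
have C : in_slice (N rho) (T rho) (S rho) (time (pts b).2 rho) (X rho + (pts b).1).
  rewrite eb; near: rho.
  exact: (near_slice hN0 hS0 hST0 ht0 htT0 hx0 hxl hxt hxS sN sS sT (st t) sX hmodel).
by rewrite (@kernel_mx_lt R _ _ _ Np ST _ _ (fun a => X rho + (pts a).1) a b m A B C) ea eb.
Unshelve. all: by end_near. Qed.

Lemma hit_prob_cvg n (pts : 'I_n -> int * int) : injective pts ->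
  exists2 d : R, hit_prob R (N rho) (T rho) (S rho) (Num.floor (rho * x0)) (Num.floor (rho * t0)) pts
    @[rho --> +oo] --> d & correlation_det (sine_kernel c phi) pts = d%:C.
Proof.
move=> inj; have [phi1 phi2 phi3] := kernel_phiP.
have c0 : c != 0 by rewrite gt_eqF// cratio_gt0.
pose L : 'M[R]_n := \matrix_(a, b)
  complex.Re ((c ^ ((pts a).1 - (pts b).1))%:C * sine_kernel c phi (pts a) (pts b)).
exists (\det L).
  apply: (near_eq_cvg_to (g := fun rho => \det (kernel_mx R (N rho) (T rho) (S rho)
      (fun a => time (pts a).2 rho) (fun a => X rho + (pts a).1)))); last first.
    by apply: det_cvg => a b; rewrite mxE; exact: kernel_mx_cvg.
  have h1 : \forall rho \near +oo, forall a, Num.floor (rho * t0) + (pts a).2 = (time (pts a).2 rho)%:Z.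
    by apply: filter_forall => a; exact: near_time.
  have h2 : \forall rho \near +oo, forall a, (time (pts a).2 rho <= T rho)%N.
    by apply: filter_forall => a; exact: near_time_le.
  near=> rho; have [Np ST] : (1 <= N rho)%N /\ (S rho <= T rho)%N by near: rho.
  by apply: hit_prob_det => //; near: rho.
have LC a b : (L a b)%:C = (c ^ (pts a).1)%:C / (c ^ (pts b).1)%:C * sine_kernel c phi (pts a) (pts b).
  have -> : (c ^ (pts a).1)%:C / (c ^ (pts b).1)%:C = (c ^ ((pts a).1 - (pts b).1))%:C :> R[i].
    by rewrite expfzDr// rmorphM -invr_expz fmorphV.
  rewrite mxE; case: (pts a) (pts b) => [x s] [y t] /=.
  have [ts|st'] := leP t s.
    have [m ->] := int_le_add ts.
    by rewrite -(sine_kernel_geE ht0 htT0 hx0 hxl hxt hxS phi1 phi3).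
  have [m ->] := int_lt_add st'.
  by rewrite -(sine_kernel_ltE hx0 hxl hxt hxS phi1).
rewrite -det_map_mx /correlation_det -(@det_gauge _ _ _ (fun a => (c ^ (pts a).1)%:C)).
  by apply: (congr1 (@determinant _ _)); apply/matrixP => a b; rewrite [LHS]mxE [RHS]mxE -LC.
by move=> a; rewrite fmorph_eq0 expfz_neq0.
Unshelve. all: by end_near. Qed.

End Assembly.

(** * The limit process *)

(** The points of the plane are enumerated, and convergence of the
    correlation functions gives that of the word probabilities. A list of
    points may have repetitions, also because the enumeration need not be
    injective; undup removes them. *)
Lemma exists_process (R : realType) (F : R -> finType) (A : forall rho, {set F rho})
    (occ : forall rho, F rho -> int * int -> bool) (K : int * int -> int * int -> R[i]) :
  (\forall rho \near +oo, (0 < #|A rho|)%N) ->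
  (forall n (pts : 'I_n -> int * int), injective pts ->
    exists2 d : R, Defs.uniform_prob R (A rho) (fun f => [forall i, occ rho f (pts i)])
      @[rho --> +oo] --> d & correlation_det K pts = d%:C) ->
  exists (d : measure_display) (Omega : measurableType d)
     (P : probability Omega R) (X : Omega -> set (int * int)),
     point_process P X /\ determinantal P X K.
Proof.
move=> A0 H; pose e k : int * int := odflt (0, 0) (unpickle k).
have eK : cancel pickle e by move=> q; rewrite /e pickleK.
pose oc rho (f : F rho) k := occ rho f (e k).
have allE (U : seq nat) : exists n, exists2 pts : 'I_n -> int * int, injective pts &
    forall rho f, all (oc rho f) U = [forall i, occ rho f (pts i)].
  pose V := undup (map e U); exists (size V); exists (fun i => nth (0, 0) V i).
    by move=> i j /eqP; rewrite nth_uniq ?undup_uniq// => /eqP/val_inj.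
  move=> rho f; rewrite -[LHS](all_map e) -(@eq_all_r _ V) => [|q]; last by rewrite mem_undup.
  apply/(all_nthP (0, 0))/forallP => [h i|h i iV]; first exact: h.
  exact: (h (Ordinal iV)).
have cv (U : seq nat) : cvg (Defs.uniform_prob R (A rho) (fun f => all (oc rho f) U) @[rho --> +oo]).
  have [n [pts inj ptsE]] := allE U; have [d dl _] := H n pts inj.
  apply/cvg_ex; exists d; apply: (near_eq_cvg_to _ dl); apply: nearW => rho.
  exact: eq_uniform_prob.
have [X [mX PX]] := process_of_limits A0 cv.
exists _, _, (uniform_prob (@ltr01 R)), (fun w q => X w (pickle q)); split => [q|n pts n0 inj].
  exact: mX.
have [d dl ->] := H n pts inj; congr (_%:C).
pose U := [seq pickle (pts i) | i <- enum 'I_n].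
rewrite (_ : mkset _ = [set w | forall k, k \in U -> X w k]); last first.
  apply/seteqP; split => w h.
    by move=> k /mapP[i _ ->].
  by move=> i; apply: h; apply/mapP; exists i => //; rewrite mem_enum.
rewrite PX; last by rewrite size_map size_enum_ord.
apply: cvg_lim => //; apply: (near_eq_cvg_to _ dl); apply: nearW => rho.
apply: eq_uniform_prob => f; rewrite all_map; apply/allP/forallP => [h i|h i _].
  by have := h i; rewrite mem_enum /= /oc eK; apply.
by rewrite /= /oc eK.
Qed.

Theorem theorem1 (R : realType) (N0 S0 T0 t0 x0 : R)
  (hN0 : 0 < N0) (hS0 : 0 < S0) (hST0 : S0 < T0)
  (ht0 : 0 < t0) (htT0 : t0 < T0)
  (hx_low : Num.max 0 (t0 + S0 - T0) < x0)
  (hx_up : x0 < N0 + Num.min t0 S0)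
  (N S T : R -> nat)
  (hmodel : \forall rho \near +oo, (1 <= N rho)%N /\ (S rho <= T rho)%N)
  (hS : (fun rho => (S rho)%:R - rho * S0) =o_ +oo (fun rho : R => rho))
  (hT : (fun rho => (T rho)%:R - rho * T0) =o_ +oo (fun rho : R => rho))
  (hN : (fun rho => (N rho)%:R - rho * N0) =o_ +oo (fun rho : R => rho)) :
  let K := sine_kernel (kernel_c N0 T0 S0 t0 x0) (kernel_phi N0 T0 S0 t0 x0) in
  (forall (n : nat) (pts : 'I_n -> int * int), (0 < n)%N -> injective pts ->
     ((hit_prob R (N rho) (T rho) (S rho)
         (Num.floor (rho * x0)) (Num.floor (rho * t0)) pts)%:C : R[i]^o)
       @[rho --> +oo] --> (correlation_det K pts : R[i]^o))
  /\
  (exists (d : measure_display) (Omega : measurableType d)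
     (P : probability Omega R) (X : Omega -> set (int * int)),
     point_process P X /\ determinantal P X K).
Proof.
move: hx_low hx_up; rewrite gt_max => /andP[hx0 hxl] hx_up'.
have hxt : x0 < N0 + t0 by apply: lt_le_trans hx_up' _; rewrite lerD2l ge_min lexx.
have hxS : x0 < N0 + S0 by apply: lt_le_trans hx_up' _; rewrite lerD2l ge_min lexx orbT.
have sN := scaled_littleo hN; have sS := scaled_littleo hS; have sT := scaled_littleo hT.
rewrite kernel_cE => K.
have H n (pts : 'I_n -> int * int) : injective pts ->
  exists2 d : R, hit_prob R (N rho) (T rho) (S rho) (Num.floor (rho * x0)) (Num.floor (rho * t0)) pts
    @[rho --> +oo] --> d & correlation_det K pts = d%:C.
  exact: (hit_prob_cvg hN0 hS0 hST0 ht0 htT0 hx0 hxl hxt hxS sN sS sT hmodel).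
split => [n pts _ inj|].
  by have [d dl ->] := H n pts inj; exact: cvg_real_complex.
apply: (exists_process (A := fun rho => nonintersecting (N rho) (T rho) (S rho))
  (occ := fun rho p q => in_H p (Num.floor (rho * t0) + q.2) (Num.floor (rho * x0) + q.1))) => //.
by apply: filterS hmodel => rho [_ ST]; exact: card_nonintersecting_gt0.
Qed.
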